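(* Let $M$ be a stationary positive weighted point measure on $\mathbb R$ of intensity $K\in(0,\infty)$, and suppose there is a finite nonnegative measurable function $h$ on $[1,\infty)$ such that \[ \mathbb E|N_M(x)-Kx|\le h(|x|)\quad(|x|\ge1),\qquad\int_1^\infty\frac{h(r)}{r^2}\,dr<\infty. \] Then, almost surely, for every real $s\notin\operatorname{supp}M$, \[ \int_{[s-L,s+R]}\frac{dM(x)}{s-x}-K\log\frac LR\longrightarrow F_M(s)\qquad(L,R\to\infty). \] In particular, if $L_n,R_n\to\infty$ and $\log(L_n/R_n)\to\ell\in\mathbb R$, then, for every deterministic $s\in\mathbb R$, \[ \frac1{\pi K}\int_{[s-L_n,s+R_n]}\frac{dM(x)}{s-x}\ \Longrightarrow\ \mathrm{Cauchy}(\ell/\pi,1). \]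
   Context: A positive weighted point measure is a measure $M=\sum_{x\in X}w_x\delta_x$ on $\mathbb R$ with $X=\operatorname{supp}M$ locally finite and $w_x>0$. Random measures are random elements of the space of such measures with its vague Borel sigma-algebra. $\theta_tM(B)=M(B+t)$; $M$ is stationary if $\theta_tM$ has the law of $M$ for every $t\in\mathbb R$; the intensity is $K=\mathbb E M((0,1])$. $N_M(x)=M((0,x])$ for $x\ge0$ and $N_M(x)=-M((x,0])$ for $x<0$. Under the hypotheses, almost surely the limit $F_M(s)=\lim_{A\to\infty}\int_{[-A,A]}\frac{dM(x)}{s-x}$ exists for every $s\notin\operatorname{supp}M$; a deterministic $s$ is almost surely outside the support. $L,R\to\infty$ is independently (no relation between $L$ and $R$). $\mathrm{Cauchy}(a,b)$ is the law of $a+bX$ with $X$ having density $[\pi(1+x^2)]^{-1}$; $\Longrightarrow$ is convergence in distribution. *)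

(* Defs.v *)
From HB Require Import structures.
From mathcomp Require Import all_boot all_order all_algebra.
From mathcomp Require Import all_classical all_reals all_analysis.
From mathcomp Require Import measurable_realfun.

Set Implicit Arguments.
Unset Strict Implicit.
Unset Printing Implicit Defensive.

Import Order.TTheory GRing.Theory Num.Def Num.Theory.
Import numFieldNormedType.Exports.

Local Open Scope classical_set_scope.
Local Open Scope ring_scope.

Section weighted_point_measure.
Context {R : realType}.

Definition supp (mu : set R -> \bar R) : set R :=
  [set x | forall U : set R, open U -> U x -> (0 < mu U)%E].

Definition locally_finite (X : set R) : Prop :=
  forall a b : R, finite_set (X `&` `[a, b]).

Definition is_weighted_point_measure (mu : set R -> \bar R) : Prop :=
  locally_finite (supp mu) /\
  exists w : R -> R, (forall x, supp mu x -> 0 < w x) /\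
    forall B : set R, measurable B ->
      mu B = (\esum_(x in supp mu) ((w x)%:E * \d_x B))%E.

Record wpm := Wpm {
  wpm_measure :> {measure set R -> \bar R} ;
  wpmP : is_weighted_point_measure wpm_measure }.

End weighted_point_measure.
Arguments wpm : clear implicits.

Section wpm_zero.
Context {R : realType}.

Let supp_mzero : supp (@mzero _ R R) = set0.
Proof.
rewrite -subset0 => x /(_ setT openT I) /=.
by rewrite /mzero ltxx.
Qed.

Let is_wpm_mzero : is_weighted_point_measure (@mzero _ R R).
Proof.
split; first by move=> a b; rewrite supp_mzero set0I; exact: finite_set0.
exists (fun=> 1); split; first by rewrite supp_mzero.
by move=> B mB; rewrite supp_mzero esum_set0.
Qed.

Definition wpm0 : wpm R := Wpm is_wpm_mzero.

End wpm_zero.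

Section vague_topology.
Context {R : realType}.

HB.instance Definition _ := gen_eqMixin (wpm R).
HB.instance Definition _ := gen_choiceMixin (wpm R).
HB.instance Definition _ := isPointed.Build (wpm R) wpm0.

(** The vague topology: the coarsest one for which [mu |-> \int[mu]_x f x] is
    continuous for every continuous compactly supported [f]. *)
Definition vague_subbase : set (set (wpm R)) :=
  [set A | exists f : R -> R, exists U : set R,
    [/\ continuous f, compact (closure [set x | f x != 0]), open U &
        A = [set mu : wpm R | U (\int[mu]_x f x)%R]]].

HB.instance Definition _ :=
  @isSubBaseTopological.Build (wpm R) (set (wpm R)) vague_subbase id.

Definition wpm_display : measure_display :=
  sigma_display (@open (wpm R)).

HB.instance Definition _ := @isMeasurable.Build wpm_display (wpm R)
  <<s @open (wpm R) >> (@sigma_algebra0 _ setT _)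
  (@sigma_algebraC (wpm R) _) (@sigma_algebra_bigcup _ setT _).

End vague_topology.

Section translation.
Context {R : realType} (t : R).

Definition translate_measure (mu : {measure set R -> \bar R}) :
  set R -> \bar R := pushforward mu (fun x => x - t).

Section measure.
Variable mu : {measure set R -> \bar R}.

Let measurable_shift : measurable_fun [set: R] (fun x : R => x - t).
Proof. by apply: measurable_funD => //; exact: measurable_cst. Qed.

Let translate0 : translate_measure mu set0 = 0%E.
Proof. by rewrite /translate_measure /pushforward preimage_set0 measure0. Qed.

Let translate_ge0 A : (0 <= translate_measure mu A)%E.
Proof. exact: measure_ge0. Qed.

Let translate_sigma_additive : semi_sigma_additive (translate_measure mu).
Proof.
move=> F mF tF mUF; rewrite /translate_measure /pushforward preimage_bigcup.
apply: measure_semi_sigma_additive.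
- by move=> n; rewrite -[X in measurable X]setTI; exact: measurable_shift.
- apply/trivIsetP => /= i j _ _ ij; rewrite -preimage_setI.
  by move/trivIsetP : tF => /(_ _ _ _ _ ij) ->//; rewrite preimage_set0.
- by rewrite -preimage_bigcup -[X in measurable X]setTI; exact: measurable_shift.
Qed.

HB.instance Definition _ := isMeasure.Build _ _ _ (translate_measure mu)
  translate0 translate_ge0 translate_sigma_additive.

End measure.

Let supp_translate (mu : {measure set R -> \bar R}) :
  supp (translate_measure mu) = [set x | supp mu (x + t)].
Proof.
apply/seteqP; split => x /= sx U oU Ux.
- suff -> : mu U = translate_measure mu ((fun y => y + t) @^-1` U).
    apply: sx => //; apply: open_comp => // y _.
    by apply: cvgD; [exact: cvg_id|exact: cvg_cst].
  rewrite /translate_measure /pushforward; congr (mu _).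
  by apply/seteqP; split => y /=; rewrite subrK.
- apply: sx; last by rewrite /preimage/= addrK.
  apply: open_comp => // y _.
  by apply: cvgB; [exact: cvg_id|exact: cvg_cst].
Qed.

Let is_wpm_translate (mu : wpm R) :
  is_weighted_point_measure (translate_measure mu).
Proof.
have [lf [w [w0 muE]]] := wpmP mu.
rewrite /is_weighted_point_measure supp_translate; split.
  move=> a b.
  apply: (@sub_finite_set _ _
      ((fun x => x - t) @` (supp mu `&` `[a + t, b + t]))).
    move=> x [/= sx]; rewrite in_itv/= => /andP[ax xb].
    exists (x + t); last by rewrite addrK.
    by split => //=; rewrite in_itv/= !lerD2r ax.
  exact/finite_image/lf.
exists (fun x => w (x + t)); split; first by move=> x /w0.
move=> B mB; rewrite /translate_measure /pushforward muE; last first.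
  rewrite -[X in measurable X]setTI.
  by apply: measurable_funD => //; exact: measurable_cst.
rewrite (reindex_esum [set x | supp mu (x + t)] _ (fun x => x + t)).
  apply: eq_esum => x _; congr (_ * _)%E; rewrite !diracE.
  congr (nat_of_bool _)%:R%:E; apply: asbool_equiv_eq.
  by rewrite /preimage/= addrK.
split => //=.
- by move=> x y _ _; exact: addIr.
- by move=> x sx; exists (x - t); rewrite /= subrK.
Qed.

Definition translate (mu : wpm R) : wpm R := Wpm (is_wpm_translate mu).

Lemma translateE (mu : wpm R) (B : set R) :
  translate mu B = mu [set x + t | x in B].
Proof.
rewrite /translate/= /translate_measure /pushforward; congr (mu _).
apply/seteqP; split => x /=; first by move=> Bx; exists (x - t); rewrite ?subrK.
by move=> [y By <-]; rewrite addrK.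
Qed.

End translation.

Section random_measure.
Context d {T : measurableType d} {R : realType} (P : probability T R).

Definition stationary (M : {RV P >-> wpm R}) : Prop :=
  forall (t : R) (B : set (wpm R)), measurable B ->
    pushforward P (translate t \o M) B = distribution P M B.

Definition intensity (M : {RV P >-> wpm R}) : \bar R :=
  (\int[P]_omega M omega `]0%R, 1%R]%classic)%E.

End random_measure.

Section counting_and_transform.
Context {R : realType}.

(** [fine] loses nothing on a weighted point measure, which is finite on
    bounded sets. *)
Definition counting_fun (mu : set R -> \bar R) (x : R) : R :=
  if 0 <= x then fine (mu `]0, x]%classic) else - fine (mu `]x, 0]%classic).

(** When [s] is an atom of [mu], its (junk) contribution is [0^-1 = 0]. *)
Definition truncated_transform (mu : wpm R) (a b s : R) : R :=
  \int[mu]_(x in `[a, b]) (s - x)^-1.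

Definition transform (mu : wpm R) (s : R) : R :=
  lim (truncated_transform mu (- A) A s @[A --> +oo]).

End counting_and_transform.

Section cauchy_law.
Context {R : realType}.

Definition std_cauchy_pdf (x : R) : R := (pi * (1 + x ^+ 2))^-1.

Let std_cauchy_pdfE : std_cauchy_pdf = (fun x => pi^-1 * (oneDsqr x)^-1).
Proof. by apply/funext => x; rewrite /std_cauchy_pdf invfM. Qed.

Let std_cauchy_pdf_ge0 x : 0 <= std_cauchy_pdf x.
Proof. by rewrite invr_ge0 mulr_ge0 ?pi_ge0// addr_ge0// sqr_ge0. Qed.

Let continuous_std_cauchy_pdf : continuous std_cauchy_pdf.
Proof.
rewrite std_cauchy_pdfE => x.
by apply: cvgM; [exact: cvg_cst|exact: continuous_oneDsqrV].
Qed.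

Let measurable_std_cauchy_pdf :
  measurable_fun [set: R] (EFin \o std_cauchy_pdf).
Proof.
by apply/measurable_EFinP; exact: continuous_measurable_fun.
Qed.

Let integral_std_cauchy_pdf :
  (\int[@lebesgue_measure R]_x (std_cauchy_pdf x)%:E = 1)%E.
Proof.
rewrite ge0_symfun_integralT//; last first.
  by move=> x; rewrite /std_cauchy_pdf /= sqrrN.
rewrite (_ : [set x | _] = `[0, +oo[%classic); last first.
  by apply/seteqP; split => x/=; rewrite in_itv/= andbT.
rewrite std_cauchy_pdfE.
under eq_integral do rewrite EFinM.
rewrite ge0_integralZl//=.
- rewrite integral0y_oneDsqr -!EFinM; congr EFin.
  by rewrite mulKf ?gt_eqF ?pi_gt0 ?divff.
- apply/measurable_EFinP/measurable_funTS.
  by apply: continuous_measurable_fun; exact: continuous_oneDsqrV.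
- by rewrite lee_fin invr_ge0 pi_ge0.
Qed.

Definition std_cauchy (V : set R) : \bar R :=
  (\int[lebesgue_measure]_(x in V) (std_cauchy_pdf x)%:E)%E.

Let std_cauchy0 : std_cauchy set0 = 0%E.
Proof. by rewrite /std_cauchy integral_set0. Qed.

Let std_cauchy_ge0 A : (0 <= std_cauchy A)%E.
Proof. by apply: integral_ge0 => x _; rewrite lee_fin. Qed.

Let std_cauchy_sigma_additive : semi_sigma_additive std_cauchy.
Proof.
move=> /= F mF tF mUF; rewrite /std_cauchy; apply: cvg_toP.
  apply: ereal_nondecreasing_is_cvgn => m n mn.
  apply: lee_sum_nneg_natr => // k _ _; apply: integral_ge0 => /= x Fkx.
  by rewrite lee_fin.
rewrite ge0_integral_bigcup//=.
- exact/measurable_funTS.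
- by move=> x _; rewrite lee_fin.
Qed.

HB.instance Definition _ := isMeasure.Build _ _ _
  std_cauchy std_cauchy0 std_cauchy_ge0 std_cauchy_sigma_additive.

Let std_cauchy_setT : std_cauchy [set: R] = 1%E.
Proof. exact: integral_std_cauchy_pdf. Qed.

HB.instance Definition _ :=
  @Measure_isProbability.Build _ _ R std_cauchy std_cauchy_setT.

Definition affine_map (a b x : R) : R := a + b * x.

Let measurable_affine_map a b : measurable_fun [set: R] (affine_map a b).
Proof. by apply: measurable_funD => //; exact: measurable_funM. Qed.

HB.instance Definition _ a b :=
  isMeasurableFun.Build _ _ _ _ (affine_map a b) (measurable_affine_map a b).

Definition cauchy_prob (a b : R) : probability R R :=
  distribution std_cauchy (affine_map a b).

End cauchy_law.

Definition converges_in_distribution d (T : measurableType d) (R : realType)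
    (P : probability T R) (X : nat -> T -> R) (nu : probability R R) : Prop :=
  (forall n, measurable_fun [set: T] (X n)) /\
  forall f : R -> R, continuous f -> bounded_fun f ->
    ('E_P[f \o X n])%E @[n --> \oo] --> (\int[nu]_y (f y)%:E)%E.

(* Main.v *)
Require Import Defs.
From HB Require Import structures.
From mathcomp Require Import all_boot all_order all_algebra.
From mathcomp Require Import all_classical all_reals all_analysis.
From mathcomp Require Import measurable_realfun complex ring lra zify.

(** Why the theorem holds.  For [z = s + i y] let [F z] be the limit over large
    windows of the integral of [1 / (z - x)] against the random measure.  Its
    real part comes from the kernel [kerU s y], the opposite of its imaginary
    part from [kerV s y].

    Convergence of the windows is deterministic once the discrepancy
    [D j = N j - K j] satisfies [sum_j |D j| / (j + 1) ^ 2 < oo] on both sides of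
    the origin; this is [regular], and it holds almost surely because the
    expectation of that sum is controlled by the integral of [h r / r ^ 2]
    ([ae_regular]).  Monotonicity of the counting function then forces
    [D j = o(j)] ([discrepancy_o]), and summation by parts over unit cells
    compares the integral of the kernel over a half-line with [K] times its
    primitive ([half_line_cvg]).  The two logarithms so produced combine into
    [K ln (L / R)], and moving the point away from [i] changes the kernel by
    [O (1 / (1 + x ^ 2))] only ([kerU_window_cvg]).  This is the first half of
    the theorem ([transform_cvg]).

    For the law, fix [a + i b] with [b > 0].  [F] maps the upper half-plane to
    the lower one, so [G z = (a + i b - F z)^-1] is holomorphic there and is
    bounded by [1 / b].  The Cauchy-Riemann equations express the vertical
    derivative of [Im G] as the horizontal derivative of [Re G], whose
    expectation vanishes since the law of [F (s + i y)] does not depend on [s].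
    Hence the expectation of [Im G (s + i y)] is constant in [y].  The argument
    is carried out with finite increments and an error of second order that is
    uniform over all finite measures ([resolvent_cauchy_riemann]), so that it
    passes to the limit of the windows and to the expectation.  When
    [y] tends to infinity [F (i y)] tends to [- i pi K] ([far_limit]); when [y]
    tends to 0 at a point [s] off the support, which is almost surely the case
    ([no_fixed_atom]), it tends to [F s] ([near_limit]).  Comparing both ends
    ([expected_resolvent]), [F s / (pi K)] has the Poisson integrals of the
    standard Cauchy law.  Integrating them in [a] and letting [b] tend to 0
    identifies its law ([distribution_cauchy]).  The window [s - L_n, s + R_n]
    adds [K l] to the limit, whence the Cauchy law centred at [l / pi]. *)

Set Implicit Arguments.
Unset Strict Implicit.
Unset Printing Implicit Defensive.

Import Order.TTheory GRing.Theory Num.Def Num.Theory.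
Import numFieldNormedType.Exports.

Local Open Scope classical_set_scope.
Local Open Scope ring_scope.

(** * The resolvent of a finite Cauchy transform *)

Section kernels.
Context {R : realType}.
Implicit Types (s y x a b U V : R).

(** Real part, and below it the opposite of the imaginary part, of
    [1 / (s + i y - x)]. For [y = 0] the value at [x = s] is 0. *)
Definition kerU s y x := (s - x) / ((s - x) ^+ 2 + y ^+ 2).
Definition kerV s y x := y / ((s - x) ^+ 2 + y ^+ 2).

(** Real part, and below it the opposite of the imaginary part, of
    [1 / (a + i b - F)] when [F = U - i V]. *)
Definition resU a b U V := (a - U) / ((a - U) ^+ 2 + (b + V) ^+ 2).
Definition resV a b U V := (b + V) / ((a - U) ^+ 2 + (b + V) ^+ 2).

End kernels.

Section cauchy_riemann.
Context {R : realType}.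
Local Open Scope complex_scope.
Import ComplexField.Normc.
Implicit Types (X : seq R) (w : R -> R) (z : R[i]).

Lemma normc_ge0 z : 0 <= normc z.
Proof. by case: z => u v; rewrite /normc sqrtr_ge0. Qed.

Lemma normc_eq0 z : (normc z == 0) = (z == 0).
Proof.
apply/eqP/eqP => [/eq0_normc //|->]; exact: normc0.
Qed.

Lemma normc_ge_Im z : `|complex.Im z| <= normc z.
Proof.
by case: z => u v /=; rewrite -sqrtr_sqr ler_wsqrtr// lerDr sqr_ge0.
Qed.

Lemma normc_sum (I : Type) (r : seq I) (F : I -> R[i]) :
  normc (\sum_(i <- r) F i) <= \sum_(i <- r) normc (F i).
Proof.
elim/big_ind2 : _ => //; first by rewrite normc0.
by move=> a b c d ac bd; apply: (le_trans (le_normcD _ _)); exact: lerD.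
Qed.

Lemma normcX z n : normc (z ^+ n) = normc z ^+ n.
Proof.
elim: n => [|n IH]; first by rewrite !expr0 normc1.
by rewrite !exprS normcM IH.
Qed.

Lemma normc_real (u : R) : 0 <= u -> normc u%:C = u.
Proof. by move=> u0; rewrite /normc /= expr0n addr0 sqrtr_sqr ger0_norm. Qed.

(** Working with one complex function avoids separate estimates for the two
    real kernels. *)
Definition ctransform X w z : R[i] := \sum_(x <- X) (w x)%:C / (z - x%:C).

Lemma ctransformE X w (s y : R) :
  ctransform X w (s +i* y) =
  (\sum_(x <- X) w x * kerU s y x) +i* (- \sum_(x <- X) w x * kerV s y x).
Proof.
rewrite /ctransform; elim: X => [|x X IH]; first by rewrite !big_nil oppr0.
rewrite !big_cons IH /kerU /kerV; by simpc.
Qed.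

Lemma resolventE (a b U V : R) :
  ((a +i* b) - (U +i* (- V)))^-1 = resU a b U V +i* (- resV a b U V).
Proof.
by rewrite /resU /resV; simpc.
Qed.

(** The imaginary part of the transform is nonpositive in the upper half-plane,
    so that the resolvent has no pole there, and the larger its modulus the
    smaller the resolvent. *)
Lemma normc_resolvent_ge X w (s y a b : R) : (forall x, x \in X -> 0 <= w x) ->
  0 <= y -> 0 < b ->
  b + \sum_(x <- X) w x * kerV s y x <=
    normc ((a +i* b) - ctransform X w (s +i* y)).
Proof.
move=> w0 y0 b0; apply: le_trans (normc_ge_Im _).
by rewrite ctransformE; simpc => /=; rewrite ?opprK ler_norm.
Qed.

Lemma sum_kerV_ge0 X w (s y : R) : (forall x, x \in X -> 0 <= w x) ->
  0 <= y -> 0 <= \sum_(x <- X) w x * kerV s y x.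
Proof.
move=> w0 y0; rewrite big_seq; apply: sumr_ge0 => x xX.
by rewrite mulr_ge0 ?w0// divr_ge0// addr_ge0// sqr_ge0.
Qed.

Lemma kerV_normc (s y x : R) : kerV s y x = y / normc ((s +i* y) - x%:C) ^+ 2.
Proof.
by rewrite /kerV; simpc; rewrite /normc sqr_sqrtr// addr_ge0// sqr_ge0.
Qed.

(** The last term on the left is the derivative of [G] at [z] times
    [z' - z], up to sign. The bound involves neither the number nor the masses
    of the atoms: with [V] the opposite of the imaginary part of the transform
    at [z], the increment of the transform is at most [2 e V / y], whereas [G z]
    is at most [1 / (b + V)], and [V / (b + V) <= 1]. *)
Lemma resolvent_taylor X w (s y a b : R) (z' : R[i]) (e : R) :
  let z := s +i* y in
  let G t := ((a +i* b) - ctransform X w t)^-1 in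
  (forall x, x \in X -> 0 <= w x) -> 0 < y -> 0 < b -> y <= complex.Im z' ->
  normc (z' - z) = e ->
  (forall x : R, normc (z - x%:C) <= 2 * normc (z' - x%:C)) ->
  normc (G z' - G z
    + (z' - z) * (\sum_(x <- X) (w x)%:C / (z - x%:C) ^+ 2) * G z ^+ 2)
    <= 5 * e ^+ 2 / (b * y ^+ 2).
Proof.
move=> z G w0 y0 b0 yz' ez cmp.
set S := \sum_(x <- X) _.
set V := \sum_(x <- X) w x * kerV s y x.
have V0 : 0 <= V by apply: sum_kerV_ge0 => //; exact: ltW.
have nz (x : R) : y <= normc (z - x%:C).
  by apply: le_trans (normc_ge_Im _); rewrite /z; simpc => /=; rewrite ler_norm.
have nz' (x : R) : y <= normc (z' - x%:C).
  apply: le_trans (normc_ge_Im _); case: z' yz' {ez cmp} => p q /= yq.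
  by rewrite subr0; apply: le_trans yq (ler_norm _).
have zx (x : R) : z - x%:C != 0 by rewrite -normc_eq0 gt_eqF// (lt_le_trans y0).
have z'x (x : R) : z' - x%:C != 0 by rewrite -normc_eq0 gt_eqF// (lt_le_trans y0).
have VE : V / y = \sum_(x <- X) w x / normc (z - x%:C) ^+ 2.
  rewrite /V mulr_suml; apply: eq_bigr => x _; rewrite kerV_normc -/z.
  have n0 : normc (z - x%:C) != 0 by rewrite normc_eq0.
  by field; rewrite n0 gt_eqF.
have e0 : 0 <= e by rewrite -ez normc_ge0.
set F := ctransform X w z; set F' := ctransform X w z'.
set lam := a +i* b.
have F0 : b + V <= normc (lam - F) by apply: normc_resolvent_ge => //; exact: ltW.
have F'0 : b <= normc (lam - F').
  have zE : z' = complex.Re z' +i* complex.Im z' by case: (z').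
  rewrite /F' [X in ctransform _ _ X]zE.
  apply: le_trans (normc_resolvent_ge _ _ w0 _ b0); last exact: ltW (lt_le_trans y0 _).
  by rewrite lerDl sum_kerV_ge0// ltW// (lt_le_trans y0).
have bV : 0 < b + V by rewrite ltr_wpDr.
have lF : lam - F != 0 by rewrite -normc_eq0 gt_eqF// (lt_le_trans bV).
have lF' : lam - F' != 0 by rewrite -normc_eq0 gt_eqF// (lt_le_trans b0).
have dF : F' - F = - (z' - z) * \sum_(x <- X) (w x)%:C / ((z - x%:C) * (z' - x%:C)).
  rewrite /F /F' /ctransform -sumrB mulr_sumr; apply: eq_bigr => x _.
  by field; rewrite zx z'x.
have ndF : normc (F' - F) <= 2 * e * (V / y).
  rewrite dF normcM normcN ez [leRHS](_ : _ = e * (V / y * 2)); last by ring.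
  rewrite ler_wpM2l// VE mulr_suml.
  apply: le_trans (normc_sum _ _) _; rewrite big_seq [leRHS]big_seq.
  apply: ler_sum => x xX; rewrite normcM normc_real ?w0// -mulrA.
  rewrite ler_wpM2l ?w0// normcV normcM.
  have p1 : 0 < normc (z - x%:C) by rewrite (lt_le_trans y0).
  have p2 : 0 < normc (z' - x%:C) by rewrite (lt_le_trans y0).
  have -> : (normc (z - x%:C) * normc (z' - x%:C))^-1 =
      (normc (z - x%:C) ^+ 2)^-1 * (normc (z - x%:C) / normc (z' - x%:C)).
    by field; rewrite !gt_eqF.
  by rewrite ler_wpM2l ?invr_ge0 ?sqr_ge0// ler_pdivrMr.
have ndF2 : normc (F' - F + (z' - z) * S) <= e ^+ 2 * (V / y / y).
  (* [1 / (z' - x) - 1 / (z - x)] minus its linear part, summed over the atoms. *)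
  have -> : F' - F + (z' - z) * S = (z' - z) ^+ 2 *
      \sum_(x <- X) (w x)%:C / ((z - x%:C) ^+ 2 * (z' - x%:C)).
    rewrite dF expr2 -mulrA mulNr addrC -mulrBr /S -sumrB; congr (_ * _).
    by rewrite mulr_sumr; apply: eq_bigr => x _; field; rewrite zx z'x.
  rewrite normcM normcX ez ler_wpM2l ?exprn_ge0// VE mulr_suml.
  apply: le_trans (normc_sum _ _) _; rewrite big_seq [leRHS]big_seq.
  apply: ler_sum => x xX; rewrite normcM normc_real ?w0// -mulrA.
  rewrite ler_wpM2l ?w0// normcV normcM normcX -invfM.
  have p1 : 0 < normc (z - x%:C) by rewrite (lt_le_trans y0).
  have p2 : 0 < normc (z' - x%:C) by rewrite (lt_le_trans y0).
  by rewrite lef_pV2 ?posrE ?mulr_gt0 ?exprn_gt0// ler_pM2l ?exprn_gt0.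
(* Second order resolvent identity: the increment of the transform enters once
   squared and once with its linear part removed. *)
have -> : G z' - G z + (z' - z) * S * G z ^+ 2 =
    (F' - F) ^+ 2 * G z ^+ 2 * G z' + (F' - F + (z' - z) * S) * G z ^+ 2.
  by rewrite /G -/lam -/F -/F'; field; rewrite lF lF'.
have nG : normc (G z) <= (b + V)^-1.
  by rewrite /G normcV lef_pV2 ?posrE// (lt_le_trans bV).
have nG' : normc (G z') <= b^-1.
  by rewrite /G normcV lef_pV2 ?posrE// (lt_le_trans b0).
apply: le_trans (le_normcD _ _) _; rewrite (normcM _ (G z')) (normcM _ (G z ^+ 2)) (normcM (_ + _) (G z ^+ 2)) !normcX.
have G0 := normc_ge0 (G z); have G'0 := normc_ge0 (G z').
have h1 : normc (F' - F) ^+ 2 * normc (G z) ^+ 2 * normc (G z')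
    <= (2 * e * (V / y)) ^+ 2 * (b + V)^-1 ^+ 2 * b^-1.
  apply: ler_pM => //; first by rewrite mulr_ge0// sqr_ge0.
  apply: ler_pM; rewrite ?sqr_ge0//; rewrite lerXn2r// ?nnegrE ?normc_ge0//.
    by rewrite !mulr_ge0// invr_ge0 ltW.
  by rewrite invr_ge0 ltW.
have h2 : normc (F' - F + (z' - z) * S) * normc (G z) ^+ 2
    <= e ^+ 2 * (V / y / y) * (b + V)^-1 ^+ 2.
  apply: ler_pM; rewrite ?sqr_ge0 ?normc_ge0//.
  by rewrite lerXn2r// ?nnegrE// invr_ge0 ltW.
apply: le_trans (lerD h1 h2) _.
have q1 : V / (b + V) <= 1 by rewrite ler_pdivrMr// mul1r lerDr ltW.
have q0 : 0 <= V / (b + V) by rewrite divr_ge0// ltW.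
have r1 : (b + V)^-1 <= b^-1 by rewrite lef_pV2 ?posrE// lerDl.
have -> : (2 * e * (V / y)) ^+ 2 * (b + V)^-1 ^+ 2 * b^-1 =
   4 * e ^+ 2 / (b * y ^+ 2) * (V / (b + V)) ^+ 2.
  by field; rewrite !gt_eqF.
have -> : e ^+ 2 * (V / y / y) * (b + V)^-1 ^+ 2 =
   e ^+ 2 / y ^+ 2 * (V / (b + V) * (b + V)^-1).
  by field; rewrite !gt_eqF.
have -> : 5 * e ^+ 2 / (b * y ^+ 2) = 4 * e ^+ 2 / (b * y ^+ 2) * 1 +
   e ^+ 2 / y ^+ 2 * (1 * b^-1).
  by field; rewrite !gt_eqF.
apply: lerD; apply: ler_wpM2l.
- by rewrite !mulr_ge0// ?invr_ge0 ?mulr_ge0 ?sqr_ge0// ltW.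
- by rewrite expr_le1.
- by rewrite mulr_ge0 ?invr_ge0 ?sqr_ge0.
- by apply: ler_pM => //; rewrite invr_ge0 ltW.
Qed.

(** The Cauchy-Riemann equation for [G] with finite increments: the Taylor
    estimates in the directions [1] and [i] have the same first order term up to
    the factor [i]. *)
Lemma resolvent_cauchy_riemann X w (s y a b e : R) :
  let U s y := \sum_(x <- X) w x * kerU s y x in
  let V s y := \sum_(x <- X) w x * kerV s y x in
  (forall x, x \in X -> 0 <= w x) -> 0 < y -> 0 < b -> 0 <= e -> 2 * e <= y ->
  `|resV a b (U s (y + e)) (V s (y + e)) - resV a b (U s y) (V s y)
    + (resU a b (U (s + e) y) (V (s + e) y) - resU a b (U s y) (V s y))|
  <= 10 * e ^+ 2 / (b * y ^+ 2).
Proof.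
move=> U V w0 y0 b0 e0 ey.
pose z := s +i* y.
pose G t := ((a +i* b) - ctransform X w t)^-1.
pose S := \sum_(x <- X) (w x)%:C / (z - x%:C) ^+ 2.
have GE (p q : R) : G (p +i* q) = resU a b (U p q) (V p q)
   +i* (- resV a b (U p q) (V p q)).
  by rewrite /G ctransformE resolventE.
have d1 : (s +i* (y + e)) - z = 0 +i* e by rewrite /z; simpc; congr (_ +i* _); ring.
have d2 : ((s + e) +i* y) - z = e +i* 0 by rewrite /z; simpc; congr (_ +i* _); ring.
have n1 : normc ((s +i* (y + e)) - z) = e.
  by rewrite d1 /normc expr0n add0r sqrtr_sqr ger0_norm.
have n2 : normc (((s + e) +i* y) - z) = e.
  by rewrite d2 /normc expr0n addr0 sqrtr_sqr ger0_norm.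
have yn (x : R) : y <= normc (z - x%:C).
  by apply: le_trans (normc_ge_Im _); rewrite /z; simpc => /=; rewrite ler_norm.
have cmp t (x : R) : normc (t - z) = e -> normc (z - x%:C) <= 2 * normc (t - x%:C).
  move=> te; have := le_normcD (t - x%:C) (z - t).
  have -> : t - x%:C + (z - t) = z - x%:C by ring.
  rewrite -[z - t]opprB normcN te => h; have := yn x; lra.
have h1 := @resolvent_taylor X w s y a b _ e w0 y0 b0 _ n1 (fun x => cmp _ x n1).
have h2 := @resolvent_taylor X w s y a b _ e w0 y0 b0 _ n2 (fun x => cmp _ x n2).
rewrite /= in h1 h2.
have {}h1 : normc (G (s +i* (y + e)) - G z
    + ('i * e%:C) * S * G z ^+ 2) <= 5 * e ^+ 2 / (b * y ^+ 2).
  have -> : 'i * e%:C = s +i* (y + e) - z by rewrite d1; simpc.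
  by apply: h1; rewrite lerDl.
have {}h2 : normc (G ((s + e) +i* y) - G z
    + e%:C * S * G z ^+ 2) <= 5 * e ^+ 2 / (b * y ^+ 2).
  have -> : e%:C = (s + e) +i* y - z by rewrite d2.
  exact: h2.
set T1 := _ + _ in h1; set T2 := _ + _ in h2.
(* The first order terms of [T1] and ['i * T2] cancel. *)
have nT : normc (T1 - 'i * T2) <= 10 * e ^+ 2 / (b * y ^+ 2).
  apply: le_trans (le_normcD _ _) _; rewrite normcN normcM.
  have -> : normc ('i : R[i]) = 1 by rewrite /normc expr0n add0r expr1n sqrtr1.
  rewrite mul1r; apply: le_trans (lerD h1 h2) _.
  by rewrite -mulrDl -mulrDl ler_wpM2r//; [rewrite invr_ge0 mulr_ge0 ?sqr_ge0// ltW
    |rewrite ler_wpM2r ?sqr_ge0//; lra].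
have TE : T1 - 'i * T2 =
    G (s +i* (y + e)) - G z - 'i * (G ((s + e) +i* y) - G z).
  by rewrite /T1 /T2; ring.
apply: le_trans nT; apply: le_trans (normc_ge_Im _).
rewrite TE !GE; simpc => /=; rewrite -normrN le_eqVlt; apply/orP; left.
by apply/eqP; congr (`|_|); ring.
Qed.
End cauchy_riemann.

(** * Weighted point measures as finite sums on bounded sets *)

Section measurable_inverse.
Context {R : realType}.

Lemma measurable_invr : measurable_fun setT (fun x : R => x^-1).
Proof.
rewrite -(setUv [set (0 : R)]); apply/measurable_funU => //; first exact: measurableC.
split; first exact: measurable_fun_set1.
apply: open_continuous_measurable_fun => [|x].
  by rewrite openC; exact: closed_eq.
by rewrite inE /= => /eqP x0; exact: cvgV.
Qed.

End measurable_inverse.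

Section atoms.
Context {R : realType}.
Implicit Types (mu : wpm R) (a b : R) (B : set R).

Definition weight mu x : R := fine (mu [set x]).

Definition atoms mu a b : seq R := finmap.enum_fset (fset_set (supp mu `&` `[a, b])).

Lemma weight_ge0 mu x : 0 <= weight mu x.
Proof. by rewrite fine_ge0. Qed.

Lemma mem_atoms mu a b x :
  (x \in atoms mu a b) = (x \in supp mu) && (a <= x <= b).
Proof.
have [lf _] := wpmP mu.
rewrite /atoms in_fset_set; last exact: lf.
by rewrite in_setI; congr andb; rewrite mem_setE in_itv.
Qed.

Lemma wpm_set1 mu (w : R -> R) :
  (forall x, supp mu x -> 0 < w x) ->
  (forall B, measurable B -> mu B = (\esum_(x in supp mu) ((w x)%:E * \d_x B))%E) ->
  forall x, supp mu x -> mu [set x] = (w x)%:E.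
Proof.
move=> w0 muE x sx; rewrite muE//.
have -> : (\esum_(y in supp mu) ((w y)%:E * \d_y [set x]) =
           \esum_(y in [set x]) (w y)%:E)%E; last by rewrite esum_set1// lee_fin ltW// w0.
rewrite [LHS]esum_mkcond [RHS]esum_mkcond; apply: eq_esum => y _.
rewrite diracE; case: ifPn => sy.
  by case: ifPn; rewrite ?mule1 ?mule0.
case: ifPn => // /set_mem /= yx.
by move: sy; rewrite notin_setE yx.
Qed.

Lemma wpm_measure_atoms mu a b B : measurable B -> B `<=` `[a, b] ->
  mu B = (\sum_(x <- atoms mu a b | x \in B) weight mu x)%:E.
Proof.
move=> mB Bab; have [lf [w [w0 muE]]] := wpmP mu.
have wE x : supp mu x -> weight mu x = w x.
  by move=> sx; rewrite /weight (wpm_set1 w0 muE).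
rewrite muE// (_ : (\esum_(x in _) _)%E =
  (\esum_(x in supp mu `&` `[a, b]) ((weight mu x)%:E * \d_x B))%E); last first.
  rewrite [LHS]esum_mkcond [RHS]esum_mkcond; apply: eq_esum => x _.
  rewrite in_setI diracE; case: ifPn => //=; rewrite inE => sx.
  have [xB|xB] := boolP (x \in B).
    rewrite ifT ?wE//; rewrite inE in xB; rewrite inE; exact: Bab.
  by case: ifPn; rewrite !mule0.
rewrite esum_fset; [|exact: lf|]; last first.
  by move=> x _; rewrite mule_ge0// lee_fin weight_ge0.
rewrite fsbig_finite; last exact: lf.
rewrite /= -sumEFin [in RHS]big_mkcond; apply: eq_bigr => x _.
by rewrite diracE; case: ifPn; rewrite ?mule1 ?mule0.
Qed.

Lemma ge0_integral_atoms mu a b B (f : R -> R) : measurable B -> B `<=` `[a, b] ->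
  measurable_fun setT f -> (forall x, 0 <= f x) ->
  (\int[mu]_(x in B) (f x)%:E =
     (\sum_(x <- atoms mu a b | x \in B) weight mu x * f x)%:E)%E.
Proof.
move=> mB Bab mf f0.
pose s := atoms mu a b.
pose m_ i := mscale (NngNum (weight_ge0 mu (nth 0 s i))) \d_(nth 0 s i).
have mfB : measurable_fun B (EFin \o f).
  by apply/measurable_EFinP/measurable_funTS.
rewrite (eq_measure_integral (msum m_ (size s))); last first.
  move=> A mA AB; apply: eq_trans (_ : (\sum_(x <- s | x \in A) weight mu x)%:E = _).
    by apply: wpm_measure_atoms => //; exact: subset_trans Bab.
  rewrite /msum -sumEFin big_mkcond (big_nth 0) big_mkord.
  apply: eq_bigr => i _.
  transitivity ((weight mu (nth 0%R s i))%:E * \d_(nth 0%R s i) A)%E; last by [].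
  rewrite diracE.
  by case: ifPn; rewrite ?mule1 ?mule0.
rewrite ge0_integral_measure_sum//; last by move=> x _; rewrite lee_fin.
rewrite -sumEFin [RHS]big_mkcond [RHS](big_nth 0) [RHS]big_mkord.
apply: eq_bigr => i _; rewrite ge0_integral_mscale//; last by move=> x _; rewrite lee_fin.
rewrite integral_dirac// diracE /=.
by case: ifPn; rewrite ?mul1e ?mul0e ?mule0 -?EFinM.
Qed.

Lemma integrable_atoms mu a b B (f : R -> R) : measurable B -> B `<=` `[a, b] ->
  measurable_fun setT f -> mu.-integrable B (EFin \o f).
Proof.
move=> mB Bab mf; apply/integrableP; split.
  by apply/measurable_EFinP/measurable_funTS.
rewrite (eq_integral (fun x => (`|f x|)%:E)); last by [].
rewrite (@ge0_integral_atoms _ a b)//; first by rewrite ltry.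
exact: measurableT_comp.
Qed.

Lemma Rintegral_atoms mu a b B (f : R -> R) : measurable B -> B `<=` `[a, b] ->
  measurable_fun setT f ->
  \int[mu]_(x in B) f x = \sum_(x <- atoms mu a b | x \in B) weight mu x * f x.
Proof.
move=> mB Bab mf.
pose p x := Num.max (f x) 0; pose n x := Num.max (- f x) 0.
have mp : measurable_fun setT p by apply: measurable_maxr.
have mn : measurable_fun setT n.
  by apply: measurable_maxr => //; exact: measurableT_comp.
have p0 x : 0 <= p x by rewrite le_max lexx orbT.
have n0 x : 0 <= n x by rewrite le_max lexx orbT.
have fE x : f x = p x - n x.
    rewrite /p /n; have [h|h] := leP 0 (f x).
      by rewrite (@max_r _ _ (- f x)) ?oppr_le0// subr0.
    by rewrite (@max_l _ _ (- f x)) ?oppr_ge0 ?ltW// sub0r opprK.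
rewrite /Rintegral (eq_integral (fun x => (p x)%:E - (n x)%:E)%E); last first.
  by move=> x _; rewrite fE EFinB.
rewrite integralB_EFin//; last 2 first.
- exact: (@integrable_atoms mu a b B p mB Bab mp).
- exact: (@integrable_atoms mu a b B n mB Bab mn).
rewrite !(@ge0_integral_atoms _ a b)// -EFinB /= -sumrB.
by apply: eq_bigr => x _; rewrite fE mulrBr.
Qed.

End atoms.

(** * Measurability for the vague topology *)

Section vague_measurability.
Context {R : realType}.

Lemma vague_subbase_open (A : set (wpm R)) : vague_subbase A -> open A.
Proof.
move=> sA; exists [set A]; last by rewrite bigcup_set1.
by move=> _ ->; exact: finI_from1.
Qed.

Lemma open_wpm_measurable (A : set (wpm R)) : open A -> measurable A.
Proof. by move=> oA; apply: sub_gen_smallest. Qed.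

Lemma measurable_Rintegral_Cc (f : R -> R) : continuous f ->
  compact (closure [set x | f x != 0]) ->
  measurable_fun [set: wpm R] (fun mu : wpm R => \int[mu]_x f x).
Proof.
move=> cf kf; apply: (measurability _ (RGenOInfty.measurableE R)) => //.
move=> _ [_ [x ->] <-]; rewrite setTI; apply: open_wpm_measurable.
apply: vague_subbase_open; exists f, `]x, +oo[%classic; split => //.
Qed.

(** Equal to 0 up to [a], with slope [n] after [a] until it reaches 1, and with
    slope [- n] after [b]: letting the ramp start at [a] makes the limit the
    indicator of an interval open at [a] and closed at [b]. *)
Definition trapezoid (a b : R) (n : nat) (x : R) : R :=
  Num.max 0 (Num.min 1 (Num.min (n%:R * (x - a)) (1 + n%:R * (b - x)))).

Lemma trapezoid_cvg (a b x : R) :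
  trapezoid a b n.+1 x @[n --> \oo] --> (\1_(`]a, b]%classic : set R) x : R).
Proof.
have big (c : R) : 0 < c -> \forall n \near \oo, 1 <= n.+1%:R * c.
  move=> c0; exists (Num.truncn c^-1) => // n /= cn.
  rewrite -ler_pdivrMr// mul1r ltW//; apply: lt_le_trans (truncnS_gt _) _.
  by rewrite ler_nat ltnS.
rewrite indicE; apply: cvg_near_cst.
have [ax|xa] := ltP a x; last first.
  apply: nearW => n; rewrite memNset/=; last by rewrite in_itv/= ltNge xa.
  rewrite /trapezoid max_l// !ge_min; apply/orP; right; apply/orP; left.
  by rewrite mulr_ge0_le0// subr_le0.
have [xb|bx] := leP x b.
  near=> n; rewrite mem_set/=; last by rewrite in_itv/= ax.
  rewrite /trapezoid (@min_l _ _ 1); first by rewrite max_r.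
  rewrite le_min; apply/andP; split; first by near: n; apply: big; rewrite subr_gt0.
  by rewrite lerDl mulr_ge0// subr_ge0.
near=> n; rewrite memNset/=; last by rewrite in_itv/= leNgt bx andbF.
rewrite /trapezoid max_l// !ge_min; apply/orP; right; apply/orP; right.
rewrite -opprB mulrN subr_le0.
by near: n; apply: big; rewrite subr_gt0.
Unshelve. all: by end_near.
Qed.

Lemma continuous_trapezoid (a b : R) n : continuous (trapezoid a b n).
Proof.
pose l x := n%:R * (x - a) : R^o; pose r x := 1 + n%:R * (b - x) : R^o.
have cl : continuous l.
  by move=> x; apply: cvgM; [exact: cvg_cst|apply: cvgB; [exact: cvg_id|exact: cvg_cst]].
have cr : continuous r.
  move=> x; apply: cvgD; first exact: cvg_cst.
  by apply: cvgM; [exact: cvg_cst|apply: cvgB; [exact: cvg_cst|exact: cvg_id]].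
move=> x; apply: (@continuous_max _ _ (cst 0) (cst 1 \min (l \min r))).
  exact: cvg_cst.
apply: (@continuous_min _ _ (cst 1) (l \min r)); first exact: cvg_cst.
by apply: continuous_min; [exact: cl|exact: cr].
Qed.

Lemma trapezoid_supp (a b : R) n x : ~ `[a, b + 1]%classic x ->
  trapezoid a b n.+1 x = 0.
Proof.
rewrite /= in_itv/= => /negP; rewrite negb_and -!ltNge => h.
rewrite /trapezoid max_l// !ge_min; apply/orP; right.
case/orP: h => h; apply/orP; [left|right].
  by rewrite mulr_ge0_le0// subr_le0 ltW.
rewrite -opprB mulrN subr_le0 mulr_ege1// ?ler1n//.
by rewrite lerBrDl ltW.
Qed.

Lemma compact_trapezoid (a b : R) n :
  compact (closure [set x | trapezoid a b n.+1 x != 0]).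
Proof.
apply: (@subclosed_compact _ _ `[a, b + 1]%classic).
- exact: closed_closure.
- exact: segment_compact.
- rewrite closureE => x; apply; split; first exact: interval_closed.
  move=> z /= /eqP z0; apply: contrapT => zab; apply: z0.
  exact: trapezoid_supp.
Qed.

(** The open sets of the vague topology only give the integrals of continuous
    functions of compact support; these approximate the mass of an interval,
    because the integral is a finite sum over the atoms in a bounded set. *)
Lemma measurable_wpm_oc (a b : R) :
  measurable_fun [set: wpm R] (fun mu : wpm R => mu `]a, b]%classic).
Proof.
pose T n (mu : wpm R) := \int[mu]_x trapezoid a b n.+1 x.
have mT n : measurable_fun [set: wpm R] (T n).
  apply: (@measurable_Rintegral_Cc (trapezoid a b n.+1)).
    exact: continuous_trapezoid.
  exact: compact_trapezoid.
have ab1 : `]a, b] `<=` `[a, b + 1 : R].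
  by move=> x /=; rewrite !in_itv/= => /andP[/ltW -> xb]; rewrite (le_trans xb)// lerDl.
have muE (mu : wpm R) : mu `]a, b]%classic = (fine (mu `]a, b]%classic))%:E.
  by rewrite (wpm_measure_atoms mu (measurable_itv _) ab1).
rewrite (_ : (fun _ => _) = EFin \o (fun mu : wpm R => fine (mu `]a, b]%classic))); last first.
  by apply/funext => mu /=; rewrite -muE.
apply/measurable_EFinP; apply: (@measurable_fun_cvg _ _ _ _ T) => // mu _.
rewrite (wpm_measure_atoms mu (measurable_itv _) ab1)//=.
have TE n : T n mu = \sum_(x <- atoms mu a (b + 1)) weight mu x * trapezoid a b n.+1 x.
  have tE : trapezoid a b n.+1 \_ `[a, b + 1]%classic = trapezoid a b n.+1.
    apply/funext => x; rewrite patchE; case: ifPn => //.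
    by rewrite notin_setE => /trapezoid_supp.
  transitivity (\int[mu]_x (trapezoid a b n.+1 \_ `[a, b + 1]%classic) x).
    by rewrite tE.
  rewrite -Rintegral_mkcond (@Rintegral_atoms _ _ a (b+1))//; last first.
    by apply: continuous_measurable_fun; exact: continuous_trapezoid.
  rewrite big_seq_cond [RHS]big_seq_cond.
  apply: eq_bigl => x.
  by rewrite mem_atoms mem_setE in_itv/=; case: (x \in supp mu) => //=; rewrite andbT andbb.
rewrite (_ : T ^~ mu = fun n => \sum_(x <- atoms mu a (b + 1)) weight mu x * trapezoid a b n.+1 x); last first.
  by apply/funext => n; rewrite TE.
rewrite [X in _ --> X](_ : _ = \sum_(x <- atoms mu a (b + 1)) weight mu x * \1_(`]a, b]%classic : set R) x); last first.
  rewrite big_mkcond; apply: eq_bigr => x _; rewrite indicE.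
  by case: ifPn; rewrite ?mulr1 ?mulr0.
apply: cvg_big => // [|x _]; first exact: add_continuous.
by apply: cvgM; [exact: cvg_cst|exact: trapezoid_cvg].
Qed.

(** Intersecting with a bounded interval keeps the masses finite, so that
    complements become differences in the induction on [B]. *)
Lemma measurable_wpm_setI (a b : R) (B : set R) : measurable B ->
  measurable_fun [set: wpm R] (fun mu : wpm R => mu (B `&` `]a, b]%classic)).
Proof.
move=> mB.
have fin (C : set R) (mu : wpm R) : measurable C -> mu (C `&` `]a, b]%classic) \is a fin_num.
  move=> mC; rewrite (@wpm_measure_atoms _ _ a b)//; first exact: measurableI.
  by move=> x [_] /=; rewrite !in_itv/= => /andP[/ltW -> ->].
pose ocs : set (set R) := [set `]x.1, x.2]%classic | x in [set: R * R]].
have ocE : @measurable _ R = <<s ocs >>.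
  by congr (<<s _ >>); apply/seteqP; split.
move: B mB; rewrite ocE; apply: (@dynkin_induction _ R ocs).
- exact: ocE.
- move=> _ _ [[x1 x2] _ <-] [[y1 y2] _ <-] /=.
  exists (Num.max x1 y1, Num.min x2 y2) => //=.
  apply/seteqP; split => x /=; rewrite !in_itv/= gt_max le_min.
    by move=> /andP[/andP[-> ->] /andP[-> ->]].
  by move=> [/andP[-> ->] /andP[-> ->]].
- rewrite (_ : (fun _ => _) = (fun mu : wpm R => mu `]a, b]%classic)); last first.
    by apply/funext => mu; rewrite setTI.
  exact: measurable_wpm_oc.
- move=> _ [[x1 x2] _ <-] /=.
  rewrite (_ : (fun _ => _) = (fun mu : wpm R => mu `]Num.max x1 a, Num.min x2 b]%classic)).
    exact: measurable_wpm_oc.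
  apply/funext => mu; congr (mu _).
  apply/seteqP; split => x /=; rewrite !in_itv/= gt_max le_min.
    by move=> [/andP[-> ->] /andP[-> ->]].
  by move=> /andP[/andP[-> ->] /andP[-> ->]].
- move=> S mS ih.
  rewrite (_ : (fun _ => _) = (fun mu : wpm R => mu `]a, b]%classic - mu (S `&` `]a, b]%classic))%E); last first.
    apply/funext => mu; rewrite (setIC S) -measureD//=.
    + by rewrite setDE setIC.
    + by rewrite -[X in mu X]setTI ltey_eq fin.
  by apply: emeasurable_funB => //; exact: measurable_wpm_oc.
- move=> F mF tF ih.
  rewrite (_ : (fun _ => _) = (fun mu : wpm R => \sum_(0 <= k <oo) mu (F k `&` `]a, b]%classic))%E); last first.
    apply/funext => mu; rewrite setI_bigcupl measure_bigcup//=.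
      by apply: eq_eseriesl => k; rewrite in_setT.
    + by move=> k _; exact: measurableI.
    + exact: trivIset_setIr.
  by apply: ge0_emeasurable_sum => //.
Qed.

Lemma measurable_wpm_eval (B : set R) : measurable B ->
  measurable_fun [set: wpm R] (fun mu : wpm R => mu B).
Proof.
move=> mB; pose F n : set R := B `&` `](- n%:R)%R, n%:R]%classic.
have mF n : measurable (F n) by exact: measurableI.
apply: (@emeasurable_fun_cvg _ _ _ _ (fun n (mu : wpm R) => mu (F n))) => //.
  by move=> n; exact: measurable_wpm_setI.
move=> mu _.
have -> : mu B = mu (\bigcup_n F n).
  congr (mu _); rewrite -setI_bigcupr; apply/seteqP; split => [x Bx|x []//].
  split => //; exists (Num.truncn `|x|).+1 => //=; rewrite in_itv/=.
  have := truncnS_gt `|x|; rewrite ltr_norml => /andP[-> /ltW ->//].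
apply: nondecreasing_cvg_mu => //; first exact: bigcup_measurable.
move=> m n mn; apply/subsetPset; apply: setIS => x /=; rewrite !in_itv/=.
have : m%:R <= n%:R :> R by rewrite ler_nat.
by move=> mn' /andP[h1 h2]; apply/andP; split; lra.
Qed.

(** Evaluation at every Borel set being measurable, the identity is a kernel from
    [wpm R] to [R]. *)
Lemma measurable_wpm_Rintegral (D : set R) (f : R -> R) :
  measurable D -> measurable_fun setT f ->
  measurable_fun [set: wpm R] (fun mu : wpm R => \int[mu]_(x in D) f x).
Proof.
move=> mD mf; rewrite /Rintegral.
have mfD : measurable_fun [set: R] ((EFin \o f) \_ D).
  by apply/(measurable_restrictT _ _).1 => //; apply/measurable_EFinP/measurable_funTS.
apply: (measurableT_comp (fine_measurable measurableT)) => /=.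
under eq_fun do rewrite integral_mkcond integralE.
apply: emeasurable_funB.
- apply: (@measurable_fun_integral_kernel _ _ _ _ _ (fun mu : wpm R => mu : {measure set R -> \bar R})) => //.
    exact: measurable_wpm_eval.
  exact: measurable_funepos.
- apply: (@measurable_fun_integral_kernel _ _ _ _ _ (fun mu : wpm R => mu : {measure set R -> \bar R})) => //.
    exact: measurable_wpm_eval.
  exact: measurable_funeneg.
Qed.

End vague_measurability.

(** * Stationarity *)

Section stationarity.
Context d {T : measurableType d} {R : realType} (P : probability T R).
Variable M : {RV P >-> wpm R}.
Hypothesis M_stationary : stationary M.

(** Only the laws of [g \o M] and [g \o translate t \o M] matter; the change of
    variables to [\bar R] is done with the absolute value as integrand. *)
Lemma stationary_ge0_integral (t : R) (g : wpm R -> \bar R) :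
  measurable_fun setT g -> measurable_fun setT (g \o translate t) ->
  (forall mu, 0 <= g mu)%E ->
  (\int[P]_w g (translate t (M w)) = \int[P]_w g (M w))%E.
Proof.
move=> mg mgt g0.
have mgM : measurable_fun setT (g \o M) by exact: measurableT_comp.
have mgtM : measurable_fun setT (g \o translate t \o M) by exact: measurableT_comp.
(* Integrand on [\bar R] that restricts to the identity on nonnegative values. *)
pose id0 (x : \bar R) : \bar R := `|x|%E.
have mid : measurable_fun setT id0 by exact: abse_measurable.
have id00 x : (0 <= id0 x)%E by exact: abse_ge0.
transitivity (\int[pushforward P (g \o translate t \o M)]_x id0 x)%E.
  rewrite ge0_integral_pushforward//.
  by apply: eq_integral => w _ /=; rewrite /id0 gee0_abs.
transitivity (\int[pushforward P (g \o M)]_x id0 x)%E; last first.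
  rewrite ge0_integral_pushforward//.
  by apply: eq_integral => w _ /=; rewrite /id0 gee0_abs.
apply: eq_measure_integral => A mA _.
have mB : measurable (g @^-1` A) by rewrite -[X in measurable X]setTI; exact: mg.
exact: (M_stationary t mB).
Qed.

Lemma stationary_integral (t : R) (g : wpm R -> \bar R) :
  measurable_fun setT g -> measurable_fun setT (g \o translate t) ->
  (\int[P]_w g (translate t (M w)) = \int[P]_w g (M w))%E.
Proof.
move=> mg mgt; rewrite integralE [RHS]integralE; congr (_ - _)%E.
- under eq_integral do rewrite funeposE.
  under [RHS]eq_integral do rewrite funeposE.
  apply: (@stationary_ge0_integral t (fun mu => maxe (g mu) 0)%E).
  + exact: measurable_maxe.
  + exact: measurable_maxe.
  + by move=> mu; rewrite le_max lexx orbT.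
- under eq_integral do rewrite funenegE.
  under [RHS]eq_integral do rewrite funenegE.
  apply: (@stationary_ge0_integral t (fun mu => maxe (- g mu) 0)%E).
  + by apply: measurable_maxe => //; exact: measurableT_comp.
  + by apply: measurable_maxe => //; exact: (measurableT_comp _ mgt).
  + by move=> mu; rewrite le_max lexx orbT.
Qed.

Lemma Rintegral_translate (t : R) (mu : wpm R) (D : set R) (f : R -> R) :
  measurable D -> measurable_fun setT f ->
  \int[translate t mu]_(x in D) f x =
  \int[mu]_(x in (fun x => x - t) @^-1` D) f (x - t).
Proof.
move=> mD mf; rewrite /Rintegral integralE [in RHS]integralE.
have mt : measurable_fun setT (fun x : R => x - t) by exact: measurable_funB.
have mF : measurable_fun setT (EFin \o f) by exact/measurable_EFinP.
congr (fine (_ - _)%E).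
- rewrite ge0_integral_pushforward//; last first.
    exact: measurable_funTS (measurable_funepos mF).
  by apply: eq_integral => x _; rewrite /= !funeposE.
- rewrite ge0_integral_pushforward//; last first.
    exact: measurable_funTS (measurable_funeneg mF).
  by apply: eq_integral => x _; rewrite /= !funenegE.
Qed.

Lemma translate_oc (t a b : R) (mu : wpm R) :
  translate t mu `]a, b]%classic = mu `]a + t, b + t]%classic.
Proof.
rewrite translateE; congr (mu _); apply/seteqP; split => x /=.
  by move=> [y]; rewrite !in_itv/= => /andP[ay yb] <-; rewrite ltrD2r lerD2r ay.
rewrite !in_itv/= => /andP[ax xb]; exists (x - t); rewrite ?subrK// in_itv/=.
by rewrite ltrBrDr ax lerBlDr.
Qed.

Lemma stationary_oc (t a b : R) :
  (\int[P]_w M w `](a + t)%R, (b + t)%R]%classic = \int[P]_w M w `]a, b]%classic)%E.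
Proof.
rewrite -(@stationary_integral t (fun mu : wpm R => mu `]a, b]%classic)).
- by apply: eq_integral => w _; rewrite translate_oc.
- exact: measurable_wpm_eval.
- rewrite (_ : _ \o _ = (fun mu : wpm R => mu `]a + t, b + t]%classic)).
    exact: measurable_wpm_eval.
  by apply/funext => mu; rewrite -translate_oc.
Qed.

Lemma stationary_set1 (t : R) :
  (\int[P]_w M w [set t] = \int[P]_w M w [set 0%R])%E.
Proof.
have tE (mu : wpm R) : translate t mu [set 0%R] = mu [set t].
  by rewrite translateE image_set1 add0r.
rewrite -(@stationary_integral t (fun mu : wpm R => mu [set 0%R])).
- by apply: eq_integral => w _; rewrite tE.
- exact: measurable_wpm_eval.
- rewrite (_ : _ \o _ = (fun mu : wpm R => mu [set t])).
    exact: measurable_wpm_eval.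
  by apply/funext => mu; rewrite -tE.
Qed.

Variable K : R.
Hypothesis M_intensity : intensity M = K%:E.

Lemma expectation_unit_cell (j : R) :
  (\int[P]_w M w `]j, (j + 1)%R]%classic = K%:E)%E.
Proof.
rewrite -M_intensity /intensity -(stationary_oc j 0 1).
by rewrite add0r addrC.
Qed.

Lemma measurable_Mw (B : set R) : measurable B ->
  measurable_fun setT (fun w => M w B).
Proof.
move=> mB; apply: (measurableT_comp (measurable_wpm_eval mB)) => //.
Qed.

(** By stationarity all points have the same expected mass [e], and [n] points of
    [`]0, 1]] together have mass at most [K] in expectation: [n e <= K] for
    every [n]. *)
Lemma no_fixed_atom (s : R) : {ae P, forall w, M w [set s] = 0%E}.
Proof.
pose e : \bar R := (\int[P]_w M w [set 0%R])%E.
have e0 : (0 <= e)%E by apply: integral_ge0.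
have ne n : (e *+ n <= K%:E)%E.
  (* The points [1 / (i + 1)] all lie in [`]0, 1]]. *)
  have -> : (e *+ n = \int[P]_w \sum_(i < n) M w [set (i.+1%:R^-1)%R])%E.
    rewrite ge0_integral_sum//; last by move=> i; exact: measurable_Mw.
    under eq_bigr do rewrite stationary_set1.
    by rewrite -/e sumr_const card_ord.
  rewrite -M_intensity; apply: ge0_le_integral => //.
  - by move=> w _; apply: sume_ge0.
  - by apply: emeasurable_sum => i; exact: measurable_Mw.
  - exact: measurable_Mw.
  - move=> w _.
    rewrite -(@measure_bigsetU_ord _ _ _ (M w) n xpredT
      (fun i : 'I_n => [set (i.+1%:R^-1 : R)]))//; last first.
      apply/trivIsetP => i j _ _ ij; rewrite -subset0 => x [/= -> /invr_inj/eqP].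
      by rewrite eqr_nat eqSS => ij'; move: ij; rewrite -(inj_eq val_inj) ij'.
    apply: le_measure; rewrite ?inE//; first exact: bigsetU_measurable.
    rewrite -bigcup_seq => x [i _] ->/=; rewrite in_itv/= invr_gt0 ltr0n/=.
    by rewrite invf_le1 ?ltr0n// ler1n.
have {ne} e00 : e = 0%E.
  have ef : e \is a fin_num.
    rewrite ge0_fin_numE//; apply: (@le_lt_trans _ _ K%:E); last exact: ltry.
    exact: (ne 1%N).
  move: ne e0; rewrite -(fineK ef) lee_fin => ne e0.
  congr EFin; apply/eqP; rewrite eq_le e0 andbT leNgt; apply/negP => ep.
  have := ne (Num.truncn (K / fine e)).+1.
  rewrite -EFin_natmul lee_fin -mulr_natl -ler_pdivlMr//.
  by rewrite leNgt truncnS_gt.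
have /(ae_eq_integral_abs _ measurableT) : (\int[P]_w `|M w [set s]| = 0)%E.
  rewrite -e00 -[RHS](stationary_set1 s).
  by apply: eq_integral => w _; rewrite gee0_abs.
by move=> /(_ (measurable_Mw (measurable_set1 s))); apply: filterS => w /(_ I).
Qed.
End stationarity.

(** * Almost sure summability of the discrepancy *)

Section counting.
Context {R : realType}.
Implicit Types (mu : wpm R) (x y z K : R).

Definition dev K mu x : R := counting_fun mu x - K * x.

Lemma wpm_oc_fin mu x y : mu `]x, y]%classic \is a fin_num.
Proof.
rewrite (@wpm_measure_atoms _ _ x y)// => z /=.
by rewrite !in_itv/= => /andP[/ltW -> ->].
Qed.

Lemma wpm_oc_split mu x y z : x <= y -> y <= z ->
  fine (mu `]x, z]%classic) = fine (mu `]x, y]%classic) + fine (mu `]y, z]%classic).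
Proof.
move=> xy yz; rewrite -fineD ?wpm_oc_fin//; congr fine.
rewrite -measureU//.
- by congr (mu _); rewrite -itv_bndbnd_setU ?bnd_simp.
- rewrite -subset0 => t /= []; rewrite !in_itv/= => /andP[_ ty] /andP[yt _].
  by move: (lt_le_trans yt ty); rewrite ltxx.
Qed.

Lemma counting_fun_diff mu x y : x <= y ->
  counting_fun mu y - counting_fun mu x = fine (mu `]x, y]%classic).
Proof.
move=> xy; rewrite /counting_fun.
have [x0|x0] := leP 0 x.
  by rewrite (le_trans x0 xy) (@wpm_oc_split mu 0 x y)// addrAC subrr add0r.
have [y0|y0] := leP 0 y.
  by rewrite opprK addrC -wpm_oc_split// ltW.
by rewrite (@wpm_oc_split mu x y 0) ?(ltW y0)//; ring.
Qed.

Lemma counting_fun0 mu : counting_fun mu 0 = 0.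
Proof. by rewrite /counting_fun lexx set_itv_ge ?bnd_simp ?ltxx// measure0. Qed.

(** Between two points at distance at most 1 the counting function grows by at
    most the mass of one unit interval, and the linear term by at most [K]. *)
Lemma dev_diff_le K mu x y : 0 <= K -> `|x - y| <= 1 ->
  `|dev K mu x| <= `|dev K mu y| +
    fine (mu `]Num.min x y, Num.min x y + 1]%classic) + K.
Proof.
move=> K0.
have key u v : u <= v -> v <= u + 1 ->
    `|dev K mu v - dev K mu u| <= fine (mu `]u, u + 1]%classic) + K.
  move=> uv vu.
  have -> : dev K mu v - dev K mu u = fine (mu `]u, v]%classic) - K * (v - u).
    by rewrite /dev -counting_fun_diff//; ring.
  apply: le_trans (ler_normB _ _) _; apply: lerD.
    rewrite ger0_norm ?fine_ge0// (@wpm_oc_split mu u v (u + 1))//.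
    by rewrite lerDl fine_ge0.
  rewrite ger0_norm ?mulr_ge0 ?subr_ge0// -[leRHS]mulr1 ler_wpM2l//.
  by rewrite lerBlDl.
rewrite ler_norml => /andP[h1 h2].
have [xy|yx] := leP x y.
- have h : `|dev K mu y - dev K mu x| <= _ := key x y xy ltac:(lra).
  have := ler_distD (dev K mu y) 0 (dev K mu x); rewrite !sub0r !normrN => t.
  by apply: le_trans t _; rewrite -[leRHS]addrA lerD2l.
- have h : `|dev K mu x - dev K mu y| <= _ := key y x (ltW yx) ltac:(lra).
  have := ler_distD (dev K mu y) 0 (dev K mu x); rewrite !sub0r !normrN => t.
  by apply: le_trans t _; rewrite -[leRHS]addrA lerD2l distrC.
Qed.

(** The two sums run over the two sides of the origin. This is the pathwise form
    of the integrability of [h r / r ^ 2]. *)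
Definition regular K mu : Prop := exists C : R, forall n : nat,
  \sum_(j < n) `|dev K mu j%:R| / j.+1%:R ^+ 2 <= C /\
  \sum_(j < n) `|dev K mu (- j%:R)| / j.+1%:R ^+ 2 <= C.

End counting.

Section almost_surely_regular.
Context d {T : measurableType d} {R : realType} (P : probability T R).
Variables (M : {RV P >-> wpm R}) (K : R) (h : R -> R).
Hypothesis M_stationary : stationary M.
Hypothesis K_gt0 : 0 < K.
Hypothesis M_intensity : intensity M = K%:E.
Hypothesis h_ge0 : forall r, 1 <= r -> 0 <= h r.
Hypothesis h_measurable : measurable_fun (`[1, +oo[%classic : set R) h.
Hypothesis M_dev : forall x, 1 <= `|x| ->
  ('E_P[fun omega => `|counting_fun (M omega) x - K * x|%R] <= (h `|x|)%:E)%E.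
Hypothesis h_int : (\int[lebesgue_measure]_(r in `[1%R, +oo[)
                (h r / r ^+ 2)%:E < +oo)%E.

Lemma measurable_dev x : measurable_fun setT (fun w => dev K (M w) x).
Proof.
apply: measurable_funB => //; rewrite /counting_fun.
have mf (B : set R) : measurable B -> measurable_fun setT (fun w => fine (M w B)).
  move=> mB; apply: (measurableT_comp (fine_measurable measurableT)) => //.
  exact: measurable_Mw.
by case: (0 <= x); [exact: mf|apply: measurable_funN; exact: mf].
Qed.

Lemma expectation_dev_le (x y : R) : `|x - y| <= 1 -> 1 <= `|y| ->
  (\int[P]_w (`|dev K (M w) x|)%:E <= (h `|y| + 2 * K)%:E)%E.
Proof.
move=> xy y1.
have mm : measurable_fun setT
    (fun w => M w `](Num.min x y), (Num.min x y + 1)%R]%classic).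
  exact: measurable_Mw.
have mnd z : measurable_fun setT (fun w => (`|dev K (M w) z|)%:E).
  by apply/measurable_EFinP; apply: measurableT_comp => //; exact: measurable_dev.
apply: (@le_trans _ _ (\int[P]_w ((`|dev K (M w) y|)%:E +
    M w `](Num.min x y), (Num.min x y + 1)%R]%classic + K%:E))%E).
  apply: ge0_le_integral => //.
  - by apply: emeasurable_funD => //; exact: emeasurable_funD.
  - move=> w _; rewrite -(fineK (wpm_oc_fin (M w) _ _)) -!EFinD lee_fin.
    exact: dev_diff_le (ltW K_gt0) xy.
rewrite ge0_integralD//; last 3 first.
- by move=> w _; rewrite adde_ge0.
- exact: emeasurable_funD.
- by move=> w _; rewrite lee_fin ltW.
rewrite ge0_integralD// (expectation_unit_cell M_stationary M_intensity).
rewrite integral_cst//= probability_setT mule1 -addeA -EFinD (_ : K + K = 2 * K); last by ring.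
rewrite [leRHS]EFinD leeD2r//.
by have := M_dev y1; rewrite unlock.
Qed.

Lemma measurable_h_div_sqr :
  measurable_fun (`[1, +oo[%classic : set R) (fun r => (h r / r ^+ 2)%:E).
Proof.
apply/measurable_EFinP; apply: measurable_funM => //.
apply: measurable_funTS; apply: (measurableT_comp measurable_invr).
exact: exprn_measurable.
Qed.

Lemma sum_h_le (n : nat) :
  (\sum_(j < n) \int[lebesgue_measure]_(r in `[j.+1%:R, j.+2%:R[) (h r / r ^+ 2)%:E
   <= \int[lebesgue_measure]_(r in `[1%R, +oo[) (h r / r ^+ 2)%:E)%E.
Proof.
have f0 r : 1 <= r -> (0 <= (h r / r ^+ 2)%:E)%E.
  by move=> r1; rewrite lee_fin divr_ge0 ?h_ge0// sqr_ge0.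
have mI (I : set R) : measurable I -> I `<=` `[1, +oo[ ->
    measurable_fun I (fun r => (h r / r ^+ 2)%:E).
  move=> mI I1; apply: measurable_funS measurable_h_div_sqr => //.
suff -> : (\sum_(j < n) \int[lebesgue_measure]_(r in `[j.+1%:R, j.+2%:R[) (h r / r ^+ 2)%:E
   = \int[lebesgue_measure]_(r in `[1%R, n.+1%:R[) (h r / r ^+ 2)%:E)%E.
  apply: ge0_subset_integral => //; first exact: mI.
    by move=> r /=; rewrite in_itv/= andbT; exact: f0.
  by move=> r /=; rewrite !in_itv/= => /andP[->].
have n1 (k : nat) : 1 <= k.+1%:R :> R by rewrite ler1n.
have kk (k : nat) : k.+1%:R <= k.+2%:R :> R by rewrite ler_nat.
elim: n => [|n IH].
  by rewrite big_ord0 set_itv_ge ?bnd_simp ?ltxx// integral_set0.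
rewrite big_ord_recr /= IH -ge0_integral_setU//.
- by congr (\int[_]_(r in _) _)%E; rewrite -itv_bndbnd_setU ?bnd_simp.
- apply: mI; first exact: measurableU.
  move=> r /= [|]; rewrite !in_itv/= andbT => /andP[]// nr _.
  exact: le_trans nr.
- move=> r /= [|]; rewrite !in_itv/= => /andP[r1 _]; apply: f0 => //.
  exact: le_trans r1.
- apply/disj_setPS => r /= []; rewrite !in_itv/= => /andP[_ rn] /andP[nr _].
  by move: (lt_le_trans rn nr); rewrite ltxx.
Qed.

(** The sum is bounded in expectation. The discrepancy at the integer [j + 1] is
    compared with the one at every point [r] of [`[j + 1, j + 2[]; averaging over
    [r] turns the bound by [h r] into a bound by its integral, without any
    regularity of [h]. *)
Lemma ae_regular_side (sg : R) : `|sg| = 1 ->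
  {ae P, forall w, exists C : R, forall n : nat,
   \sum_(j < n) `|dev K (M w) (sg * j%:R)| / j.+1%:R ^+ 2 <= C}.
Proof.
move=> sg1.
pose a j w := (`|dev K (M w) (sg * j%:R)| / j.+1%:R ^+ 2)%:E.
have a0 j w : (0 <= a j w)%E by rewrite lee_fin divr_ge0// sqr_ge0.
have ma j : measurable_fun setT (a j).
  apply/measurable_EFinP; apply: measurable_funM => //.
  by apply: measurableT_comp => //; exact: measurable_dev.
pose H := (\int[lebesgue_measure]_(r in `[1%R, +oo[) (h r / r ^+ 2)%:E)%E.
have aj j : (\int[P]_w a j.+1 w <=
   \int[lebesgue_measure]_(r in `[j.+1%:R, j.+2%:R[) (h r / r ^+ 2)%:E +
   (2 * K / j.+2%:R ^+ 2)%:E)%E.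
  pose A := (\int[P]_w (`|dev K (M w) (sg * j.+1%:R)|)%:E)%E.
  have Ah r : j.+1%:R <= r -> r < j.+2%:R -> (A <= (h r + 2 * K)%:E)%E.
    move=> jr rj; have r0 : 0 <= r by apply: le_trans jr.
    have -> : r = `|sg * r| by rewrite normrM sg1 mul1r ger0_norm.
    apply: expectation_dev_le.
      rewrite -mulrBr normrM sg1 mul1r distrC ger0_norm ?subr_ge0//.
      by move: rj; rewrite -[j.+2%:R]natr1; lra.
    rewrite normrM sg1 mul1r ger0_norm//; apply: le_trans jr.
    by rewrite ler1n.
  have A0 : (0 <= A)%E by apply: integral_ge0.
  have Af : A \is a fin_num.
    rewrite ge0_fin_numE//; apply: (le_lt_trans (Ah j.+1%:R (lexx _) _)).
      by rewrite ltr_nat.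
    exact: ltry.
  have -> : (\int[P]_w a j.+1 w = (fine A / j.+2%:R ^+ 2)%:E)%E.
    under eq_integral do rewrite /a mulrC EFinM.
    rewrite ge0_integralZl ?lee_fin ?invr_ge0 ?sqr_ge0//; last first.
      by apply/measurable_EFinP; apply: measurableT_comp => //; exact: measurable_dev.
    by rewrite -/A -{1}(fineK Af) -EFinM mulrC.
  (* [c] is a constant below [h r / r ^ 2] on the cell, which has length 1. *)
  pose c := Num.max 0 ((fine A - 2 * K) / j.+2%:R ^+ 2).
  have c0 : 0 <= c by rewrite le_max lexx.
  apply: (@le_trans _ _ (c%:E + (2 * K / j.+2%:R ^+ 2)%:E)%E).
    rewrite -EFinD lee_fin -lerBlDr -mulrBl /c le_max lexx orbT//.
  rewrite leeD2r//.
  have -> : c%:E = (\int[lebesgue_measure]_(r in `[j.+1%:R, j.+2%:R[) c%:E)%E.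
    rewrite integral_cst//= lebesgue_measure_itv/= lte_fin ltr_nat leqnn.
    by rewrite -EFinB -natrB// subSnn mule1.
  apply: ge0_le_integral => //.
  - apply: measurable_funS measurable_h_div_sqr => //.
    move=> r /=; rewrite !in_itv/= andbT => /andP[jr _]; apply: le_trans jr.
    by rewrite ler1n.
  - move=> r; rewrite /= in_itv/= => /andP[jr rj].
    have r1 : 1 <= r by apply: le_trans jr; rewrite ler1n.
    have r0 : 0 < r by apply: lt_le_trans r1.
    rewrite lee_fin /c ge_max divr_ge0 ?h_ge0 ?sqr_ge0//=.
    have : fine A - 2 * K <= h r.
      by rewrite lerBlDr; have := Ah r jr rj; rewrite -{1}(fineK Af) lee_fin.
    move=> /(ler_wpM2r (_ : 0 <= (j.+2%:R ^+ 2)^-1)).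
    rewrite invr_ge0 sqr_ge0 => /(_ isT)/le_trans; apply.
    rewrite ler_wpM2l ?h_ge0// lef_pV2 ?posrE ?exprn_gt0//.
    by rewrite lerXn2r ?nnegrE ?ltW.
have sumj (n : nat) : \sum_(j < n) (2 * K / j.+2%:R ^+ 2) <= 2 * K.
  have s1 : 2 * K * (1 - n.+1%:R^-1) <= 2 * K.
    rewrite -[leRHS]mulr1 ler_wpM2l ?mulr_ge0 ?(ltW K_gt0)//.
  apply: le_trans s1; elim: n => [|n IH]; first by rewrite big_ord0 invr1 subrr mulr0.
  rewrite big_ord_recr /=; apply: le_trans (lerD IH (lexx _)) _.
  rewrite -mulrDr ler_wpM2l ?mulr_ge0 ?(ltW K_gt0)//.
  rewrite -addrA lerD2l addrC -lerBrDr opprK addrC.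
  have -> : n.+1%:R^-1 - n.+2%:R^-1 = (n.+1%:R * n.+2%:R)^-1 :> R.
    have gen (x : R) : 0 < x -> x^-1 - (x + 1)^-1 = (x * (x + 1))^-1.
      by move=> x0; field; rewrite !gt_eqF// ltr_wpDr.
    by rewrite -[n.+2%:R]natr1 gen.
  rewrite lef_pV2 ?posrE ?mulr_gt0 ?exprn_gt0// expr2 ler_wpM2r//.
  by rewrite ler_nat.
have Ea : (\int[P]_w \sum_(j <oo) a j w <= H + (2 * K)%:E)%E.
  rewrite integral_nneseries//; apply: lime_le.
    by apply: is_cvg_nneseries => j _ _; exact: integral_ge0.
  apply: nearW => n; apply: (@le_trans _ _ (\sum_(0 <= j < n.+1) \int[P]_w a j w)%E).
    by rewrite big_nat_recr//= leeDl// integral_ge0.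
  rewrite big_nat_recl//= [X in (X + _)%E](_ : _ = 0%E); last first.
    under eq_integral do rewrite /a mulr0 /dev counting_fun0 mulr0 subrr normr0 mul0r.
    by rewrite integral0.
  rewrite add0e big_mkord.
  apply: (@le_trans _ _ (\sum_(j < n) (\int[lebesgue_measure]_(r in `[j.+1%:R, j.+2%:R[) (h r / r ^+ 2)%:E +
   (2 * K / j.+2%:R ^+ 2)%:E))%E).
    by apply: lee_sum => j _; exact: aj.
  rewrite big_split /=; apply: leeD; first exact: sum_h_le.
  by rewrite sumEFin lee_fin; exact: sumj.
have ms : measurable_fun setT (fun w => \sum_(j <oo) a j w)%E.
  exact: ge0_emeasurable_sum.
have iS : P.-integrable setT (fun w => \sum_(j <oo) a j w)%E.
  apply/integrableP; split => //.
  under eq_integral do rewrite gee0_abs ?nneseries_ge0//.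
  by apply: le_lt_trans Ea _; rewrite lte_add_pinfty// ltry.
have := integrable_ae measurableT iS; apply: filterS => w /(_ I) sf.
exists (fine (\sum_(j <oo) a j w)%E) => n.
rewrite -lee_fin fineK// -sumEFin.
rewrite -(big_mkord xpredT (a ^~ w)).
by apply: nneseries_lim_ge => j _ _; exact: a0.
Qed.

Lemma ae_regular : {ae P, forall w, regular K (M w)}.
Proof.
have := @ae_regular_side 1 (normr1 _); have := @ae_regular_side (-1) ltac:(by rewrite normrN1).
apply: filterS2 => w [C1 h1] [C2 h2]; exists (Num.max C1 C2) => n; split.
- apply: le_trans (_ : C2 <= _); last by rewrite le_max lexx orbT.
  by have := h2 n; under eq_bigr do rewrite mul1r.
- apply: le_trans (_ : C1 <= _); last by rewrite le_max lexx.
  by have := h1 n; under eq_bigr do rewrite mulN1r.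
Qed.

End almost_surely_regular.

(** * Discrepancy sequences and summation by parts *)

Section series_tail.
Context {R : realType}.

Lemma bounded_series_tail (a : nat -> R) (C e : R) : (forall j, 0 <= a j) ->
  (forall n : nat, \sum_(j < n) a j <= C) -> 0 < e ->
  exists N : nat, forall p q : nat, (N <= p)%N -> \sum_(p <= j < q) a j <= e.
Proof.
move=> a0 aC e0; pose u n := \sum_(0 <= j < n) a j.
have u_nd : nondecreasing_seq u.
  by apply/nondecreasing_seqP => n; rewrite /u big_nat_recr//= lerDl.
have u_ub n : u n <= C by rewrite /u big_mkord.
have cu : cvgn u by apply: nondecreasing_is_cvgn => //; exists C => _ [n _ <-].
have ul n : u n <= limn u by exact: nondecreasing_cvgn_le.
have [N _ HN] : \forall n \near \oo, limn u - e < u n.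
  by apply: (cvgr_gt (limn u)) => //; rewrite gtrBl.
exists N => p q Np; have [pq|qp] := leqP p q; last by rewrite big_geq ?(ltnW qp)// ltW.
have -> : \sum_(p <= j < q) a j = u q - u p.
  by rewrite /u (@big_cat_nat _ _ _ p 0 q)//= addrAC subrr add0r.
have := ul q; have := HN p Np; lra.
Qed.

Lemma dominated_series_cvg (a t : nat -> R) (C : R) :
  (forall n : nat, \sum_(j < n) a j <= C) -> (forall j, `|t j| <= a j) ->
  cvgn (fun n => \sum_(j < n) t j).
Proof.
move=> aC ta; have a0 j : 0 <= a j by exact: le_trans (ta j).
have cv (b : nat -> R) (B : R) : (forall j, 0 <= b j) -> (forall n : nat, \sum_(j < n) b j <= B) ->
    cvgn (fun n => \sum_(j < n) b j).
  move=> b0 bB; apply: nondecreasing_is_cvgn; last by exists B => _ [n _ <-].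
  by apply/nondecreasing_seqP => n; rewrite big_ord_recr/= lerDl.
have -> : (fun n => \sum_(j < n) t j) =
    (fun n => \sum_(j < n) (a j + t j) - \sum_(j < n) a j).
  by apply/funext => n /=; rewrite -sumrB; apply: eq_bigr => j _; ring.
have c1 : cvgn (fun n => \sum_(j < n) (a j + t j)).
  apply: (cv (fun j => a j + t j) (C + C)) => [j|n]; first by have := ta j; rewrite ler_norml => /andP[]; lra.
  rewrite big_split /=; apply: lerD; first exact: aC.
  apply: le_trans (aC n); apply: ler_sum => j _.
  exact: le_trans (ler_norm _) (ta j).
by apply/cvg_ex; eexists; exact: (cvgB c1 (cv _ _ a0 aC)).
Qed.

End series_tail.

Section discrepancy_sequences.
Context {R : realType}.
Variables (K C : R) (m : nat -> R).
Hypothesis K0 : 0 <= K.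
Hypothesis m0 : forall j, 0 <= m j.

(** For masses [m j] of consecutive unit cells, their partial sums against the
    linear growth they should have. *)
Definition discrepancy (n : nat) : R := \sum_(j < n) m j - K * n%:R.
Local Notation D := discrepancy.

Hypothesis D_summable : forall n : nat, \sum_(j < n) `|D j| / j.+1%:R ^+ 2 <= C.

Lemma discrepancyS n : D n.+1 = D n + m n - K.
Proof. by rewrite /D big_ord_recr /= -natr1; ring. Qed.

(** The masses are nonnegative, so the discrepancy decreases at rate at most [K]. *)
Lemma discrepancy_ge n i : D n - K * i%:R <= D (n + i).
Proof.
elim: i => [|i IH]; first by rewrite addn0 mulr0 subr0.
rewrite addnS discrepancyS -natr1; have := m0 (n + i); lra.
Qed.

(** A large discrepancy persists on one side: on the right of [n] if it is
    positive, on the left if it is negative. Averaging over [p] neighbours loses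
    at most [K p]. *)
Lemma discrepancy_avg n p : (p <= n)%N ->
  p%:R * `|D n| <= \sum_(n - p <= j < n + p) `|D j| + K * p%:R ^+ 2.
Proof.
move=> pn.
have sub (a b : nat) : (n - p <= a)%N -> (b <= n + p)%N ->
    \sum_(a <= j < b) `|D j| <= \sum_(n - p <= j < n + p) `|D j|.
  move=> pa bp; have [ab|ba] := leqP a b; last first.
    by rewrite big_geq ?(ltnW ba)//; exact: sumr_ge0.
  rewrite (@big_cat_nat _ _ _ a (n - p))//=; last exact: leq_trans bp.
  rewrite (@big_cat_nat _ _ _ b a (n + p))//=.
  by rewrite addrCA lerDl addr_ge0// sumr_ge0.
have shift (f : nat -> R) a : \sum_(i < p) f (a + i)%N = \sum_(a <= j < a + p) f j.
  have -> : \sum_(a <= j < a + p) f j = \sum_(0 + a <= j < a + p) f j by rewrite add0n.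
  by rewrite big_addn addKn big_mkord; apply: eq_bigr => i _; rewrite addnC.
have cst (c : R) : p%:R * c = \sum_(i < p) c by rewrite sumr_const card_ord mulr_natl.
have [Dn|Dn] := leP 0 (D n).
- apply: (@le_trans _ _ (\sum_(i < p) (`|D (n + i)| + K * p%:R))).
    rewrite cst; apply: ler_sum => i _.
    have := discrepancy_ge n i; have := ler_norm (D (n + i)).
    have : K * i%:R <= K * p%:R by rewrite ler_wpM2l// ler_nat ltnW.
    by rewrite (ger0_norm Dn); lra.
  rewrite big_split /= -cst expr2 [p%:R * _]mulrCA lerD2r (shift (fun j => `|D j|)).
  by apply: sub => //; exact: leq_subr.
- apply: (@le_trans _ _ (\sum_(i < p) (`|D (n - p + i)| + K * p%:R))).
    rewrite cst; apply: ler_sum => i _.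
    have := discrepancy_ge (n - p + i) (p - i).
    have -> : (n - p + i + (p - i) = n)%N by have := ltn_ord i; lia.
    have := ler_norm (- D (n - p + i)); rewrite normrN.
    have : K * (p - i)%:R <= K * p%:R by rewrite ler_wpM2l// ler_nat leq_subr.
    by rewrite (ltr0_norm Dn); lra.
  rewrite big_split /= -cst expr2 [p%:R * _]mulrCA lerD2r (shift (fun j => `|D j|)).
  by apply: sub => //; lia.
Qed.

Lemma discrepancy_tail (e : R) : 0 < e -> exists N : nat, forall a b : nat,
  (N <= a)%N -> \sum_(a <= j < b) `|D j| / j.+1%:R ^+ 2 <= e.
Proof.
move=> e0; apply: (@bounded_series_tail _ (fun j => `|D j| / j.+1%:R ^+ 2) C) => //.
Qed.

(** By the averaging inequality with [p] a small multiple of [n], the tail of the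
    weighted sum controls [D n / n]. *)
Lemma discrepancy_o : D n / n.+1%:R @[n --> \oo] --> (0 : R).
Proof.
apply/cvgr0Pnorm_le => e e0.
(* [p] is between [dl * (n + 1)] and twice that: the loss [K p] is at most
   [e (n + 1) / 2], and [n - p] is still about [n / 2], where the tail sum is
   small. *)
pose dl := Num.min (4^-1) (e / (4 * (K + 1))).
have K1 : 0 < K + 1 by rewrite ltr_wpDl.
have dl0 : 0 < dl by rewrite lt_min invr_gt0 ltr0n divr_gt0// mulr_gt0.
have dl4 : dl <= 4^-1 by rewrite ge_min lexx.
have dlK : 2 * K * dl <= e / 2.
  apply: (@le_trans _ _ (2 * (K + 1) * (e / (4 * (K + 1))))).
    apply: ler_pM; rewrite ?mulr_ge0 ?(ltW dl0)//; first by rewrite ler_wpM2l// lerDl.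
    by rewrite ge_min lexx orbT.
  by rewrite le_eqVlt; apply/orP; left; apply/eqP; field; rewrite gt_eqF.
(* The averaging inequality divides the tail by [p / (n + 1) >= dl]; the
   factor 8 absorbs the weights [(j + 1) ^ 2 <= (2 (n + 1)) ^ 2] and leaves
   half of [e]. *)
have [N HN] := discrepancy_tail (divr_gt0 (mulr_gt0 e0 dl0) (ltr0n R 8)).
exists (maxn (2 * N).+2 (Num.truncn dl^-1).+1) => // n /=.
rewrite geq_max => /andP[nN nd].
pose p := (Num.truncn (dl * n.+1%:R)).+1.
have n1 : 0 < n.+1%:R :> R by [].
have p1 : dl * n.+1%:R <= p%:R by rewrite ltW// truncnS_gt.
have dn : 1 <= dl * n.+1%:R.
  rewrite mulrC -ler_pdivrMr// mul1r; apply: (le_trans (ltW (truncnS_gt _))).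
  by rewrite ler_nat (leq_trans nd).
have p2 : p%:R <= 2 * (dl * n.+1%:R).
  rewrite /p -natr1; have := truncn_le (dl * n.+1%:R).
  by rewrite mulr_ge0 ?(ltW dl0)// => h; lra.
have p2' : 2 * p%:R <= n.+1%:R :> R.
  have : dl * n.+1%:R <= 4^-1 * n.+1%:R by rewrite ler_wpM2r.
  lra.
have pn2 : (2 * p <= n.+1)%N by rewrite -(ler_nat R) natrM.
have pp : (0 < p)%N by [].
have pn : (p <= n)%N by move: pp pn2; clear; lia.
have p0 : 0 < p%:R :> R by [].
have := discrepancy_avg pn.
have T : \sum_(n - p <= j < n + p) `|D j| <= (2 * n.+1%:R) ^+ 2 * (e * dl / 8).
  apply: (@le_trans _ _ (\sum_(n - p <= j < n + p) (2 * n.+1%:R) ^+ 2 * (`|D j| / j.+1%:R ^+ 2))).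
    rewrite !big_nat; apply: ler_sum => j /andP[_ jn].
    rewrite mulrCA ler_peMr// ler_pdivlMr ?exprn_gt0// mul1r.
    rewrite lerXn2r ?nnegrE ?mulr_ge0// -natrM ler_nat.
    by move: jn pn; clear; lia.
  rewrite -mulr_sumr ler_wpM2l ?sqr_ge0//; apply: HN.
  by move: pn2 nN; clear; lia.
move=> avg.
rewrite normrM normfV [`|n.+1%:R|]ger0_norm// ler_pdivrMr//.
rewrite -(ler_pM2l p0); apply: (le_trans avg).
apply: (le_trans (lerD T (lexx _))).
have -> : p%:R * (e * n.+1%:R) = p%:R * (e / 2 * n.+1%:R) + p%:R * (e / 2 * n.+1%:R).
  by rewrite -mulrDr -mulrDl -splitr.
apply: lerD.
  have -> : (2 * n.+1%:R) ^+ 2 * (e * dl / 8) = (dl * n.+1%:R) * (e / 2 * n.+1%:R) by field.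
  by rewrite ler_wpM2r// !mulr_ge0// ?invr_ge0// ltW.
rewrite expr2 mulrCA ler_wpM2l ?(ltW p0)//.
apply: (@le_trans _ _ (2 * K * dl * n.+1%:R)); last by rewrite ler_wpM2r.
have := ler_wpM2l K0 p2; lra.
Qed.

Lemma mass_o : m n / n.+1%:R @[n --> \oo] --> (0 : R).
Proof.
have i0 : n.+1%:R^-1 @[n --> \oo] --> (0 : R) by exact: cvg_harmonic.
have h1 : D n.+1 / n.+2%:R @[n --> \oo] --> (0 : R).
  by rewrite (cvg_shiftS (fun n => D n / n.+1%:R)); exact: discrepancy_o.
have h2 : (D n.+1 / n.+2%:R) * (1 + n.+1%:R^-1) - D n / n.+1%:R + K * n.+1%:R^-1
    @[n --> \oo] --> (0 * (1 + 0) - 0 + K * 0 : R).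
  apply: cvgD; last by apply: cvgM => //; exact: cvg_cst.
  apply: cvgB; last exact: discrepancy_o.
  by apply: cvgM => //; apply: cvgD => //; exact: cvg_cst.
rewrite mul0r subrr mulr0 addr0 in h2.
apply: cvg_trans h2; apply: near_eq_cvg; apply: nearW => n.
rewrite discrepancyS -[n.+2%:R]natr1; set x : R := n.+1%:R.
have x0 : 0 < x by [].
by field; rewrite !gt_eqF// addr_gt0.
Qed.

Lemma sum_inv_sqr_le (n : nat) : \sum_(j < n) (j.+1%:R ^+ 2)^-1 <= 2 :> R.
Proof.
suff h k : \sum_(j < k.+1) (j.+1%:R ^+ 2)^-1 <= 2 - k.+1%:R^-1 :> R.
  case: n => [|n]; first by rewrite big_ord0.
  by apply: le_trans (h n) _; rewrite lerBlDr lerDl invr_ge0.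
elim: k => [|k IH]; first by rewrite big_ord1 expr1n invr1; lra.
rewrite big_ord_recr /=; apply: (le_trans (lerD IH (lexx _))).
rewrite -[k.+2%:R]natr1; set x : R := k.+1%:R.
have x0 : 0 < x by [].
have : ((x + 1) ^+ 2)^-1 <= (x * (x + 1))^-1.
  rewrite lef_pV2 ?posrE ?exprn_gt0 ?mulr_gt0 ?addr_gt0// expr2 ler_wpM2r//.
    by rewrite addr_ge0// ltW.
  by rewrite lerDl.
have -> : (x * (x + 1))^-1 = x^-1 - (x + 1)^-1.
  by field; rewrite !gt_eqF// addr_gt0.
by move=> h; apply: (le_trans (lerD (lexx _) h)); rewrite addrA subrK.
Qed.

(** Bounds the three coefficients that multiply the oscillation of the kernel
    on the cell in the summation by parts. *)
Definition cell_cost (j : nat) : R := m j + K + `|D j.+1|.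

Lemma cell_cost_ge0 j : 0 <= cell_cost j.
Proof. by rewrite !addr_ge0. Qed.

Lemma cell_cost_summable n :
  \sum_(j < n) cell_cost j / j.+1%:R ^+ 2 <= 9 * C + 4 * K.
Proof.
have sh : \sum_(j < n) `|D j.+1| / j.+2%:R ^+ 2 <= C.
  have := D_summable n.+1; rewrite big_ord_recl /=.
  by rewrite /D big_ord0 mulr0 subr0 normr0 mul0r add0r.
apply: (@le_trans _ _ (\sum_(j < n) (8 * (`|D j.+1| / j.+2%:R ^+ 2) +
    `|D j| / j.+1%:R ^+ 2 + 2 * K * (j.+1%:R ^+ 2)^-1))).
  apply: ler_sum => j _; set x : R := j.+1%:R.
  have x0 : 1 <= x by rewrite /x ler1n.
  (* The cost of cell [j] involves [D j.+1], whose weight in the summability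
     hypothesis is [1 / (j + 2) ^ 2]. *)
  have h4 : (x ^+ 2)^-1 <= 4 * (j.+2%:R ^+ 2)^-1.
    have xx : 0 < x by rewrite (lt_le_trans ltr01).
    rewrite -[j.+2%:R]natr1 -/x ler_pdivlMr; last by rewrite exprn_gt0// addr_gt0.
    by rewrite mulrC ler_pdivrMr ?exprn_gt0//; nra.
  have mj : m j <= `|D j.+1| + `|D j| + K.
    rewrite (_ : m j = D j.+1 - D j + K); last by rewrite discrepancyS; ring.
    by rewrite lerD2r (le_trans (ler_norm _)) ?ler_normB.
  apply: (@le_trans _ _ ((2 * `|D j.+1| + `|D j| + 2 * K) * (x ^+ 2)^-1)).
    rewrite ler_wpM2r ?invr_ge0 ?sqr_ge0// /cell_cost.
    apply: (le_trans (lerD (lerD mj (lexx K)) (lexx _))).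
    by rewrite le_eqVlt; apply/orP; left; apply/eqP; ring.
  have -> : (2 * `|D j.+1| + `|D j| + 2 * K) * (x ^+ 2)^-1 =
      2 * (`|D j.+1| * (x ^+ 2)^-1) + `|D j| / x ^+ 2 + 2 * K * (x ^+ 2)^-1 by ring.
  rewrite lerD2r lerD2r.
  have -> : 8 * (`|D j.+1| / j.+2%:R ^+ 2) = 2 * (`|D j.+1| * (4 * (j.+2%:R ^+ 2)^-1)) by ring.
  by rewrite ler_wpM2l// ler_wpM2l.
rewrite !big_split /= -!mulr_sumr.
have := D_summable n; have := ler_wpM2l K0 (sum_inv_sqr_le n); lra.
Qed.

(** Summation by parts. In each cell the integral [I j] is replaced by the mass
    times the value [phi j] of the kernel, and the increment [P j] of the
    primitive by [phi j]; what remains is [(m j - K) * phi j], where [m j - K] is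
    an increment of the discrepancy. Every replacement costs at most the
    oscillation [ep j] of the kernel on the cell. *)
Lemma abel_cells (I P phi ep : nat -> R) (n : nat) :
  (forall j, `|I j - m j * phi j| <= m j * ep j) ->
  (forall j, `|P j - phi j| <= ep j) ->
  (forall j, `|phi j.+1 - phi j| <= ep j) ->
  let t j := (I j - m j * phi j) - K * (P j - phi j)
    - D j.+1 * (phi j.+1 - phi j) in
  \sum_(j < n) (I j - K * P j) = D n * phi n + \sum_(j < n) t j /\
  forall j, `|t j| <= cell_cost j * ep j.
Proof.
move=> hI hP hphi t; split.
  elim: n => [|n IH]; first by rewrite !big_ord0 /D big_ord0 mulr0 subr0 mul0r addr0.
  rewrite !big_ord_recr /= IH /t discrepancyS; ring.
move=> j; rewrite /t /cell_cost.
have -> : (m j + K + `|D j.+1|) * ep j = m j * ep j + K * ep j + `|D j.+1| * ep j by ring.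
apply: (le_trans (ler_normB _ _)); apply: lerD; last by rewrite normrM ler_wpM2l.
apply: (le_trans (ler_normB _ _)); apply: lerD => //.
by rewrite normrM (ger0_norm K0) ler_wpM2l.
Qed.

Lemma cells_cvg (I P phi ep : nat -> R) (c : R) :
  (forall j, `|I j - m j * phi j| <= m j * ep j) ->
  (forall j, `|P j - phi j| <= ep j) ->
  (forall j, `|phi j.+1 - phi j| <= ep j) ->
  (forall j, ep j <= c / j.+1%:R ^+ 2) ->
  (forall j, `|phi j| <= c / j.+1%:R) ->
  cvgn (fun n => \sum_(j < n) (I j - K * P j)).
Proof.
move=> hI hP hphi epc phic.
have c0 : 0 <= c by have := le_trans (normr_ge0 _) (phic 0); rewrite divr1.
pose t j := (I j - m j * phi j) - K * (P j - phi j) - D j.+1 * (phi j.+1 - phi j).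
have tle j : `|t j| <= cell_cost j * ep j.
  by have [_] := abel_cells 0 hI hP hphi; exact.
have -> : (fun n => \sum_(j < n) (I j - K * P j)) =
    (fun n => D n * phi n + \sum_(j < n) t j).
  by apply/funext => n; have [] := abel_cells n hI hP hphi.
have c1 : D n * phi n @[n --> \oo] --> (0 : R).
  apply/norm_cvg0P.
  apply: (@squeeze_cvgr _ _ _ _ (cst 0) (fun n => `|D n / n.+1%:R| * c)).
  + apply: nearW => n; rewrite normr_ge0/= !normrM normfV [`|n.+1%:R|]ger0_norm//.
    by rewrite -mulrA ler_wpM2l// mulrC.
  + exact: cvg_cst.
  + have h : `|D n / n.+1%:R| @[n --> \oo] --> (0 : R).
      by apply/(norm_cvg0P (fun n => D n / n.+1%:R)); exact: discrepancy_o.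
    by have := cvgM h (cvg_cst c); rewrite mul0r; exact.
have c2 : cvgn (fun n => \sum_(j < n) t j).
  apply: (@dominated_series_cvg _ (fun j => cell_cost j / j.+1%:R ^+ 2 * c) _
    ((9 * C + 4 * K) * c)).
  + by move=> n; rewrite -mulr_suml ler_wpM2r//; exact: cell_cost_summable.
  + move=> j; apply: (le_trans (tle j)).
    by rewrite -mulrA ler_wpM2l ?cell_cost_ge0// mulrC.
by apply/cvg_ex; eexists; exact: (cvgD c1 c2).
Qed.

Lemma cells_bound (I P phi ep : nat -> R) (n : nat) :
  (forall j, `|I j - m j * phi j| <= m j * ep j) ->
  (forall j, `|P j - phi j| <= ep j) ->
  (forall j, `|phi j.+1 - phi j| <= ep j) ->
  `|\sum_(j < n) (I j - K * P j)| <= `|D n * phi n| + \sum_(j < n) cell_cost j * ep j.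
Proof.
move=> hI hP hphi; have [-> tle] := abel_cells n hI hP hphi.
apply: (le_trans (ler_normD _ _)); rewrite lerD2l.
by apply: (le_trans (ler_norm_sum _ _ _)); apply: ler_sum => j _; exact: tle.
Qed.

(** In the first [N] cells the factor is at most [1 / y ^ 2]; in the others the
    sum is a tail of a convergent series, uniformly in [y >= 1]. *)
Lemma cell_cost_small (e : R) : 0 < e -> exists Y : R, forall y, Y <= y -> 1 <= y ->
  forall n : nat, \sum_(j < n) cell_cost j * (j%:R ^+ 2 + y ^+ 2)^-1 <= e.
Proof.
move=> e0.
have [N HN] : exists N : nat, forall p q : nat, (N <= p)%N ->
    \sum_(p <= j < q) cell_cost j / j.+1%:R ^+ 2 <= e / 4.
  apply: (bounded_series_tail _ cell_cost_summable); last by rewrite divr_gt0.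
  by move=> j; rewrite divr_ge0 ?cell_cost_ge0// sqr_ge0.
pose Q := \sum_(0 <= j < N) cell_cost j.
have Q0 : 0 <= Q by apply: sumr_ge0 => j _; exact: cell_cost_ge0.
exists (2 * Q / e) => y Yy y1 n.
have y0 : 0 < y by exact: lt_le_trans y1.
have d0 j : 0 < j%:R ^+ 2 + y ^+ 2 by rewrite ltr_wpDl ?sqr_ge0// exprn_gt0.
have c0 j : 0 <= cell_cost j * (j%:R ^+ 2 + y ^+ 2)^-1.
  by rewrite divr_ge0 ?cell_cost_ge0// ltW.
rewrite -(big_mkord xpredT (fun j => cell_cost j * (j%:R ^+ 2 + y ^+ 2)^-1)).
apply: (@le_trans _ _ (\sum_(0 <= j < N + n) cell_cost j * (j%:R ^+ 2 + y ^+ 2)^-1)).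
  rewrite (@big_cat_nat _ _ _ n 0 (N + n))//= ?leq_addl// lerDl.
  by apply: sumr_ge0.
rewrite (@big_cat_nat _ _ _ N 0 (N + n))//= ?leq_addr//.
have -> : e = e / 2 + e / 2 by rewrite -splitr.
apply: lerD.
- apply: (@le_trans _ _ (Q / y)).
    rewrite /Q mulr_suml; apply: ler_sum => j _; rewrite ler_wpM2l ?cell_cost_ge0//.
    rewrite lef_pV2 ?posrE//; apply: (@le_trans _ _ (y ^+ 2)).
      by rewrite expr2 ler_peMr// ltW.
    by rewrite lerDr sqr_ge0.
  rewrite ler_pdivrMr//; move: Yy; rewrite ler_pdivrMr//; lra.
- apply: (@le_trans _ _ (2 * \sum_(N <= j < N + n) cell_cost j / j.+1%:R ^+ 2)).
    rewrite mulr_sumr; apply: ler_sum => j _.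
    rewrite mulrCA ler_wpM2l ?cell_cost_ge0//.
    rewrite ler_pdivlMr ?exprn_gt0// mulrC ler_pdivrMr// -natr1.
    have : 1 <= y ^+ 2 by rewrite expr_ge1// ltW.
    have := sqr_ge0 (j%:R - 1 : R); nra.
  by have := HN N (N + n) (leqnn _); lra.
Qed.

End discrepancy_sequences.

(** * Integrals over half-lines and unit cells *)

Section wpm_integral.
Context {R : realType}.
Variable mu : wpm R.
Implicit Types (a b s y t : R) (B : set R) (f g : R -> R).

Lemma wpm_int_le a b B f g : measurable B -> B `<=` `[a, b] ->
  measurable_fun setT f -> measurable_fun setT g ->
  (forall x, supp mu x -> B x -> f x <= g x) ->
  \int[mu]_(x in B) f x <= \int[mu]_(x in B) g x.
Proof.
move=> mB Bab mf mg fg; rewrite !(Rintegral_atoms _ mB Bab)//.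
rewrite big_seq_cond [leRHS]big_seq_cond; apply: ler_sum => x /andP[].
rewrite mem_atoms => /andP[/set_mem sx _] /set_mem Bx.
by rewrite ler_wpM2l ?weight_ge0// fg.
Qed.

Lemma wpm_intD a b B f g : measurable B -> B `<=` `[a, b] ->
  measurable_fun setT f -> measurable_fun setT g ->
  \int[mu]_(x in B) (f x + g x) = \int[mu]_(x in B) f x + \int[mu]_(x in B) g x.
Proof.
move=> mB Bab mf mg; rewrite !(Rintegral_atoms _ mB Bab)//; last exact: measurable_funD.
by rewrite -big_split; apply: eq_bigr => x _ /=; rewrite mulrDr.
Qed.

Lemma wpm_intZ a b B f (c : R) : measurable B -> B `<=` `[a, b] ->
  measurable_fun setT f ->
  \int[mu]_(x in B) (c * f x) = c * \int[mu]_(x in B) f x.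
Proof.
move=> mB Bab mf; rewrite !(Rintegral_atoms _ mB Bab)//; last exact: measurable_funM.
by rewrite mulr_sumr; apply: eq_bigr => x _ /=; rewrite mulrCA.
Qed.

Lemma wpm_int_cst a b B (c : R) : measurable B -> B `<=` `[a, b] ->
  \int[mu]_(x in B) c = c * fine (mu B).
Proof.
move=> mB Bab; rewrite (Rintegral_atoms _ mB Bab)// (wpm_measure_atoms mu mB Bab)/=.
by rewrite mulr_sumr; apply: eq_bigr => x _ /=; rewrite mulrC.
Qed.

Lemma wpm_bounded_fin a b B : measurable B -> B `<=` `[a, b] -> mu B \is a fin_num.
Proof. by move=> mB Bab; rewrite (wpm_measure_atoms mu mB Bab). Qed.

Lemma wpm_int_abs_le a b B f (c : R) : measurable B -> B `<=` `[a, b] ->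
  measurable_fun setT f -> (forall x, supp mu x -> B x -> `|f x| <= c) ->
  `|\int[mu]_(x in B) f x| <= c * fine (mu B).
Proof.
move=> mB Bab mf fc; rewrite -(wpm_int_cst _ mB Bab) ler_norml; apply/andP; split.
  have -> : - (\int[mu]_(x in B) c) = \int[mu]_(x in B) (- c).
    by rewrite !(wpm_int_cst _ mB Bab) mulNr.
  apply: (wpm_int_le mB Bab) => // x sx Bx.
  by have := fc x sx Bx; rewrite ler_norml => /andP[].
apply: (wpm_int_le mB Bab) => // x sx Bx.
exact: le_trans (ler_norm _) (fc x sx Bx).
Qed.

Lemma wpm_int_setU a b A B f : measurable A -> measurable B ->
  A `<=` `[a, b] -> B `<=` `[a, b] -> A `&` B = set0 ->
  measurable_fun setT f ->
  \int[mu]_(x in A `|` B) f x = \int[mu]_(x in A) f x + \int[mu]_(x in B) f x.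
Proof.
move=> mA mB Aab Bab AB mf; rewrite Rintegral_setU//.
- apply: (@integrable_atoms _ mu a b) => //; first exact: measurableU.
  by rewrite subUset.
- by rewrite disj_set2E AB eqxx.
Qed.

Lemma wpm_int_near_cst a b B f (c e : R) : measurable B -> B `<=` `[a, b] ->
  measurable_fun setT f -> (forall x, supp mu x -> B x -> `|f x - c| <= e) ->
  `|\int[mu]_(x in B) f x - fine (mu B) * c| <= fine (mu B) * e.
Proof.
move=> mB Bab mf fc.
have -> : \int[mu]_(x in B) f x - fine (mu B) * c = \int[mu]_(x in B) (f x - c).
  rewrite (@wpm_intD a b B f (fun=> - c))// (wpm_int_cst _ mB Bab).
  by rewrite mulNr mulrC.
rewrite mulrC; apply: (wpm_int_abs_le mB Bab) => //.
exact: measurable_funB.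
Qed.

End wpm_integral.

Section half_lines.
Context {R : realType}.
Implicit Types (mu : wpm R) (sd : bool) (t K : R) (f : R -> R).

(** [sd] selects the right or the left half-line. The cells of the left one are
    open on the left like those of the right one, as [counting_fun] requires, and
    numbered away from the origin. *)
Definition half sd t : set R :=
  if sd then `]0, t]%classic else `[(- t), 0]%classic.

Definition cell sd (j : nat) : set R :=
  if sd then `]j%:R, j.+1%:R]%classic else `](- j.+1%:R), (- j%:R)]%classic.

Definition sgn sd : R := if sd then 1 else -1.

Definition cell_mass sd mu (j : nat) : R := fine (mu (cell sd j)).

Lemma sgn_sqr sd : sgn sd * sgn sd = 1.
Proof. by case: sd; rewrite /sgn ?mulr1// mulrNN mulr1. Qed.

Lemma norm_sgn sd : `|sgn sd| = 1.
Proof. by case: sd; rewrite /sgn ?normr1// normrN1. Qed.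

Lemma cell_mass_ge0 sd mu j : 0 <= cell_mass sd mu j.
Proof. by rewrite fine_ge0. Qed.

Lemma measurable_half sd t : measurable (half sd t).
Proof. by case: sd; exact: measurable_itv. Qed.

Lemma measurable_cell sd j : measurable (cell sd j).
Proof. by case: sd; exact: measurable_itv. Qed.

Lemma half_sub sd t : half sd t `<=` `[- `|t|, `|t|].
Proof.
have h := ler_norm t; have h' := normr_ge0 t.
case: sd => x; rewrite /half /= !in_itv/= => /andP[x1 x2]; apply/andP; split; lra.
Qed.

Lemma cell_mem sd j x : cell sd j x -> j%:R <= sgn sd * x <= j.+1%:R.
Proof.
case: sd; rewrite /cell /sgn /= in_itv/= => /andP[x1 x2].
  by rewrite mul1r (ltW x1).
by rewrite mulN1r lerNr x2/= lerNl ltW.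
Qed.

Lemma cell_sub sd j : cell sd j `<=` `[- j.+1%:R, j.+1%:R].
Proof.
move=> x /cell_mem => /andP[h1 h2]; rewrite /= in_itv/=.
have j0 : 0 <= j%:R :> R by [].
by move: h1 h2; rewrite /sgn; case: sd; rewrite ?mul1r ?mulN1r => h1 h2;
  apply/andP; split; lra.
Qed.

Lemma discrepancy_cell_mass K sd mu n :
  discrepancy K (cell_mass sd mu) n = sgn sd * dev K mu (sgn sd * n%:R).
Proof.
rewrite /discrepancy.
have -> : \sum_(j < n) cell_mass sd mu j = sgn sd * counting_fun mu (sgn sd * n%:R).
  elim: n => [|n IH]; first by rewrite big_ord0 mulr0 counting_fun0 mulr0.
  rewrite big_ord_recr /= IH /cell_mass /cell /sgn; case: sd {IH}.
    by rewrite -counting_fun_diff ?ler_nat// !mul1r; ring.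
  by rewrite -counting_fun_diff ?lerN2 ?ler_nat// !mulN1r; ring.
by rewrite /dev mulrBr [sgn sd * (K * _)]mulrCA [sgn sd * (sgn sd * _)]mulrA sgn_sqr mul1r.
Qed.

Lemma regular_discrepancy K mu : regular K mu -> exists C : R, forall sd (n : nat),
  \sum_(j < n) `|discrepancy K (cell_mass sd mu) j| / j.+1%:R ^+ 2 <= C.
Proof.
move=> [C HC]; exists C => sd n.
under eq_bigr do rewrite discrepancy_cell_mass normrM norm_sgn mul1r.
have [h1 h2] := HC n; case: sd; rewrite /sgn.
  by under eq_bigr do rewrite mul1r.
by under eq_bigr do rewrite mulN1r.
Qed.

(** The last, incomplete cell contributes at most its full mass times the
    bound on [f] there. *)
Lemma half_cells sd mu t f (c : R) : 0 <= t -> measurable_fun setT f ->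
  (forall x, cell sd (Num.truncn t) x -> `|f x| <= c) ->
  `|\int[mu]_(x in half sd t) f x
     - \sum_(j < Num.truncn t) \int[mu]_(x in cell sd j) f x|
  <= c * cell_mass sd mu (Num.truncn t).
Proof.
move=> t0 mf fc; set n := Num.truncn t.
have nt : n%:R <= t by rewrite truncn_le.
have tn : t < n.+1%:R by exact: truncnS_gt.
pose tile k : set R := if sd then `]0, k%:R]%classic else `](- k%:R), 0]%classic.
have mtile k : measurable (tile k) by rewrite /tile; case: (sd); exact: measurable_itv.
have tile_sub k (r : R) : k%:R <= r -> tile k `<=` `[- r, r].
  have k0 : 0 <= k%:R :> R by [].
  by move=> kr x; rewrite /tile; case: (sd); rewrite /= !in_itv/= => /andP[h1 h2];
    apply/andP; split; lra.
have sumE k : \sum_(j < k) \int[mu]_(x in cell sd j) f x = \int[mu]_(x in tile k) f x.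
  elim: k => [|k IH].
    rewrite big_ord0 (_ : tile 0 = set0) ?Rintegral_set0//.
    by rewrite /tile; case: (sd); rewrite ?oppr0 set_itv_ge// bnd_simp ltxx.
  rewrite big_ord_recr /= IH -(@wpm_int_setU _ mu (- k.+1%:R) k.+1%:R)//.
  - congr (\int[mu]_(x in _) f x); rewrite /tile /cell; case: (sd).
      by rewrite -itv_bndbnd_setU ?bnd_simp// ler_nat.
    by rewrite setUC -itv_bndbnd_setU ?bnd_simp// ?lerN2 ?ler_nat// oppr_le0.
  - exact: measurable_cell.
  - by apply: tile_sub; rewrite ler_nat.
  - exact: cell_sub.
  - rewrite /tile /cell -subset0; case: (sd) => x /= []; rewrite !in_itv/=.
      by move=> /andP[_ h1] /andP[h2 _]; lra.
    by move=> /andP[h1 _] /andP[_ h2]; lra.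
(* The part of the half-line beyond its last complete cell. *)
pose rest : set R := if sd then `]n%:R, t]%classic else `[(- t), (- n%:R)]%classic.
have mrest : measurable rest by rewrite /rest; case: (sd); exact: measurable_itv.
have rest_cell : rest `<=` cell sd n.
  rewrite /rest /cell; case: (sd) => x; rewrite /= !in_itv/= => /andP[h1 h2].
    by apply/andP; split; lra.
  by apply/andP; split; lra.
have rest_sub : rest `<=` `[- n.+1%:R, n.+1%:R].
  by apply: subset_trans rest_cell _; exact: cell_sub.
have halfE : half sd t = tile n `|` rest.
  rewrite /half /tile /rest; case: (sd).
    by rewrite -itv_bndbnd_setU ?bnd_simp.
  by rewrite setUC -itv_bndbnd_setU ?bnd_simp// ?lerN2// oppr_le0.
rewrite halfE (@wpm_int_setU _ mu (- n.+1%:R) n.+1%:R)//; last 2 first.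
- by apply: tile_sub; rewrite ler_nat.
- rewrite /tile /rest -subset0; case: (sd) => x /= []; rewrite !in_itv/=.
    by move=> /andP[_ h1] /andP[h2 _]; lra.
  by move=> /andP[h1 _] /andP[_ h2]; lra.
rewrite sumE addrAC subrr add0r.
have c0 : 0 <= c.
  apply: le_trans (fc (if sd then n.+1%:R else - n%:R) _); first exact: normr_ge0.
  rewrite /cell; case: (sd); rewrite /= in_itv/= lexx ?andbT; first by rewrite ltr_nat.
  by rewrite ltrN2 ltr_nat.
apply: (le_trans (wpm_int_abs_le mrest rest_sub mf _)).
  by move=> x _ /rest_cell; exact: fc.
rewrite ler_wpM2l// fine_le//.
- exact: wpm_bounded_fin rest_sub.
- exact: wpm_bounded_fin (measurable_cell _ _) (@cell_sub _ _).
- by apply: le_measure => //; rewrite inE//; exact: measurable_cell.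
Qed.

Lemma window_halves mu (a b : R) f : a <= 0 -> 0 <= b -> measurable_fun setT f ->
  \int[mu]_(x in `[a, b]) f x =
  \int[mu]_(x in half true b) f x + \int[mu]_(x in half false (- a)) f x.
Proof.
move=> a0 b0 mf.
rewrite addrC -(@wpm_int_setU _ mu a b)//.
- by rewrite /half opprK -itv_bndbnd_setU ?bnd_simp.
- exact: measurable_half.
- exact: measurable_half.
- by rewrite /half opprK => x /=; rewrite !in_itv/= => /andP[-> h]; rewrite (le_trans h).
- by rewrite /half => x /=; rewrite !in_itv/= => /andP[h ->]; rewrite (le_trans a0 (ltW h)).
- rewrite /half -subset0 => x /= []; rewrite !in_itv/= => /andP[_ h1] /andP[h2 _]; lra.
Qed.

End half_lines.

(** * The Cauchy kernels along a half-line *)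

Section kernel_cells.
Context {R : realType}.
Implicit Types (x y s t K : R) (sd : bool) (mu : wpm R).

Lemma measurable_kerU s y : measurable_fun setT (kerU s y).
Proof.
have msx : measurable_fun setT (fun x : R => s - x) by exact: measurable_funB.
apply: measurable_funM => //; apply: (measurableT_comp measurable_invr).
by apply: measurable_funD => //; exact: measurable_funX.
Qed.

Lemma measurable_kerV s y : measurable_fun setT (kerV s y).
Proof.
have msx : measurable_fun setT (fun x : R => s - x) by exact: measurable_funB.
apply: measurable_funM => //; apply: (measurableT_comp measurable_invr).
by apply: measurable_funD => //; exact: measurable_funX.
Qed.

Lemma kerU_sgn sd y x : kerU 0 y (sgn sd * x) = - sgn sd * (x / (x ^+ 2 + y ^+ 2)).
Proof.
rewrite /kerU sub0r sqrrN exprMn [sgn sd ^+ 2]expr2 sgn_sqr.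
by rewrite mul1r mulNr mulNr mulrA.
Qed.

Lemma kerV_sgn sd y x : kerV 0 y (sgn sd * x) = y / (x ^+ 2 + y ^+ 2).
Proof.
rewrite /kerV sub0r sqrrN exprMn [sgn sd ^+ 2]expr2 sgn_sqr.
by rewrite mul1r.
Qed.

(** The derivative of the kernel is at most [1 / (t ^ 2 + y ^ 2)] on the cell that
    starts at [t]. *)
Lemma kerU_osc y t x : 0 < y -> 0 <= t -> t <= x -> x <= t + 1 ->
  `|x / (x ^+ 2 + y ^+ 2) - t / (t ^+ 2 + y ^+ 2)| <= (t ^+ 2 + y ^+ 2)^-1.
Proof.
move=> y0 t0 tx xt.
have Q0 z : 0 < z ^+ 2 + y ^+ 2 by rewrite ltr_wpDl ?sqr_ge0// exprn_gt0.
have -> : x / (x ^+ 2 + y ^+ 2) - t / (t ^+ 2 + y ^+ 2) =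
    ((x - t) * (y ^+ 2 - t * x) / (x ^+ 2 + y ^+ 2)) * (t ^+ 2 + y ^+ 2)^-1.
  by field; rewrite !gt_eqF.
rewrite normrM normfV (gtr0_norm (Q0 t)) -[leRHS]mul1r ler_wpM2r//.
  by rewrite invr_ge0 ltW.
rewrite normrM normfV (gtr0_norm (Q0 x)) ler_pdivrMr// mul1r.
rewrite normrM ger0_norm ?subr_ge0//.
apply: (@le_trans _ _ (1 * `|y ^+ 2 - t * x|)).
  by rewrite ler_wpM2r// lerBlDl.
have : t * x <= x ^+ 2 by rewrite expr2 ler_wpM2r// (le_trans t0).
have : 0 <= t * x by rewrite mulr_ge0// (le_trans t0).
have := sqr_ge0 y; have := sqr_ge0 x.
by rewrite mul1r ler_norml => *; apply/andP; split; lra.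
Qed.

Lemma kerV_osc y t x : 0 < y -> 0 <= t -> t <= x -> x <= t + 1 ->
  `|y / (x ^+ 2 + y ^+ 2) - y / (t ^+ 2 + y ^+ 2)| <= (t ^+ 2 + y ^+ 2)^-1.
Proof.
move=> y0 t0 tx xt.
have Q0 z : 0 < z ^+ 2 + y ^+ 2 by rewrite ltr_wpDl ?sqr_ge0// exprn_gt0.
have -> : y / (x ^+ 2 + y ^+ 2) - y / (t ^+ 2 + y ^+ 2) =
    (- ((x - t) * (y * (t + x))) / (x ^+ 2 + y ^+ 2)) * (t ^+ 2 + y ^+ 2)^-1.
  by field; rewrite !gt_eqF.
rewrite normrM normfV (gtr0_norm (Q0 t)) -[leRHS]mul1r ler_wpM2r//.
  by rewrite invr_ge0 ltW.
rewrite normrM normfV (gtr0_norm (Q0 x)) ler_pdivrMr// mul1r.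
have yx : 0 <= y * (t + x) by rewrite mulr_ge0 ?(ltW y0)// addr_ge0// (le_trans t0).
rewrite normrN normrM ger0_norm ?subr_ge0// (ger0_norm yx).
apply: (@le_trans _ _ (1 * (y * (t + x)))).
  by rewrite ler_wpM2r// lerBlDl.
have : y * (t + x) <= y * (x + x) by rewrite ler_wpM2l ?(ltW y0)// lerD2r.
have := sqr_ge0 (x - y); rewrite mul1r; nra.
Qed.

Lemma mvt_unit (f df : R -> R) t :
  (forall x, t <= x -> is_derive x 1 f (df x)) ->
  exists2 c, t <= c <= t + 1 & f (t + 1) - f t = df c.
Proof.
move=> fdf; have [|||c ct ->] := @MVT_segment R f df t (t + 1).
- by rewrite lerDl.
- by move=> x; rewrite in_itv/= => /andP[/ltW + _]; exact: fdf.
- apply: derivable_within_continuous => x; rewrite in_itv/= => /andP[tx _].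
  by have [] := fdf x tx.
- by exists c; [rewrite in_itv/= in ct|rewrite addrAC subrr add0r mulr1].
Qed.

Lemma is_derive_half_ln y x : 0 < y ->
  is_derive x 1 (fun t => 2^-1 * ln (t ^+ 2 + y ^+ 2)) (x / (x ^+ 2 + y ^+ 2)).
Proof.
move=> y0; have Q0 : 0 < x ^+ 2 + y ^+ 2 by rewrite ltr_wpDl ?sqr_ge0// exprn_gt0.
have d1 := is_derive1_ln Q0.
have d2 : is_derive x 1 (fun t : R => t ^+ 2 + y ^+ 2) (2 * x).
  apply: is_derive_eq.
  by rewrite /GRing.scale /=; ring.
have d3 := @is_derive1_comp R (@ln R) (fun t : R => t ^+ 2 + y ^+ 2) x _ _ d1 d2.
have d4 : is_derive x 1 (2^-1 \*: (@ln R \o (fun t : R => t ^+ 2 + y ^+ 2))) _ := is_deriveZ _ d3.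
apply: (is_derive_eq d4).
by rewrite /GRing.scale /=; field; rewrite gt_eqF.
Qed.

Lemma is_derive_atan_div y x : 0 < y ->
  is_derive x 1 (fun t => atan (t / y)) (y / (x ^+ 2 + y ^+ 2)).
Proof.
move=> y0; have Q0 : 0 < x ^+ 2 + y ^+ 2 by rewrite ltr_wpDl ?sqr_ge0// exprn_gt0.
have d1 : is_derive x 1 (fun t : R => t / y) (y^-1).
  apply: is_derive_eq.
  by rewrite /GRing.scale /=; ring.
have d2 := is_derive1_atan (x / y).
have d3 := @is_derive1_comp R (@atan R) (fun t : R => t / y) x _ _ d2 d1.
apply: (is_derive_eq d3).
by field; rewrite !gt_eqF.
Qed.

(** The primitive increases over the cell by the value of the kernel at some
    point of the cell. *)
Lemma half_ln_osc y t : 0 < y -> 0 <= t ->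
  `|2^-1 * ln ((t + 1) ^+ 2 + y ^+ 2) - 2^-1 * ln (t ^+ 2 + y ^+ 2)
    - t / (t ^+ 2 + y ^+ 2)| <= (t ^+ 2 + y ^+ 2)^-1.
Proof.
move=> y0 t0.
have [c /andP[tc ct] ->] := @mvt_unit (fun t => 2^-1 * ln (t ^+ 2 + y ^+ 2)) _ t
  (fun x _ => is_derive_half_ln x y0).
exact: kerU_osc.
Qed.

Lemma atan_osc y t : 0 < y -> 0 <= t ->
  `|atan ((t + 1) / y) - atan (t / y) - y / (t ^+ 2 + y ^+ 2)|
    <= (t ^+ 2 + y ^+ 2)^-1.
Proof.
move=> y0 t0.
have [c /andP[tc ct] ->] := @mvt_unit (fun t => atan (t / y)) _ t
  (fun x _ => is_derive_atan_div x y0).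
exact: kerV_osc.
Qed.

End kernel_cells.

Section half_line_limits.
Context {R : realType}.
Implicit Types (x y s t K : R) (sd : bool) (mu : wpm R).

Lemma cvg_truncn (u : nat -> R) (l : R) : u n @[n --> \oo] --> l ->
  u (Num.truncn (t : R)) @[t --> +oo] --> l.
Proof.
move=> ul; apply: cvg_comp ul => A [N _ NA].
exists N%:R; split; first by rewrite num_real.
by move=> t Nt /=; apply: NA => /=; rewrite truncn_ge_nat ?ltW// (le_lt_trans _ Nt).
Qed.

(** What the real and imaginary parts of [1 / (i y - x)] have in common: along
    the half line [sd], [f] has primitive [G] and varies on unit cells by at
    most the modulus of its derivative. *)
Definition cauchy_like sd y (f G : R -> R) : Prop :=
  [/\ measurable_fun setT f,
      forall t x, 0 <= t -> t <= x -> x <= t + 1 ->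
        `|f (sgn sd * x) - f (sgn sd * t)| <= (t ^+ 2 + y ^+ 2)^-1,
      forall t, 0 <= t ->
        `|G (t + 1) - G t - f (sgn sd * t)| <= (t ^+ 2 + y ^+ 2)^-1 &
      forall x, 0 <= x -> `|f (sgn sd * x)| <= 2 * y / (x + 1)].

Lemma kerU_cauchy_like sd y : 1 <= y ->
  cauchy_like sd y (kerU 0 y) (fun t => - sgn sd * (2^-1 * ln (t ^+ 2 + y ^+ 2))).
Proof.
move=> y1; have y0 : 0 < y by rewrite (lt_le_trans ltr01).
split; first exact: measurable_kerU.
- move=> t x t0 tx xt; rewrite !kerU_sgn -mulrBr normrM normrN norm_sgn mul1r.
  exact: kerU_osc.
- move=> t t0; rewrite kerU_sgn -mulrBr -mulrBr normrM normrN norm_sgn mul1r.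
  exact: half_ln_osc.
- move=> x x0; rewrite kerU_sgn normrM normrN norm_sgn mul1r.
  have Q0 : 0 < x ^+ 2 + y ^+ 2 by rewrite ltr_wpDl ?sqr_ge0// exprn_gt0.
  rewrite ger0_norm ?divr_ge0 ?(ltW Q0)// ler_pdivrMr// mulrAC ler_pdivlMr ?ltr_wpDl//.
  by have := sqr_ge0 (x - 1); nra.
Qed.

Lemma kerV_cauchy_like sd y : 1 <= y ->
  cauchy_like sd y (kerV 0 y) (fun t => atan (t / y)).
Proof.
move=> y1; have y0 : 0 < y by rewrite (lt_le_trans ltr01).
split; first exact: measurable_kerV.
- by move=> t x t0 tx xt; rewrite !kerV_sgn; exact: kerV_osc.
- by move=> t t0; rewrite kerV_sgn; exact: atan_osc.
- move=> x x0; rewrite kerV_sgn.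
  have Q0 : 0 < x ^+ 2 + y ^+ 2 by rewrite ltr_wpDl ?sqr_ge0// exprn_gt0.
  rewrite ger0_norm ?divr_ge0 ?(ltW Q0) ?(ltW y0)// ler_pdivrMr// mulrAC ler_pdivlMr ?ltr_wpDl//.
  rewrite -mulrA [2 * _]mulrC -mulrA ler_wpM2l ?(ltW y0)//.
  by have := sqr_ge0 (x - 1); nra.
Qed.

Variables (sd : bool) (mu : wpm R) (K y : R) (f G : R -> R).
Hypothesis K0 : 0 <= K.
Hypothesis y1 : 1 <= y.
Hypothesis mu_reg : regular K mu.
Hypothesis fG : cauchy_like sd y f G.

Local Notation I j := (\int[mu]_(x in cell sd j) f x).
Local Notation P j := (G j.+1%:R - G j%:R).
Local Notation phi j := (f (sgn sd * j%:R)).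
Local Notation ep j := ((j%:R ^+ 2 + y ^+ 2)^-1).
Local Notation m := (cell_mass sd mu).

Lemma cell_integral_osc j : `|I j - m j * phi j| <= m j * ep j.
Proof.
have [mf osc _ _] := fG.
apply: (wpm_int_near_cst (measurable_cell _ _) (@cell_sub _ _ _)) => // x _.
move=> /cell_mem/andP[jx xj].
have -> : x = sgn sd * (sgn sd * x) by rewrite mulrA sgn_sqr mul1r.
by apply: osc => //; rewrite natr1.
Qed.

Lemma primitive_osc j : `|P j - phi j| <= ep j.
Proof. by have [_ _ prim _] := fG; rewrite -natr1; exact: prim. Qed.

Lemma kernel_osc j : `|phi j.+1 - phi j| <= ep j.
Proof.
by have [_ osc _ _] := fG; apply: osc => //; rewrite ?natr1// ler_nat.
Qed.

Lemma ep_le j : ep j <= 2 * y / j.+1%:R ^+ 2.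
Proof.
have y0 : 0 < y by rewrite (lt_le_trans ltr01).
have Q0 : 0 < j%:R ^+ 2 + y ^+ 2 by rewrite ltr_wpDl ?sqr_ge0// exprn_gt0.
rewrite ler_pdivlMr ?exprn_gt0// mulrC ler_pdivrMr// -natr1.
have h : 2 * (j%:R ^+ 2 + y ^+ 2) <= 2 * y * (j%:R ^+ 2 + y ^+ 2).
  by rewrite ler_wpM2r ?(ltW Q0)// ler_peMr.
have : 1 <= y ^+ 2 by rewrite expr_ge1// ltW.
move=> yy; apply: le_trans h; have := sqr_ge0 (j%:R - 1 : R); nra.
Qed.

Lemma phi_le j : `|phi j| <= 2 * y / j.+1%:R.
Proof. by have [_ _ _ /(_ j%:R (ler0n _ _))] := fG; rewrite natr1. Qed.

Lemma sum_primitive n : \sum_(j < n) P j = G n%:R - G 0.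
Proof.
by rewrite -(big_mkord xpredT (fun j => P j)) (telescope_sumr (fun j => G j%:R)).
Qed.

(** The second part bounds the limit by the cost of all cells: the limit is small
    when [y] is large. *)
Lemma half_line_cvg : exists2 l : R,
  \int[mu]_(x in half sd t) f x - K * (G (Num.truncn t)%:R - G 0) @[t --> +oo] --> l &
  forall E, (forall n : nat, \sum_(j < n) cell_cost K m j * ep j <= E) -> `|l| <= E.
Proof.
have [C HC] := regular_discrepancy mu_reg.
have m0 := cell_mass_ge0 sd mu.
have c1 : cvgn (fun n => \sum_(j < n) (I j - K * P j)).
  exact: (cells_cvg K0 m0 (HC sd) cell_integral_osc primitive_osc kernel_osc ep_le phi_le).
exists (limn (fun n => \sum_(j < n) (I j - K * P j))).
- have c2 := cvg_truncn c1.
  have [mf _ _ bd] := fG.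
  pose r t := \int[mu]_(x in half sd t) f x - \sum_(j < Num.truncn t) I j.
  have c3 : r t @[t --> +oo] --> (0 : R).
    have c4 : 2 * y * (m n / n.+1%:R) @[n --> \oo] --> (0 : R).
      rewrite -[X in _ --> X](mulr0 (2 * y)); apply: cvgM; first exact: cvg_cst.
      exact: (mass_o K0 m0 (HC sd)).
    have {}c4 := cvg_truncn c4.
    apply/norm_cvg0P; apply: (squeeze_cvgr _ (cvg_cst 0) c4).
    near=> t; rewrite normr_ge0/= mulrCA mulrC.
    apply: half_cells => //.
    move=> x /cell_mem/andP[jx xj].
    have -> : x = sgn sd * (sgn sd * x) by rewrite mulrA sgn_sqr mul1r.
    have x0 : 0 <= sgn sd * x by rewrite (le_trans _ jx).
    apply: (le_trans (bd _ x0)); rewrite ler_wpM2l ?mulr_ge0 ?(le_trans _ y1)//.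
    by rewrite lef_pV2 ?posrE ?ltr_wpDl// -natr1 lerD2r.
  have c8 := cvgD c3 c2; rewrite add0r in c8.
  suff -> : (fun t => \int[mu]_(x in half sd t) f x - K * (G (Num.truncn t)%:R - G 0)) =
      (fun t => r t + \sum_(j < Num.truncn t) (I j - K * P j)) by exact: c8.
  by apply/funext => t; rewrite /r /= -sum_primitive mulr_sumr sumrB; ring.
- move=> E HE.
  have c5 : `|\sum_(j < n) (I j - K * P j)| @[n --> \oo] -->
      `|limn (fun n => \sum_(j < n) (I j - K * P j))| by exact: cvg_norm c1.
  have c6 : `|discrepancy K m n * phi n| + E @[n --> \oo] --> 0 + E.
    apply: cvgD; last exact: cvg_cst.
    have c7 : `|discrepancy K m n / n.+1%:R| * (2 * y) @[n --> \oo] --> (0 : R).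
      rewrite -[X in _ --> X](mul0r (2 * y)); apply: cvgM; last exact: cvg_cst.
      apply/(norm_cvg0P (fun n => discrepancy K m n / n.+1%:R)).
      exact: (discrepancy_o K0 m0 (HC sd)).
    apply: (squeeze_cvgr _ (cvg_cst 0) c7); apply: nearW => n.
    rewrite normr_ge0/= !normrM normfV [`|n.+1%:R|]ger0_norm// -mulrA ler_wpM2l//.
    by rewrite [leRHS]mulrC; exact: phi_le.
  rewrite add0r in c6; apply: (ler_cvg_to c5 c6); apply: nearW => n /=.
  apply: (le_trans (cells_bound K0 n cell_integral_osc primitive_osc kernel_osc)).
  by rewrite lerD2l.
Unshelve. all: by end_near.
Qed.

End half_line_limits.

(** * Windows around a point *)

Section absolute_convergence.
Context {R : realType}.
Variables (K : R) (mu : wpm R).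
Hypothesis K0 : 0 <= K.
Hypothesis mu_reg : regular K mu.
Implicit Types (x t : R) (sd : bool) (g : R -> R).

Definition decay x : R := (1 + x ^+ 2)^-1.

Lemma decay_gt0 x : 0 < decay x.
Proof. by rewrite invr_gt0 ltr_pwDl ?sqr_ge0. Qed.

Lemma measurable_decay : measurable_fun setT decay.
Proof.
apply: (measurableT_comp measurable_invr).
by apply: measurable_funD => //; exact: exprn_measurable.
Qed.

Lemma wpm_int_mono a b (A B : set R) g : measurable A -> measurable B ->
  A `<=` B -> B `<=` `[a, b] -> measurable_fun setT g ->
  (forall x, supp mu x -> 0 <= g x) ->
  \int[mu]_(x in A) g x <= \int[mu]_(x in B) g x.
Proof.
move=> mA mB AB Bab mg g0.
have mBA : measurable (B `\` A) by exact: measurableD.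
have BAab : B `\` A `<=` `[a, b] by apply: subset_trans Bab; exact: subDsetl.
rewrite -[in leRHS](setDUK AB) (@wpm_int_setU _ mu a b)//; last 2 first.
- exact: subset_trans Bab.
- exact: setDIK.
rewrite lerDl -[leLHS](_ : \int[mu]_(x in B `\` A) 0 = 0); last first.
  by rewrite (wpm_int_cst mu 0 mBA BAab) mul0r.
by apply: (wpm_int_le mBA BAab) => // x sx _; exact: g0.
Qed.

Lemma half_mono sd t t' : t <= t' -> half sd t `<=` half sd t'.
Proof.
move=> tt'; rewrite /half; case: sd => x; rewrite /= !in_itv/= => /andP[h1 h2].
  by rewrite h1 (le_trans h2).
by rewrite h2 andbT; lra.
Qed.

(** The mass of a cell is at most its cost, and the costs are summable against
    [1 / (j + 1) ^ 2]. *)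
Lemma decay_bounded sd : exists B : R, forall t, \int[mu]_(x in half sd t) decay x <= B.
Proof.
have [C HC] := regular_discrepancy mu_reg.
have m0 := cell_mass_ge0 sd mu.
exists (2 * (9 * C + 4 * K)) => t.
wlog t0 : t / 0 <= t => [wl|].
  have [t0|t0] := leP 0 t; first exact: wl.
  apply: le_trans (wl 0 (lexx _)).
  apply: (@wpm_int_mono (- `|0|) `|0|) => //.
  - exact: measurable_half.
  - exact: measurable_half.
  - exact: half_mono (ltW t0).
  - exact: half_sub.
  - exact: measurable_decay.
  - by move=> x _; exact/ltW/decay_gt0.
have dle j x : cell sd j x -> `|decay x| <= 2 / j.+1%:R ^+ 2.
  move=> /cell_mem/andP[jx xj]; rewrite ger0_norm ?(ltW (decay_gt0 _))//.
  have -> : decay x = (1 + (sgn sd * x) ^+ 2)^-1.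
    by rewrite exprMn [sgn sd ^+ 2]expr2 sgn_sqr mul1r.
  set z := sgn sd * x in jx xj *.
  have j0 : 0 <= j%:R :> R by [].
  rewrite ler_pdivlMr ?exprn_gt0// mulrC ler_pdivrMr ?ltr_pwDl ?sqr_ge0// -natr1.
  have : j%:R ^+ 2 <= z ^+ 2 by rewrite lerXn2r ?nnegrE// (le_trans j0).
  by have := sqr_ge0 (j%:R - 1 : R); nra.
set n := Num.truncn t.
have hc := half_cells mu t0 measurable_decay (dle n).
rewrite -/n ler_distl in hc; have {hc} /andP[_ hc] := hc.
apply: (le_trans hc).
apply: (@le_trans _ _ (2 * \sum_(j < n.+1) cell_cost K (cell_mass sd mu) j / j.+1%:R ^+ 2)); last first.
  by rewrite ler_wpM2l// (cell_cost_summable K0 (HC sd)).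
rewrite mulr_sumr big_ord_recr /=.
have ck j : cell_mass sd mu j <= cell_cost K (cell_mass sd mu) j.
  by rewrite /cell_cost -addrA lerDl addr_ge0.
apply: lerD.
- apply: ler_sum => j _.
  apply: (le_trans (ler_norm _)).
  apply: (le_trans (wpm_int_abs_le (measurable_cell _ _) (@cell_sub _ _ _) measurable_decay (fun x _ => dle j x))).
  rewrite mulrAC -mulrA ler_wpM2l// ler_wpM2r ?invr_ge0 ?sqr_ge0//; exact: ck.
- rewrite mulrAC -mulrA ler_wpM2l// ler_wpM2r ?invr_ge0 ?sqr_ge0//; exact: ck.
Qed.

Lemma half_mono_cvg sd g (c : R) : measurable_fun setT g -> 0 <= c ->
  (forall x, supp mu x -> 0 <= g x) ->
  (forall x, supp mu x -> g x <= c * decay x) ->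
  cvg (\int[mu]_(x in half sd t) g x @[t --> +oo]).
Proof.
move=> mg c0 g0 gc; have [B HB] := decay_bounded sd.
have h t : \int[mu]_(x in half sd t) g x <= c * B.
  apply: (@le_trans _ _ (\int[mu]_(x in half sd t) (c * decay x))).
    apply: (wpm_int_le (measurable_half _ _) (@half_sub _ _ _)) => //.
      by apply: measurable_funM => //; exact: measurable_decay.
    by move=> x sx _; exact: gc.
  rewrite (wpm_intZ _ _ (measurable_half _ _) (@half_sub _ _ _))//.
    exact: ler_wpM2l.
  exact: measurable_decay.
apply/cvg_ex; eexists; apply: nondecreasing_cvgr.
- move=> t t' tt'; apply: (@wpm_int_mono (- `|t'|) `|t'|) => //.
  + exact: measurable_half.
  + exact: measurable_half.
  + exact: half_mono.
  + exact: half_sub.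
- by exists (c * B) => _ [t _ <-].
Qed.

(** [g] is the difference of the functions [g + c * decay] and [c * decay],
    which are nonnegative on the support and have bounded integrals. *)
Lemma half_abs_cvg sd g (c : R) : measurable_fun setT g ->
  (forall x, supp mu x -> `|g x| <= c * decay x) ->
  cvg (\int[mu]_(x in half sd t) g x @[t --> +oo]).
Proof.
move=> mg gc.
wlog c0 : c gc / 0 <= c => [wl|].
  have [c0|c0] := leP 0 c; first exact: (wl c).
  apply: (wl 0) => // x sx; rewrite mul0r; apply: (le_trans (gc x sx)).
  by rewrite mulr_le0_ge0// ltW// decay_gt0.
have md : measurable_fun setT (fun x => c * decay x).
  by apply: measurable_funM => //; exact: measurable_decay.
have c1 : cvg (\int[mu]_(x in half sd t) (g x + c * decay x) @[t --> +oo]).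
  apply: (@half_mono_cvg sd _ (2 * c)); first exact: measurable_funD.
  - by rewrite mulr_ge0.
  - by move=> x /gc; rewrite ler_norml => /andP[]; lra.
  - by move=> x /gc; rewrite ler_norml => /andP[]; lra.
have c2 : cvg (\int[mu]_(x in half sd t) (c * decay x) @[t --> +oo]).
  apply: (@half_mono_cvg sd _ c) => // x _.
  by rewrite mulr_ge0// ltW// decay_gt0.
have c3 := cvgB c1 c2; apply/cvg_ex; eexists.
suff -> : (fun t => \int[mu]_(x in half sd t) g x) =
  (fun t => \int[mu]_(x in half sd t) (g x + c * decay x) -
     \int[mu]_(x in half sd t) (c * decay x)) by exact: c3.
apply/funext => t.
rewrite (wpm_intD _ (measurable_half _ _) (@half_sub _ _ _))//.
by rewrite addrK.
Qed.

End absolute_convergence.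

Lemma near_eq_cvg_to {T : Type} {V : topologicalType} (F : set_system T)
    {FF : Filter F} (f g : T -> V) (l : V) :
  f x @[x --> F] --> l -> (\forall x \near F, f x = g x) -> g x @[x --> F] --> l.
Proof. by move=> fl fg; apply: cvg_trans fl; exact: near_eq_cvg. Qed.

Section windows.
Context {R : realType}.
Implicit Types (x s y t : R) (sd : bool) (f g : R -> R).

Lemma cvg_invr_y : t^-1 @[t --> +oo] --> (0 : R).
Proof.
apply/(@gtr0_cvgV0 _ _ _ _ (fun t : R => t)) => //.
by apply: nbhs_pinfty_gt; rewrite num_real.
Qed.

Lemma cvg_half_ln_truncn y : 0 < y ->
  2^-1 * ln ((Num.truncn (t : R))%:R ^+ 2 + y ^+ 2) - ln t @[t --> +oo] --> (0 : R).
Proof.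
move=> y0.
have c1 : (1 + 2 + y ^+ 2) / t @[t --> +oo] --> (0 : R).
  rewrite -[X in _ --> X](mulr0 (1 + 2 + y ^+ 2)); apply: cvgM; first exact: cvg_cst.
  exact: cvg_invr_y.
have c2 : ((Num.truncn (t : R))%:R ^+ 2 + y ^+ 2) / t ^+ 2 - 1 @[t --> +oo] --> (0 : R).
  apply/norm_cvg0P; apply: (squeeze_cvgr _ (cvg_cst 0) c1).
  near=> t; rewrite normr_ge0/=.
  have t1 : 1 <= t by near: t; apply: nbhs_pinfty_ge; rewrite num_real.
  have t0 : 0 < t by rewrite (lt_le_trans ltr01).
  have n1 : (Num.truncn t)%:R <= t by rewrite truncn_le// ltW.
  have n2 : t < (Num.truncn t)%:R + 1 by rewrite natr1 truncnS_gt.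
  move: n1 n2 (ler0n R (Num.truncn t)); move: (Num.truncn t)%:R => n n1 n2 n0.
  have -> : (n ^+ 2 + y ^+ 2) / t ^+ 2 - 1 = (n ^+ 2 + y ^+ 2 - t ^+ 2) / t ^+ 2.
    by field; rewrite gt_eqF.
  rewrite normrM normfV (ger0_norm (sqr_ge0 t)) ler_pdivrMr ?exprn_gt0//.
  have -> : (1 + 2 + y ^+ 2) / t * t ^+ 2 = (1 + 2 + y ^+ 2) * t.
    by field; rewrite gt_eqF.
  have := sqr_ge0 y; move: (y ^+ 2) => q q0.
  by rewrite ler_norml; apply/andP; split; nra.
have c3 : ((Num.truncn (t : R))%:R ^+ 2 + y ^+ 2) / t ^+ 2 @[t --> +oo] --> (1 : R).
  have c := cvgD c2 (cvg_cst (1 : R)); rewrite add0r in c.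
  by apply: (near_eq_cvg_to (c _ _)); apply: nearW => t /=; rewrite subrK.
have c4 : 2^-1 * ln (((Num.truncn (t : R))%:R ^+ 2 + y ^+ 2) / t ^+ 2) @[t --> +oo] --> (0 : R).
  rewrite -[X in _ --> X](mulr0 2^-1) -ln1; apply: cvgM; first exact: cvg_cst.
  by apply: cvg_comp c3 _; exact: continuous_ln.
apply: (near_eq_cvg_to c4); near=> t.
have t0 : 0 < t by near: t; apply: nbhs_pinfty_gt; rewrite num_real.
rewrite ln_div ?posrE ?exprn_gt0//; last by rewrite ltr_wpDl ?sqr_ge0// exprn_gt0.
by rewrite lnXn// -mulr_natr; lra.
Unshelve. all: by end_near.
Qed.

Lemma cvg_ln_shift s : ln (s + t) - ln t @[t --> +oo] --> (0 : R).
Proof.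
have c1 : (s + t) / t @[t --> +oo] --> (1 : R).
  have c : s * t^-1 + 1 @[t --> +oo] --> (s * 0 + 1 : R).
    apply: cvgD; last exact: cvg_cst.
    apply: cvgM; first exact: cvg_cst.
    exact: cvg_invr_y.
  rewrite mulr0 add0r in c; apply: (near_eq_cvg_to c); near=> t.
  have t0 : 0 < t by near: t; apply: nbhs_pinfty_gt; rewrite num_real.
  by field; rewrite gt_eqF.
have c2 : ln ((s + t) / t) @[t --> +oo] --> (0 : R).
  by rewrite -ln1; apply: cvg_comp c1 _; exact: continuous_ln.
apply: (near_eq_cvg_to c2); near=> t.
have t0 : 0 < t by near: t; apply: nbhs_pinfty_gt; rewrite num_real.
have st : 0 < s + t.
  have : - s < t by near: t; apply: nbhs_pinfty_gt; rewrite num_real.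
  by lra.
by rewrite ln_div ?posrE.
Unshelve. all: by end_near.
Qed.

Variables (K : R) (mu : wpm R).
Hypothesis K0 : 0 <= K.
Hypothesis mu_reg : regular K mu.

Lemma half_kerU_cvg sd : exists l : R,
  \int[mu]_(x in half sd t) kerU 0 1 x + sgn sd * K * ln t @[t --> +oo] --> l.
Proof.
have [l lim _] := half_line_cvg K0 (lexx 1) mu_reg (kerU_cauchy_like sd (lexx 1)).
exists l.
have c : sgn sd * K * (2^-1 * ln ((Num.truncn (t : R))%:R ^+ 2 + 1 ^+ 2) - ln t)
    @[t --> +oo] --> (0 : R).
  rewrite -[X in _ --> X](mulr0 (sgn sd * K)); apply: cvgM; first exact: cvg_cst.
  exact: cvg_half_ln_truncn.
have c' := cvgB lim c; rewrite subr0 in c'; apply: (near_eq_cvg_to (c' _)).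
apply: nearW => t /=; rewrite expr0n add0r expr1n ln1.
rewrite [X in _ + X](_ : _ = - (sgn sd * K * (2^-1 * ln ((Num.truncn t)%:R ^+ 2 + 1) - ln t)))//.
ring.
Qed.

(** The window is cut at the origin, not at [s]; the ends [s + R] and [L - s] of
    the two halves differ from [R] and [L] by a shift that the logarithm does not
    see in the limit. *)
Lemma window_cvg s f (c l r : R) : measurable_fun setT f ->
  \int[mu]_(x in half true t) f x + c * ln t @[t --> +oo] --> r ->
  \int[mu]_(x in half false t) f x - c * ln t @[t --> +oo] --> l ->
  \int[mu]_(x in `[s - LR.1, s + LR.2]) f x - c * ln (LR.1 / LR.2)
    @[LR --> filter_prod (pinfty_nbhs R) (pinfty_nbhs R)] --> r + l.
Proof.
move=> mf cr cl.
have shift (u : R) : u + t @[t --> +oo] --> +oo.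
  exact: cvg_addrl.
pose pr t := \int[mu]_(x in half true (s + t)) f x + c * ln (s + t) - c * (ln (s + t) - ln t).
pose pl t := \int[mu]_(x in half false (- s + t)) f x - c * ln (- s + t) + c * (ln (- s + t) - ln t).
have c1 : pr t @[t --> +oo] --> r.
  rewrite -[X in _ --> X]subr0 -(mulr0 c); apply: cvgB.
    exact: (cvg_comp _ _ (shift s) cr).
  by apply: cvgM; [exact: cvg_cst|exact: cvg_ln_shift].
have c2 : pl t @[t --> +oo] --> l.
  rewrite -[X in _ --> X]addr0 -(mulr0 c); apply: cvgD.
    exact: (cvg_comp _ _ (shift (- s)) cl).
  by apply: cvgM; [exact: cvg_cst|exact: cvg_ln_shift].
have c3 : pr LR.2 + pl LR.1 @[LR --> filter_prod (pinfty_nbhs R) (pinfty_nbhs R)] --> r + l.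
  apply: cvgD.
    by apply: cvg_comp c1; exact: cvg_snd.
  by apply: cvg_comp c2; exact: cvg_fst.
apply: (near_eq_cvg_to c3).
exists ([set t | `|s| < t], [set t | `|s| < t]) => /=.
  by split; apply: nbhs_pinfty_gt; rewrite num_real.
move=> [L Rr] /= [sL sR].
have L0 : 0 < L by rewrite (le_lt_trans _ sL).
have R0 : 0 < Rr by rewrite (le_lt_trans _ sR).
have := ler_norm s; have := ler_norm (- s); rewrite normrN => s1 s2.
rewrite (window_halves mu _ _ mf); [|lra..].
rewrite /pr /pl ln_div ?posrE// opprB [- s + L]addrC.
ring.
Qed.

End windows.

Section transform.
Context {R : realType}.
Implicit Types (x s y t : R) (sd : bool) (f g : R -> R) (mu : wpm R).

(** The point [s + i y] stays away from the support of [mu]; [A] compares the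
    kernels at [s + i y] with the one at [i]. *)
Definition away mu s y (A : R) : Prop :=
  0 <= A /\ forall x, supp mu x -> 1 + x ^+ 2 <= A * ((s - x) ^+ 2 + y ^+ 2).

Lemma away_le (s y x : R) (dl : R) : 0 < dl -> dl <= (s - x) ^+ 2 + y ^+ 2 ->
  1 + x ^+ 2 <= ((1 + 2 * s ^+ 2) / dl + 2) * ((s - x) ^+ 2 + y ^+ 2).
Proof.
move=> dl0 dlQ; rewrite mulrDl.
have h : 1 + 2 * s ^+ 2 <= (1 + 2 * s ^+ 2) / dl * ((s - x) ^+ 2 + y ^+ 2).
  have Qd : 1 <= dl^-1 * ((s - x) ^+ 2 + y ^+ 2) by rewrite mulrC ler_pdivlMr// mul1r.
  by rewrite -mulrA ler_peMr// addr_ge0// mulr_ge0// sqr_ge0.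
apply: le_trans (lerD h (lexx _)).
by have := sqr_ge0 (x - 2 * s); have := sqr_ge0 y; nra.
Qed.

Lemma away_upper mu s y : 0 < y -> exists A, away mu s y A.
Proof.
move=> y0; exists ((1 + 2 * s ^+ 2) / y ^+ 2 + 2); split.
  by rewrite addr_ge0// divr_ge0 ?sqr_ge0// addr_ge0// mulr_ge0// sqr_ge0.
by move=> x _; apply: away_le; rewrite ?exprn_gt0// lerDr sqr_ge0.
Qed.

Lemma away_off_support mu s : ~ supp mu s -> exists A, forall y, away mu s y A.
Proof.
move=> ns.
(* The support is closed: some neighbourhood of [s] has mass 0. *)
have [U [oU Us muU]] : exists U : set R, [/\ open U, U s & mu U = 0%E].
  apply: contrapT => h; apply: ns => U oU Us; rewrite lt_neqAle measure_ge0 andbT.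
  by apply/eqP => muU; apply: h; exists U.
have : nbhs s U by exact: open_nbhs_nbhs.
move=> /nbhs_ballP[e /= e0 sU].
exists ((1 + 2 * s ^+ 2) / e ^+ 2 + 2) => y; split.
  by rewrite addr_ge0// divr_ge0 ?sqr_ge0// addr_ge0// mulr_ge0// sqr_ge0.
move=> x sx; apply: away_le; first by rewrite exprn_gt0.
apply: (@le_trans _ _ ((s - x) ^+ 2)); last by rewrite lerDl sqr_ge0.
rewrite -[leRHS]real_normK ?num_real// lerXn2r ?nnegrE ?(ltW e0)// leNgt.
apply/negP => xs; have := sx U oU (sU x xs); rewrite muU; by rewrite ltxx.
Qed.

Lemma away_gt0 mu s y A x : away mu s y A -> supp mu x ->
  0 < (s - x) ^+ 2 + y ^+ 2.
Proof.
move=> [A0 AQ] sx; have := AQ x sx; rewrite lt_neqAle addr_ge0 ?sqr_ge0// andbT.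
move=> h; apply/eqP => Q0; rewrite -Q0 mulr0 in h.
by have := sqr_ge0 x; lra.
Qed.

Lemma kerV_decay mu s y A x : 0 <= y -> away mu s y A -> supp mu x ->
  `|kerV s y x| <= A * y * decay x.
Proof.
move=> y0 aw sx; have Q0 := away_gt0 aw sx; have [A0 /(_ x sx) AQ] := aw.
have d0 : 0 < 1 + x ^+ 2 by rewrite ltr_pwDl ?sqr_ge0.
rewrite /kerV /decay ger0_norm ?divr_ge0 ?(ltW Q0)//.
rewrite ler_pdivrMr// mulrAC ler_pdivlMr//.
by rewrite [A * y]mulrC -mulrA ler_wpM2l.
Qed.

(** The two kernels agree to first order at infinity, since both are equivalent
    to [- 1 / x]. *)
Lemma kerU_decay mu s y A x : away mu s y A -> supp mu x ->
  `|kerU s y x - kerU 0 1 x| <= (1 + (1 + s ^+ 2) * A + A * y ^+ 2) * decay x.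
Proof.
move=> aw sx; have Q0 := away_gt0 aw sx; have [A0 /(_ x sx) AQ] := aw.
have d0 : 0 < 1 + x ^+ 2 by rewrite ltr_pwDl ?sqr_ge0.
rewrite /kerU /decay sub0r sqrrN expr1n [x ^+ 2 + 1]addrC.
set Q := (s - x) ^+ 2 + y ^+ 2 in Q0 AQ *.
have -> : (s - x) / Q - - x / (1 + x ^+ 2) =
   ((s - x) * (1 + x * s) + x * y ^+ 2) / Q * (1 + x ^+ 2)^-1.
  rewrite (_ : (s - x) * (1 + x * s) + x * y ^+ 2 = (s - x) * (1 + x ^+ 2) + x * Q).
    by field; rewrite !gt_eqF.
  by rewrite /Q; ring.
rewrite normrM normfV (gtr0_norm d0) ler_wpM2r ?invr_ge0 ?(ltW d0)//.
rewrite normrM normfV (gtr0_norm Q0) ler_pdivrMr//.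
apply: (le_trans (ler_normD _ _)).
have h1 : 2 * `|(s - x) * (1 + x * s)| <= Q + (1 + s ^+ 2) * (A * Q).
  apply: (@le_trans _ _ ((s - x) ^+ 2 + (1 + x * s) ^+ 2)).
    rewrite -[2]ger0_norm// -normrM ler_norml.
    have := sqr_ge0 (s - x + (1 + x * s)); have := sqr_ge0 (s - x - (1 + x * s)).
    by move=> *; apply/andP; split; nra.
  apply: lerD; first by rewrite lerDl sqr_ge0.
  apply: (@le_trans _ _ ((1 + s ^+ 2) * (1 + x ^+ 2))).
    by have := sqr_ge0 (x - s); nra.
  by rewrite ler_wpM2l// addr_ge0// sqr_ge0.
have h2 : 2 * `|x * y ^+ 2| <= A * Q * y ^+ 2.
  rewrite normrM (ger0_norm (sqr_ge0 y)) mulrA ler_wpM2r ?sqr_ge0//.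
  apply: le_trans AQ; rewrite -[2]ger0_norm// -normrM ler_norml.
  have := sqr_ge0 (x - 1); have := sqr_ge0 (x + 1).
  by move=> *; apply/andP; split; nra.
have := normr_ge0 ((s - x) * (1 + x * s)); have := normr_ge0 (x * y ^+ 2).
move=> n1 n2.
rewrite [leRHS](_ : _ = Q + (1 + s ^+ 2) * (A * Q) + A * Q * y ^+ 2); last by ring.
apply: le_trans (lerD h1 h2).
by apply: lerD; rewrite ler_peMl// ler1n.
Qed.

Lemma kerU_near0 mu s y A x : 0 <= y -> away mu s 0 A -> supp mu x ->
  `|kerU s y x - kerU s 0 x| <= A * y * decay x.
Proof.
move=> y0 aw sx; have := away_gt0 aw sx; have [A0 /(_ x sx)] := aw.
rewrite /kerU expr0n addr0 /decay; move: (s - x) => z AQ z20.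
have z0 : z != 0 by apply: contraTneq z20 => ->; rewrite expr0n ltxx.
have Q0 : 0 < z ^+ 2 + y ^+ 2 by rewrite ltr_pwDl// sqr_ge0.
have d0 : 0 < 1 + x ^+ 2 by rewrite ltr_pwDl ?sqr_ge0.
have -> : z / (z ^+ 2 + y ^+ 2) - z / z ^+ 2 =
   - ((z * y) / (z ^+ 2 + y ^+ 2) * (y / z ^+ 2)).
  by field; rewrite z0 gt_eqF.
rewrite normrN normrM.
have h1 : `|z * y / (z ^+ 2 + y ^+ 2)| <= 1.
  rewrite normrM normfV (gtr0_norm Q0) ler_pdivrMr// mul1r ler_norml.
  have := sqr_ge0 (z - y); have := sqr_ge0 (z + y).
  by move=> *; apply/andP; split; nra.
apply: (@le_trans _ _ (1 * `|y / z ^+ 2|)); first by rewrite ler_wpM2r.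
rewrite mul1r normrM normfV (ger0_norm y0) (gtr0_norm z20).
rewrite ler_pdivrMr// mulrAC ler_pdivlMr//.
by rewrite [A * y]mulrC -mulrA ler_wpM2l.
Qed.

Variables (K : R) (mu : wpm R).
Hypothesis K0 : 0 <= K.
Hypothesis mu_reg : regular K mu.

(** At the point [i] the half-lines converge after subtraction of a logarithm,
    and the kernel at [s + i y] differs from that one by an absolutely integrable
    function. *)
Lemma kerU_window_cvg s y A : away mu s y A -> exists U : R,
  \int[mu]_(x in `[s - LR.1, s + LR.2]) kerU s y x - K * ln (LR.1 / LR.2)
    @[LR --> filter_prod (pinfty_nbhs R) (pinfty_nbhs R)] --> U.
Proof.
move=> aw.
have mU := measurable_kerU s y; have m1 := measurable_kerU (0 : R) 1.
have md : measurable_fun setT (fun x => kerU s y x - kerU 0 1 x).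
  exact: measurable_funB.
have side sd : exists l : R,
    \int[mu]_(x in half sd t) kerU s y x + sgn sd * K * ln t @[t --> +oo] --> l.
  have [l1 c1] := half_kerU_cvg K0 mu_reg sd.
  have c2 := half_abs_cvg K0 mu_reg (sd := sd) md (fun x sx => kerU_decay aw sx).
  exists (l1 + lim (\int[mu]_(x in half sd t) (kerU s y x - kerU 0 1 x) @[t --> +oo])).
  have c3 : (\int[mu]_(x in half sd t) kerU 0 1 x + sgn sd * K * ln t) +
      \int[mu]_(x in half sd t) (kerU s y x - kerU 0 1 x) @[t --> +oo]
      --> l1 + lim (\int[mu]_(x in half sd t) (kerU s y x - kerU 0 1 x) @[t --> +oo]).
    exact: cvgD c1 c2.
  apply: (near_eq_cvg_to c3); apply: nearW => t.
  transitivity (\int[mu]_(x in half sd t) (kerU 0 1 x + (kerU s y x - kerU 0 1 x)) + sgn sd * K * ln t).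
    by rewrite [in RHS](wpm_intD mu (measurable_half _ _) (@half_sub _ _ _))// addrAC.
  by congr (Rintegral _ _ _ + _); apply/funext => x; ring.
have [l cl] := side false; have [r cr] := side true.
exists (r + l); apply: window_cvg => //.
  by rewrite /sgn mul1r in cr.
by apply: (near_eq_cvg_to cl); apply: nearW => t; rewrite /sgn; ring.
Qed.

Lemma kerV_window_cvg s y A : 0 <= y -> away mu s y A -> exists V : R,
  \int[mu]_(x in `[s - LR.1, s + LR.2]) kerV s y x
    @[LR --> filter_prod (pinfty_nbhs R) (pinfty_nbhs R)] --> V.
Proof.
move=> y0 aw; have mV := measurable_kerV s y.
have side sd := half_abs_cvg K0 mu_reg (sd := sd) mV (fun x sx => kerV_decay y0 aw sx).
eexists; apply: near_eq_cvg_to (window_cvg (c := 0) s mV _ _) _.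
- apply: near_eq_cvg_to (side true) _; apply: nearW => t; rewrite mul0r addr0//.
- apply: near_eq_cvg_to (side false) _; apply: nearW => t; rewrite mul0r subr0//.
- by apply: nearW => LR; rewrite mul0r subr0.
Qed.

End transform.

Section window_sequences.
Context {R : realType}.
Implicit Types (x s y t : R) (sd : bool) (f g : R -> R) (mu : wpm R).

Lemma window_along mu s f (c l : R) {T : Type} (F : set_system T) {FF : Filter F}
    (L Rr : T -> R) (ell : R) :
  \int[mu]_(x in `[s - LR.1, s + LR.2]) f x - c * ln (LR.1 / LR.2)
    @[LR --> filter_prod (pinfty_nbhs R) (pinfty_nbhs R)] --> l ->
  L i @[i --> F] --> +oo -> Rr i @[i --> F] --> +oo ->
  ln (L i / Rr i) @[i --> F] --> ell ->
  \int[mu]_(x in `[s - L i, s + Rr i]) f x @[i --> F] --> l + c * ell.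
Proof.
move=> cl cL cR clog.
have c1 : \int[mu]_(x in `[s - L i, s + Rr i]) f x - c * ln (L i / Rr i) @[i --> F] --> l.
  exact: (cvg_comp _ _ (cvg_pair cL cR) cl).
have c2 : (\int[mu]_(x in `[s - L i, s + Rr i]) f x - c * ln (L i / Rr i)) +
    c * ln (L i / Rr i) @[i --> F] --> l + c * ell.
  by apply: cvgD => //; apply: cvgM => //; exact: cvg_cst.
by apply: (near_eq_cvg_to c2); apply: nearW => i; rewrite subrK.
Qed.

Lemma cvg_ln_ratio s : ln ((t + s) / (t - s)) @[t --> +oo] --> (0 : R).
Proof.
have c : (ln (s + t) - ln t) - (ln (- s + t) - ln t) @[t --> +oo] --> (0 - 0 : R).
  by apply: cvgB; exact: cvg_ln_shift.
rewrite subr0 in c; apply: (near_eq_cvg_to c); near=> t.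
have st : `|s| < t by near: t; apply: nbhs_pinfty_gt; rewrite num_real.
have := ler_norm s; have := ler_norm (- s); rewrite normrN => s1 s2.
rewrite ln_div ?posrE; [|lra..].
by rewrite [s + t]addrC [- s + t]addrC; ring.
Unshelve. all: by end_near.
Qed.

(** A symmetric window around any [u] is a window around [s] whose two lengths
    have a ratio that tends to 1, so the logarithm vanishes in the limit. *)
Lemma sym_window_along mu s u f (c l : R) {T : Type} (F : set_system T) {FF : Filter F}
    (tt : T -> R) :
  \int[mu]_(x in `[s - LR.1, s + LR.2]) f x - c * ln (LR.1 / LR.2)
    @[LR --> filter_prod (pinfty_nbhs R) (pinfty_nbhs R)] --> l ->
  tt i @[i --> F] --> +oo ->
  \int[mu]_(x in `[u - tt i, u + tt i]) f x @[i --> F] --> l.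
Proof.
move=> cl ct.
have c1 := @window_along mu s f c l T F FF (fun i => tt i + (s - u)) (fun i => tt i - (s - u)) 0 cl.
rewrite mulr0 addr0 in c1.
have -> : (fun i => \int[mu]_(x in `[u - tt i, u + tt i]) f x) =
  (fun i => \int[mu]_(x in `[s - (tt i + (s - u)), s + (tt i - (s - u))]) f x).
  apply/funext => i.
  rewrite (_ : s - (tt i + (s - u)) = u - tt i); last by ring.
  by rewrite (_ : s + (tt i - (s - u)) = u + tt i); last by ring.
apply: c1.
- exact: (cvg_comp _ _ ct (cvg_addrr _)).
- exact: (cvg_comp _ _ ct (cvg_addrr _)).
- exact: (cvg_comp _ _ ct (cvg_ln_ratio _)).
Qed.

Variables (K : R) (mu : wpm R).
Hypothesis K0 : 0 <= K.
Hypothesis mu_reg : regular K mu.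

Lemma sym_window_halves t f : 0 <= t -> measurable_fun setT f ->
  \int[mu]_(x in `[0 - t, 0 + t]) f x =
  \int[mu]_(x in half true t) f x + \int[mu]_(x in half false t) f x.
Proof.
by move=> t0 mf; rewrite sub0r add0r window_halves ?oppr_le0// opprK.
Qed.

(** As [y] tends to infinity the costs of the cells disappear, and only the main
    terms [K * (G t - G 0)] of the two half-lines remain: the logarithms cancel
    and the arctangents add up to [pi * K]. *)
Lemma far_limit (e : R) : 0 < e -> exists Y : R, forall y, Y <= y -> forall U V : R,
  \int[mu]_(x in `[0 - t, 0 + t]) kerU 0 y x @[t --> +oo] --> U ->
  \int[mu]_(x in `[0 - t, 0 + t]) kerV 0 y x @[t --> +oo] --> V ->
  `|U| <= e /\ `|V - pi * K| <= e.
Proof.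
move=> e0; have e2 : 0 < e / 2 by rewrite divr_gt0.
have [C HC] := regular_discrepancy mu_reg.
have small sd := cell_cost_small K0 (cell_mass_ge0 sd mu) (HC sd) e2.
have [Y1 H1] := small true; have [Y2 H2] := small false.
exists (Num.max 1 (Num.max Y1 Y2)) => y.
rewrite !ge_max => /andP[y1 /andP[yY1 yY2]] U V cU cV.
have y0 : 0 < y by rewrite (lt_le_trans ltr01).
split.
- have [r cr /(_ _ (H1 y yY1 y1)) rE] :=
    half_line_cvg K0 y1 mu_reg (kerU_cauchy_like true y1).
  have [l cl /(_ _ (H2 y yY2 y1)) lE] :=
    half_line_cvg K0 y1 mu_reg (kerU_cauchy_like false y1).
  suff -> : U = r + l by rewrite (le_trans (ler_normD _ _))// [leRHS]splitr lerD.
  apply: (cvg_unique (@norm_hausdorff _ R) cU) => /=.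
  apply: (near_eq_cvg_to (cvgD cr cl)).
  near=> t; rewrite sym_window_halves; last exact: measurable_kerU.
    by rewrite /sgn /=; ring.
  by near: t; apply: nbhs_pinfty_ge; rewrite num_real.
- have [r cr /(_ _ (H1 y yY1 y1)) rE] :=
    half_line_cvg K0 y1 mu_reg (kerV_cauchy_like true y1).
  have [l cl /(_ _ (H2 y yY2 y1)) lE] :=
    half_line_cvg K0 y1 mu_reg (kerV_cauchy_like false y1).
  suff -> : V - pi * K = r + l by rewrite (le_trans (ler_normD _ _))// [leRHS]splitr lerD.
  (* Each half-line contributes [K * pi / 2]. *)
  have ca : 2 * K * atan ((Num.truncn (t : R))%:R / y) @[t --> +oo] --> 2 * K * (pi / 2).
    have ca0 : 2 * K * atan (n%:R / y) @[n --> \oo] --> 2 * K * (pi / 2).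
      apply: cvgM; first exact: cvg_cst.
      have cn : (n%:R / y : R) @[n --> \oo] --> +oo.
        have cy : ((t : R) / y) @[t --> +oo] --> +oo.
          by apply: gt0_cvgMly; [rewrite invr_gt0|exact: cvg_id].
        exact: (cvg_comp _ _ (@cvgr_idn R) cy).
      exact: (cvg_comp _ _ cn (@cvgy_atan R)).
    exact: (cvg_truncn ca0).
  have -> : V = r + l + 2 * K * (pi / 2); last by field.
  apply: (cvg_unique (@norm_hausdorff _ R) cV) => /=.
  have c3 : (\int[mu]_(x in half true t) kerV 0 y x
       - K * (atan ((Num.truncn t)%:R / y) - atan (0 / y))) +
      (\int[mu]_(x in half false t) kerV 0 y x
       - K * (atan ((Num.truncn t)%:R / y) - atan (0 / y))) +
      2 * K * atan ((Num.truncn (t : R))%:R / y) @[t --> +oo] --> r + l + 2 * K * (pi / 2).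
    by apply: cvgD => //; exact: cvgD.
  apply: (near_eq_cvg_to c3); near=> t; rewrite sym_window_halves.
  - by rewrite mul0r atan0; ring.
  - by near: t; apply: nbhs_pinfty_ge; rewrite num_real.
  - exact: measurable_kerV.
Unshelve. all: by end_near.
Qed.

(** The support keeps a positive distance to [s], and the kernels at [s + i y]
    differ from those at [s] by at most a multiple of [y / (1 + x ^ 2)] there. *)
Lemma near_limit s : ~ supp mu s -> exists c : R, forall y, 0 <= y ->
  forall U V F : R,
  \int[mu]_(x in `[s - t, s + t]) kerU s y x @[t --> +oo] --> U ->
  \int[mu]_(x in `[s - t, s + t]) kerV s y x @[t --> +oo] --> V ->
  \int[mu]_(x in `[s - t, s + t]) kerU s 0 x @[t --> +oo] --> F ->
  `|U - F| <= c * y /\ `|V| <= c * y.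
Proof.
move=> ns; have [A aw] := away_off_support ns.
have [B1 H1] := decay_bounded K0 mu_reg true.
have [B2 H2] := decay_bounded K0 mu_reg false.
have A0 : 0 <= A by have [] := aw 0.
exists (A * (B1 + B2)) => y y0 U V F cU cV cF.
have bnd (t : R) : `|s| < t -> forall f, measurable_fun setT f ->
    (forall x, supp mu x -> `|f x| <= A * y * decay x) ->
    `|\int[mu]_(x in `[s - t, s + t]) f x| <= A * (B1 + B2) * y.
  move=> st f mf fb.
  have mt : measurable `[s - t, s + t] by exact: measurable_itv.
  have md : measurable_fun setT (fun x => A * y * decay x).
    by apply: measurable_funM => //; exact: measurable_decay.
  have := ler_norm s; have := ler_norm (- s); rewrite normrN => s1 s2.
  apply: (@le_trans _ _ (\int[mu]_(x in `[s - t, s + t]) (A * y * decay x))).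
    rewrite ler_norml; apply/andP; split.
      have -> : - (\int[mu]_(x in `[s - t, s + t]) (A * y * decay x)) =
          \int[mu]_(x in `[s - t, s + t]) (-1 * (A * y * decay x)).
        by rewrite (wpm_intZ mu (-1) mt (@subset_refl _ _))// mulN1r.
      apply: (wpm_int_le mt (@subset_refl _ _)) => //; first exact: measurable_funM.
      by move=> x sx _; have := fb x sx; rewrite ler_norml => /andP[]; lra.
    apply: (wpm_int_le mt (@subset_refl _ _)) => // x sx _.
    exact: le_trans (ler_norm _) (fb x sx).
  rewrite (window_halves mu _ _ md); [|lra..].
  rewrite !(wpm_intZ mu _ (measurable_half _ _) (@half_sub _ _ _) measurable_decay).
  rewrite -mulrDr mulrAC ler_wpM2r// ler_wpM2l//.
  by apply: lerD.
split.
- have cd : `|\int[mu]_(x in `[s - t, s + t]) kerU s y x -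
      \int[mu]_(x in `[s - t, s + t]) kerU s 0 x| @[t --> +oo] --> `|U - F|.
    by apply: cvg_norm; exact: cvgB.
  apply: (ler_cvg_to cd (cvg_cst _)); near=> t => /=.
  have -> : \int[mu]_(x in `[s - t, s + t]) kerU s y x -
      \int[mu]_(x in `[s - t, s + t]) kerU s 0 x =
      \int[mu]_(x in `[s - t, s + t]) (kerU s y x - kerU s 0 x).
    rewrite [RHS](wpm_intD (b := s + t) mu (measurable_itv _) (@subset_refl _ _)).
    - congr (_ + _); rewrite -[RHS](_ : -1 * \int[mu]_(x in `[s - t, s + t]) kerU s 0 x = _).
        by rewrite mulN1r.
      rewrite -(wpm_intZ mu (-1) (measurable_itv _) (@subset_refl _ _)).
        by congr (Rintegral _ _ _); apply/funext => x; rewrite mulN1r.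
      exact: measurable_kerU.
    - exact: measurable_kerU.
    - by apply: measurable_funN; exact: measurable_kerU.
  apply: bnd.
  + by near: t; apply: nbhs_pinfty_gt; rewrite num_real.
  + by apply: measurable_funB; exact: measurable_kerU.
  + by move=> x sx; exact: kerU_near0.
- have cd : `|\int[mu]_(x in `[s - t, s + t]) kerV s y x| @[t --> +oo] --> `|V|.
    exact: cvg_norm.
  apply: (ler_cvg_to cd (cvg_cst _)); near=> t => /=.
  apply: bnd.
  + by near: t; apply: nbhs_pinfty_gt; rewrite num_real.
  + exact: measurable_kerV.
  + by move=> x sx; exact: kerV_decay.
Unshelve. all: by end_near.
Qed.

End window_sequences.

(** * Bounded convergence and resolvents *)

Section measurable_limits.
Context d {T : measurableType d} {R : realType} (P : probability T R).
Implicit Types (X : nat -> T -> R) (Y : T -> R).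

(** A measurable function that agrees with the limit of [X] wherever that
    limit exists. *)
Definition mlim X (w : T) : R := fine (limn_esup (fun n => (X n w)%:E)).

Lemma measurable_mlim X : (forall n, measurable_fun setT (X n)) ->
  measurable_fun setT (mlim X).
Proof.
move=> mX; apply: (measurableT_comp (fine_measurable measurableT)) => //.
by apply: measurable_fun_limn_esup => n; exact/measurable_EFinP.
Qed.

Lemma mlim_eq X w (l : R) : X n w @[n --> \oo] --> l -> mlim X w = l.
Proof.
move=> Xl; have c : (X n w)%:E @[n --> \oo] --> l%:E.
  by apply: cvg_EFin => //; exact: nearW.
rewrite /mlim is_cvg_limn_esupE; last by apply/cvg_ex; exists l%:E.
by rewrite (cvg_lim (@ereal_hausdorff R) c).
Qed.

Lemma bounded_integrable Y (C : R) : measurable_fun setT Y ->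
  (forall w, `|Y w| <= C) -> P.-integrable setT (EFin \o Y).
Proof.
move=> mY YC; apply: (@le_integrable _ _ _ P setT measurableT _ (EFin \o cst C)).
- exact/measurable_EFinP.
- by move=> w _; rewrite /= lee_fin; apply: le_trans (YC w) _; exact: ler_norm.
- exact: finite_measure_integrable_cst.
Qed.

Lemma bounded_cvg_Rintegral X Y (C : R) :
  (forall n, measurable_fun setT (X n)) -> measurable_fun setT Y ->
  (forall n w, `|X n w| <= C) ->
  {ae P, forall w, X n w @[n --> \oo] --> Y w} ->
  \int[P]_w X n w @[n --> \oo] --> \int[P]_w Y w.
Proof.
move=> mX mY XC XY.
have [| | | | |iY _ cv] := @dominated_convergence _ _ _ P setT measurableT
    (fun n w => (X n w)%:E) (EFin \o Y) (EFin \o cst C).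
- by move=> n; exact/measurable_EFinP.
- exact/measurable_EFinP.
- by apply: filterS XY => w Xw _; apply: cvg_EFin => //; exact: nearW.
- exact: finite_measure_integrable_cst.
- by apply: aeW => w n _; rewrite lee_fin.
apply: fine_cvg; rewrite /Rintegral fineK//.
exact: integrable_fin_num.
Qed.

Lemma ae_Rintegral_le (Y : T -> R) (C : R) : measurable_fun setT Y -> 0 <= C ->
  {ae P, forall w, `|Y w| <= C} -> `|\int[P]_w Y w| <= C.
Proof.
move=> mY C0 YC.
have iY : P.-integrable setT (EFin \o Y).
  apply/integrableP; split; first exact/measurable_EFinP.
  apply: (@le_lt_trans _ _ (\int[P]_w (cst C%:E) w)%E); last first.
    by rewrite integral_cst//= probability_setT mule1 ltry.
  apply: ae_ge0_le_integral => //.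
  - by apply/measurable_EFinP; exact: measurableT_comp.
  - by apply: filterS YC => w YC _; rewrite /= lee_fin.
rewrite -lee_fin EFin_normr_Rintegral//.
apply: (le_trans (le_abse_integral _ _ _)) => //.
  by case/integrableP : iY.
apply: (@le_trans _ _ (\int[P]_w (cst C%:E) w)%E); last first.
  by rewrite integral_cst//= probability_setT mule1.
apply: ae_ge0_le_integral => //.
- by apply/measurable_EFinP; exact: measurableT_comp.
- by apply: filterS YC => w YC _; rewrite /= lee_fin.
Qed.

End measurable_limits.

Section resolvent.
Context {R : realType}.
Implicit Types (a b U V e y : R).

Lemma resV_le a b U V : 0 < b -> 0 <= V -> `|resV a b U V| <= b^-1.
Proof.
move=> b0 V0; have bV : 0 < b + V by rewrite ltr_wpDr.
have Q0 : 0 < (a - U) ^+ 2 + (b + V) ^+ 2 by rewrite ltr_wpDl ?sqr_ge0// exprn_gt0.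
rewrite /resV normrM normfV (gtr0_norm Q0) (gtr0_norm bV) ler_pdivrMr// mulrC ler_pdivlMr//.
by have := sqr_ge0 (a - U); nra.
Qed.

Lemma resU_le a b U V : 0 < b -> 0 <= V -> `|resU a b U V| <= b^-1.
Proof.
move=> b0 V0; have bV : 0 < b + V by rewrite ltr_wpDr.
have Q0 : 0 < (a - U) ^+ 2 + (b + V) ^+ 2 by rewrite ltr_wpDl ?sqr_ge0// exprn_gt0.
rewrite /resU normrM normfV (gtr0_norm Q0) ler_pdivrMr// mulrC ler_pdivlMr//.
rewrite -[X in _ * X](gtr0_norm b0) -normrM ler_norml.
have := sqr_ge0 (a - U - b); have := sqr_ge0 (a - U + b).
by move=> *; apply/andP; split; nra.
Qed.

Lemma resolvent_cvg a b (U V : nat -> R) (u v : R) : 0 < b -> 0 <= v ->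
  U n @[n --> \oo] --> u -> V n @[n --> \oo] --> v ->
  resV a b (U n) (V n) @[n --> \oo] --> resV a b u v /\
  resU a b (U n) (V n) @[n --> \oo] --> resU a b u v.
Proof.
move=> b0 v0 cU cV.
have Q0 : (a - u) ^+ 2 + (b + v) ^+ 2 != 0.
  by rewrite gt_eqF// ltr_wpDl ?sqr_ge0// exprn_gt0// ltr_wpDr.
have cV' : b + V n @[n --> \oo] --> b + v by apply: cvgD => //; exact: cvg_cst.
have cU' : a - U n @[n --> \oo] --> a - u by apply: cvgB => //; exact: cvg_cst.
have cQ : ((a - U n) ^+ 2 + (b + V n) ^+ 2)^-1 @[n --> \oo]
    --> ((a - u) ^+ 2 + (b + v) ^+ 2)^-1.
  by apply: cvgV => //; apply: cvgD; rewrite !expr2; exact: cvgM.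
by split; apply: cvgM.
Qed.

Lemma measurable_res d (T : measurableType d) a b (U V : T -> R) :
  measurable_fun setT U -> measurable_fun setT V ->
  measurable_fun setT (fun w => resU a b (U w) (V w)) /\
  measurable_fun setT (fun w => resV a b (U w) (V w)).
Proof.
move=> mU mV.
have maU : measurable_fun setT (fun w => a - U w) by exact: measurable_funB.
have mbV : measurable_fun setT (fun w => b + V w) by exact: measurable_funD.
by split; apply: measurable_funM => //; apply: (measurableT_comp measurable_invr);
  apply: measurable_funD; exact: measurable_funX.
Qed.

Lemma cvg_norm_increments (p q r t : nat -> R) (p' q' r' t' : R) :
  p n @[n --> \oo] --> p' -> q n @[n --> \oo] --> q' ->
  r n @[n --> \oo] --> r' -> t n @[n --> \oo] --> t' ->
  `|p n - q n + (r n - t n)| @[n --> \oo] --> `|p' - q' + (r' - t')|.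
Proof. by move=> cp cq cr ct; apply: cvg_norm; apply: cvgD; exact: cvgB. Qed.

(** Cut [y, y'] into [N] equal steps: the total increment is at most
    [N * (C * (D / N) ^ 2)], where [D] is the length, and [N] is arbitrary. *)
Lemma quadratic_increments_cst (phi : R -> R) (C dl y : R) : 0 <= C -> 0 < dl ->
  (forall z e, y <= z -> 0 <= e -> e <= dl -> `|phi (z + e) - phi z| <= C * e ^+ 2) ->
  forall y', y <= y' -> phi y' = phi y.
Proof.
move=> C0 dl0 hphi y' yy'.
pose D := y' - y; have D0 : 0 <= D by rewrite subr_ge0.
apply/eqP; rewrite -subr_eq0 -normr_le0; apply/ler_addgt0Pr => e e0; rewrite add0r.
(* Steps of length [D / N] are at most [dl], and [N] of them cost
   [C D ^ 2 / N], at most [e]. *)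
pose N := (Num.truncn (D / dl + C * D ^+ 2 / e)).+1.
have N0 : 0 < N%:R :> R by [].
have h1 : 0 <= D / dl by rewrite divr_ge0// ltW.
have h2 : 0 <= C * D ^+ 2 / e by rewrite divr_ge0 ?mulr_ge0 ?sqr_ge0// ltW.
have hN : D / dl + C * D ^+ 2 / e <= N%:R by rewrite ltW// truncnS_gt.
have hN1 : D / N%:R <= dl.
  rewrite ler_pdivrMr//.
  have : D / dl <= N%:R by lra.
  by rewrite ler_pdivrMr// [N%:R * dl]mulrC.
have hN2 : C * D ^+ 2 / e <= N%:R by lra.
have step k : (k <= N)%N -> `|phi (y + k%:R * (D / N%:R)) - phi y|
    <= k%:R * (C * (D / N%:R) ^+ 2).
  elim: k => [_|k IH kN]; first by rewrite mul0r addr0 subrr normr0 mul0r.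
  set yk := y + k%:R * (D / N%:R) in IH.
  have DN : 0 <= D / N%:R by rewrite divr_ge0// ltW.
  have yyk : y <= yk by rewrite lerDl mulr_ge0.
  have -> : y + k.+1%:R * (D / N%:R) = yk + D / N%:R by rewrite /yk -[k.+1%:R]natr1; ring.
  apply: (le_trans (ler_distD (phi yk) _ _)); rewrite addrC -[k.+1%:R]natr1 [leRHS]mulrDl mul1r.
  by apply: lerD; [exact: IH (ltnW kN)|exact: hphi].
have := step N (leqnn N).
have -> : y + N%:R * (D / N%:R) = y' by rewrite mulrC divfK ?gt_eqF// /D; ring.
move=> h; apply: (le_trans h).
have -> : N%:R * (C * (D / N%:R) ^+ 2) = C * D ^+ 2 / e / N%:R * e.
  by field; rewrite !gt_eqF.
by rewrite ler_piMl ?(ltW e0)// ler_pdivrMr// mul1r.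
Qed.

End resolvent.

(** * The expected resolvent *)

Section expected_resolvent.
Context d {T : measurableType d} {R : realType} (P : probability T R).
Variables (M : {RV P >-> wpm R}) (K : R).
Hypothesis M_stationary : stationary M.
Hypothesis K_gt0 : 0 < K.
Hypothesis M_regular : {ae P, forall w, regular K (M w)}.
Implicit Types (s y a b e t : R).

Let K0 : 0 <= K. Proof. exact: ltW. Qed.

(** Real part and opposite of the imaginary part of the transform at [s + i y],
    restricted to a window of half-width [n] around [c]. *)
Definition winU c s y n (w : T) : R :=
  \int[M w]_(x in `[c - n%:R, c + n%:R]) kerU s y x.
Definition winV c s y n (w : T) : R :=
  \int[M w]_(x in `[c - n%:R, c + n%:R]) kerV s y x.

Definition limU s y : T -> R := mlim (winU s s y).
(** The maximum with 0 makes the value nonnegative at every [w], as the bounds on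
    the resolvent require. The windows are nonnegative for [y >= 0], so this is
    their limit wherever they converge. *)
Definition limV s y (w : T) : R := Num.max 0 (mlim (winV s s y) w).

Lemma measurable_winU c s y n : measurable_fun setT (winU c s y n).
Proof.
apply: (measurableT_comp (measurable_wpm_Rintegral (measurable_itv _) (measurable_kerU s y))).
exact: measurable_funPT.
Qed.

Lemma measurable_winV c s y n : measurable_fun setT (winV c s y n).
Proof.
apply: (measurableT_comp (measurable_wpm_Rintegral (measurable_itv _) (measurable_kerV s y))).
exact: measurable_funPT.
Qed.

Lemma measurable_limU s y : measurable_fun setT (limU s y).
Proof. by apply: measurable_mlim => n; exact: measurable_winU. Qed.

Lemma measurable_limV s y : measurable_fun setT (limV s y).
Proof.
by apply: measurable_maxr => //; apply: measurable_mlim => n; exact: measurable_winV.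
Qed.

Lemma winV_ge0 c s y n w : 0 <= y -> 0 <= winV c s y n w.
Proof.
move=> y0; apply: Rintegral_ge0 => x _.
by rewrite divr_ge0// addr_ge0// sqr_ge0.
Qed.

Lemma limV_ge0 s y w : 0 <= limV s y w.
Proof. by rewrite le_max lexx. Qed.

(** The centre [c] of the windows need not be the base point [s]. *)
Lemma away_limits w s y A {U : Type} (F : set_system U) {FF : Filter F} (tt : U -> R) c :
  regular K (M w) -> 0 <= y -> away (M w) s y A -> tt i @[i --> F] --> +oo ->
  \int[M w]_(x in `[c - tt i, c + tt i]) kerU s y x @[i --> F] --> limU s y w /\
  \int[M w]_(x in `[c - tt i, c + tt i]) kerV s y x @[i --> F] --> limV s y w.
Proof.
move=> reg y0 aw ct.
have [u cu] := kerU_window_cvg K0 reg aw; have [v cv] := kerV_window_cvg K0 reg y0 aw.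
have {}cv : \int[M w]_(x in `[s - LR.1, s + LR.2]) kerV s y x - 0 * ln (LR.1 / LR.2)
    @[LR --> filter_prod (pinfty_nbhs R) (pinfty_nbhs R)] --> v.
  by apply: (near_eq_cvg_to cv); apply: nearW => LR; rewrite mul0r subr0.
have cn := @cvgr_idn R.
have su : winU s s y n w @[n --> \oo] --> u by exact: (sym_window_along s cu cn).
have sv : winV s s y n w @[n --> \oo] --> v by exact: (sym_window_along s cv cn).
have v0 : 0 <= v.
  by apply: (ler_cvg_to (cvg_cst 0) sv); apply: nearW => n; exact: winV_ge0.
have -> : limU s y w = u by exact: mlim_eq.
have -> : limV s y w = v by rewrite /limV (mlim_eq sv) max_r.
by split; [exact: (sym_window_along c cu ct)|exact: (sym_window_along c cv ct)].
Qed.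

Lemma upper_limits w s y c : regular K (M w) -> 0 < y ->
  winU c s y n w @[n --> \oo] --> limU s y w /\
  winV c s y n w @[n --> \oo] --> limV s y w.
Proof.
move=> reg y0; have [A aw] := away_upper (M w) s y0.
exact: (away_limits c reg (ltW y0) aw (@cvgr_idn R)).
Qed.

Section fixed_pole.
Variables (a b : R).
Hypothesis b0 : 0 < b.

Definition expU s y : R := \int[P]_w resU a b (limU s y w) (limV s y w).
Definition expV s y : R := \int[P]_w resV a b (limU s y w) (limV s y w).

Lemma window_translate s (mu : wpm R) n (k : R -> R -> R -> R) y :
  (forall s y, measurable_fun setT (k s y)) ->
  (forall s y x, k s y x = k 0 y (x - s)) ->
  \int[translate s mu]_(x in `[0 - n%:R, 0 + n%:R]) k 0 y x =
  \int[mu]_(x in `[s - n%:R, s + n%:R]) k s y x.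
Proof.
move=> mk ks; rewrite Rintegral_translate//.
have -> : (fun x => x - s) @^-1` `[0 - n%:R, 0 + n%:R]%classic = `[s - n%:R, s + n%:R]%classic.
  by apply/seteqP; split => x; rewrite /= !in_itv/= => /andP[h1 h2]; apply/andP; split; lra.
by apply: eq_Rintegral => x _; rewrite [RHS]ks.
Qed.

Lemma kerU_shift s y x : kerU s y x = kerU 0 y (x - s).
Proof. by rewrite /kerU sub0r opprB. Qed.

Lemma kerV_shift s y x : kerV s y x = kerV 0 y (x - s).
Proof. by rewrite /kerV sub0r opprB. Qed.

(** A window around [s] with the kernel at [s + i y] is, after translation of the
    measure by [s], a window around 0 with the kernel at [i y]. *)
Lemma stationary_resolvent (g : R -> R -> R) s y :
  (forall (U V : wpm R -> R), measurable_fun setT U -> measurable_fun setT V ->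
    measurable_fun setT (fun mu => g (U mu) (V mu))) ->
  forall n, \int[P]_w g (winU s s y n w) (winV s s y n w) =
    \int[P]_w g (winU 0 0 y n w) (winV 0 0 y n w).
Proof.
move=> mg n.
pose U c s' (mu : wpm R) := \int[mu]_(x in `[c - n%:R, c + n%:R]) kerU s' y x.
pose V c s' (mu : wpm R) := \int[mu]_(x in `[c - n%:R, c + n%:R]) kerV s' y x.
have mU c s' : measurable_fun setT (U c s').
  exact: measurable_wpm_Rintegral (measurable_itv _) (measurable_kerU _ _).
have mV c s' : measurable_fun setT (V c s').
  exact: measurable_wpm_Rintegral (measurable_itv _) (measurable_kerV _ _).
pose G (mu : wpm R) := (g (U 0 0 mu) (V 0 0 mu))%:E.
have GtE (mu : wpm R) : G (translate s mu) = (g (U s s mu) (V s s mu))%:E.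
  rewrite /G /U /V (window_translate _ _ _ _ measurable_kerU kerU_shift).
  by rewrite (window_translate _ _ _ _ measurable_kerV kerV_shift).
rewrite /Rintegral; apply: (congr1 (@fine R)).
rewrite -(@stationary_integral _ _ _ P M M_stationary s G).
- by apply: eq_integral => w _; rewrite GtE.
- by apply/measurable_EFinP; exact: mg.
- rewrite (_ : G \o translate s = fun mu => (g (U s s mu) (V s s mu))%:E); last first.
    by apply/funext => mu; rewrite /= GtE.
  by apply/measurable_EFinP; exact: mg.
Qed.

Lemma exp_cvg s y : 0 < y ->
  \int[P]_w resU a b (winU s s y n w) (winV s s y n w) @[n --> \oo] --> expU s y /\
  \int[P]_w resV a b (winU s s y n w) (winV s s y n w) @[n --> \oo] --> expV s y.
Proof.
move=> y0.
have mres n := measurable_res a b (measurable_winU s s y n) (measurable_winV s s y n).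
have [mlU mlV] := measurable_res a b (measurable_limU s y) (measurable_limV s y).
have lim : {ae P, forall w,
    resV a b (winU s s y n w) (winV s s y n w) @[n --> \oo] --> resV a b (limU s y w) (limV s y w) /\
    resU a b (winU s s y n w) (winV s s y n w) @[n --> \oo] --> resU a b (limU s y w) (limV s y w)}.
  apply: filterS M_regular => w reg; have [cu cv] := upper_limits s s reg y0.
  by apply: resolvent_cvg => //; exact: limV_ge0.
split.
- apply: (@bounded_cvg_Rintegral _ _ _ P _ _ b^-1) => //.
  + by move=> n; have [] := mres n.
  + by move=> n w; apply: resU_le => //; exact: winV_ge0 (ltW y0).
  + by apply: filterS lim => w [].
- apply: (@bounded_cvg_Rintegral _ _ _ P _ _ b^-1) => //.
  + by move=> n; have [] := mres n.
  + by move=> n w; apply: resV_le => //; exact: winV_ge0 (ltW y0).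
  + by apply: filterS lim => w [].
Qed.

Lemma exp_stationary s y : 0 < y -> expU s y = expU 0 y /\ expV s y = expV 0 y.
Proof.
move=> y0; have [cU cV] := exp_cvg s y0; have [cU0 cV0] := exp_cvg 0 y0.
split.
- apply: (cvg_unique (@norm_hausdorff _ R) cU) => /=.
  apply: (near_eq_cvg_to cU0); apply: nearW => n.
  rewrite (stationary_resolvent (g := resU a b) s y)// => U V mU mV.
  by have [] := measurable_res a b mU mV.
- apply: (cvg_unique (@norm_hausdorff _ R) cV) => /=.
  apply: (near_eq_cvg_to cV0); apply: nearW => n.
  rewrite (stationary_resolvent (g := resV a b) s y)// => U V mU mV.
  by have [] := measurable_res a b mU mV.
Qed.

(** The windows for the three base points are all centred at [s], so that for each
    [n] they involve one finite measure, to which the finite Cauchy-Riemann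
    equation applies. Its error term does not depend on that measure and survives
    the limit. *)
Lemma resolvent_increment w s y e : regular K (M w) -> 0 < y -> 0 <= e -> 2 * e <= y ->
  `|resV a b (limU s (y + e) w) (limV s (y + e) w) - resV a b (limU s y w) (limV s y w)
    + (resU a b (limU (s + e) y w) (limV (s + e) y w) - resU a b (limU s y w) (limV s y w))|
  <= 10 / b * e ^+ 2 / y ^+ 2.
Proof.
move=> reg y0 e0 ey; have ye0 : 0 < y + e by rewrite ltr_wpDr.
have [u1 v1] := upper_limits s s reg y0.
have [u2 v2] := upper_limits s s reg ye0.
have [u3 v3] := upper_limits (s + e) s reg y0.
have [rV1 rU1] := resolvent_cvg a b0 (limV_ge0 _ _ _) u1 v1.
have [rV2 rU2] := resolvent_cvg a b0 (limV_ge0 _ _ _) u2 v2.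
have [rV3 rU3] := resolvent_cvg a b0 (limV_ge0 _ _ _) u3 v3.
have c := cvg_norm_increments rV2 rV1 rU3 rU1.
apply: (ler_cvg_to c (cvg_cst _)); apply: nearW => n /=.
have mI : measurable `[s - n%:R, s + n%:R] by exact: measurable_itv.
pose X := [seq x <- atoms (M w) (s - n%:R) (s + n%:R) | x \in `[s - n%:R, s + n%:R]%classic].
have UE s' y' : winU s s' y' n w = \sum_(x <- X) weight (M w) x * kerU s' y' x.
  rewrite /winU (Rintegral_atoms (M w) mI (@subset_refl _ _))//; last exact: measurable_kerU.
  by rewrite /X big_filter.
have VE s' y' : winV s s' y' n w = \sum_(x <- X) weight (M w) x * kerV s' y' x.
  rewrite /winV (Rintegral_atoms (M w) mI (@subset_refl _ _))//; last exact: measurable_kerV.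
  by rewrite /X big_filter.
rewrite !UE !VE.
have -> : 10 / b * e ^+ 2 / y ^+ 2 = 10 * e ^+ 2 / (b * y ^+ 2).
  by field; rewrite !gt_eqF.
by apply: resolvent_cauchy_riemann => // x _; exact: weight_ge0.
Qed.

Lemma integrable_resV s y :
  P.-integrable setT (EFin \o (fun w => resV a b (limU s y w) (limV s y w))).
Proof.
apply: (@bounded_integrable _ _ _ P _ b^-1).
  by have [] := measurable_res a b (measurable_limU s y) (measurable_limV s y).
by move=> w; apply: resV_le => //; exact: limV_ge0.
Qed.

Lemma integrable_resU s y :
  P.-integrable setT (EFin \o (fun w => resU a b (limU s y w) (limV s y w))).
Proof.
apply: (@bounded_integrable _ _ _ P _ b^-1).
  by have [] := measurable_res a b (measurable_limU s y) (measurable_limV s y).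
by move=> w; apply: resU_le => //; exact: limV_ge0.
Qed.

(** The horizontal increment of the real part has expectation 0 by stationarity;
    it is added in order to use the Cauchy-Riemann equation. *)
Lemma expV_increment s y e : 0 < y -> 0 <= e -> 2 * e <= y ->
  `|expV s (y + e) - expV s y| <= 10 / b * e ^+ 2 / y ^+ 2.
Proof.
move=> y0 e0 ey; have ye0 : 0 < y + e by rewrite ltr_wpDr.
set C := 10 / b * e ^+ 2 / y ^+ 2.
have <- : \int[P]_w ((resV a b (limU s (y + e) w) (limV s (y + e) w)
      - resV a b (limU s y w) (limV s y w))
    + (resU a b (limU (s + e) y w) (limV (s + e) y w)
      - resU a b (limU s y w) (limV s y w))) = expV s (y + e) - expV s y.
  have iB1 := integrableB measurableT (integrable_resV s (y + e)) (integrable_resV s y).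
  have iB2 := integrableB measurableT (integrable_resU (s + e) y) (integrable_resU s y).
  have eU : expU (s + e) y - expU s y = 0.
    apply/eqP; rewrite subr_eq0; apply/eqP.
    have [h1 _] := exp_stationary (s + e) y0.
    have [h2 _] := exp_stationary s y0.
    apply: (etrans h1); apply: esym; exact: h2.
  transitivity ((expV s (y + e) - expV s y) + (expU (s + e) y - expU s y)).
    rewrite RintegralD//.
    congr (_ + _).
      exact: (RintegralB measurableT (integrable_resV s (y + e)) (integrable_resV s y)).
    exact: (RintegralB measurableT (integrable_resU (s + e) y) (integrable_resU s y)).
  apply: (etrans (congr1 (fun z => expV s (y + e) - expV s y + z) eU)).
  exact: addr0.
apply: ae_Rintegral_le.
- by apply: measurable_funD; apply: measurable_funB;
    first [exact: (measurable_res a b (measurable_limU _ _) (measurable_limV _ _)).1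
          |exact: (measurable_res a b (measurable_limU _ _) (measurable_limV _ _)).2].
- by rewrite /C divr_ge0 ?sqr_ge0// mulr_ge0 ?sqr_ge0// divr_ge0// ltW.
- by apply: filterS M_regular => w reg; exact: resolvent_increment.
Qed.

Lemma expV_cst s y y' : 0 < y -> 0 < y' -> expV s y = expV s y'.
Proof.
have key z z' : 0 < z -> z <= z' -> expV s z' = expV s z.
  move=> z0 zz'; have z2 : 0 < z / 2 by rewrite divr_gt0.
  have C0 : 0 <= 10 / b / z ^+ 2 by rewrite !divr_ge0 ?sqr_ge0// ltW.
  apply: (quadratic_increments_cst C0 z2) zz' => x e zx e0 ez.
  have x0 := lt_le_trans z0 zx.
  apply: le_trans (expV_increment s x0 e0 _) _; first by move: ez zx; lra.
  rewrite mulrAC ler_wpM2r ?sqr_ge0// ler_wpM2l ?divr_ge0 ?(ltW b0)//.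
  rewrite lef_pV2 ?posrE ?exprn_gt0// lerXn2r ?nnegrE ?(ltW z0)// ltW//.
move=> y0 y'0; have [yy|yy] := leP y y'; last exact: key (ltW yy).
by apply: esym; exact: key.
Qed.

Lemma expV_far : expV 0 k.+1%:R @[k --> \oo] --> resV a b 0 (pi * K).
Proof.
have piK : 0 <= pi * K by rewrite mulr_ge0// pi_ge0.
have -> : resV a b 0 (pi * K) = \int[P]_w resV a b 0 (pi * K).
  by rewrite Rintegral_cst//= probability_setT mulr1.
apply: (@bounded_cvg_Rintegral _ _ _ P _ _ b^-1) => //.
- by move=> k; have [] := measurable_res a b (measurable_limU 0 k.+1%:R) (measurable_limV 0 k.+1%:R).
- by move=> k w; apply: resV_le => //; exact: limV_ge0.
apply: filterS M_regular => w reg.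
have cv k : let y : R := k.+1%:R in
    \int[M w]_(x in `[0 - t, 0 + t]) kerU 0 y x @[t --> +oo] --> limU 0 y w /\
    \int[M w]_(x in `[0 - t, 0 + t]) kerV 0 y x @[t --> +oo] --> limV 0 y w.
  move=> y; have y0 : 0 < y by [].
  have [A aw] := away_upper (M w) 0 y0.
  exact: (away_limits 0 reg (ltW y0) aw (@cvg_id _ _)).
have far (e : R) : 0 < e -> \forall k \near \oo,
    `|limU 0 k.+1%:R w| <= e /\ `|limV 0 k.+1%:R w - pi * K| <= e.
  move=> e0; have [Y HY] := far_limit K0 reg e0.
  exists (Num.truncn Y) => // k /= Yk.
  have [cU cV] := cv k; apply: (HY _ _ _ _ cU cV).
  by rewrite (le_trans (ltW (truncnS_gt Y)))// ler_nat ltnS.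
have [] := @resolvent_cvg _ a b (fun k => limU 0 k.+1%:R w) (fun k => limV 0 k.+1%:R w)
  0 (pi * K) b0 piK => //.
- by apply/cvgr0Pnorm_le => e e0; apply: filterS (far e e0) => k [].
- apply/cvgrPdist_le => e e0; apply: filterS (far e e0) => k [_].
  by rewrite distrC.
Qed.

Lemma expV_near s : {ae P, forall w, ~ supp (M w) s} ->
  expV s k.+1%:R^-1 @[k --> \oo] --> \int[P]_w resV a b (limU s 0 w) 0.
Proof.
move=> ns; apply: (@bounded_cvg_Rintegral _ _ _ P _ _ b^-1).
- by move=> k; have [] := measurable_res a b (measurable_limU s k.+1%:R^-1) (measurable_limV s k.+1%:R^-1).
- by have [] := measurable_res a b (measurable_limU s 0) (measurable_cst (0 : R)).
- by move=> k w; apply: resV_le => //; exact: limV_ge0.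
apply: filterS2 M_regular ns => w reg nsw.
have [A aw] := away_off_support nsw.
have cv y : 0 <= y ->
    \int[M w]_(x in `[s - t, s + t]) kerU s y x @[t --> +oo] --> limU s y w /\
    \int[M w]_(x in `[s - t, s + t]) kerV s y x @[t --> +oo] --> limV s y w.
  by move=> y0; exact: (away_limits s reg y0 (aw y) (@cvg_id _ _)).
have [cF _] := cv 0 (lexx 0).
have [c Hc] := near_limit K0 reg nsw.
have ck : c * k.+1%:R^-1 @[k --> \oo] --> (0 : R).
  rewrite -[X in _ --> X](mulr0 c); apply: cvgM; first exact: cvg_cst.
  exact: cvg_harmonic.
have y0 k : 0 <= k.+1%:R^-1 :> R by rewrite invr_ge0.
have [] := @resolvent_cvg _ a b (fun k => limU s k.+1%:R^-1 w) (fun k => limV s k.+1%:R^-1 w)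
  (limU s 0 w) 0 b0 (lexx 0) => //.
- apply/subr_cvg0; apply/norm_cvg0P.
  apply: (squeeze_cvgr _ (cvg_cst 0) ck); apply: nearW => k.
  rewrite normr_ge0/=; have [cU cV] := cv _ (y0 k).
  by have [] := Hc _ (y0 k) _ _ _ cU cV cF.
- apply/norm_cvg0P.
  apply: (squeeze_cvgr _ (cvg_cst 0) ck); apply: nearW => k.
  rewrite normr_ge0/=; have [cU cV] := cv _ (y0 k).
  by have [] := Hc _ (y0 k) _ _ _ cU cV cF.
Qed.

(** The expectation is constant in [y]; its limits at infinity and at 0 are the
    two sides. *)
Lemma expected_resolvent s : {ae P, forall w, ~ supp (M w) s} ->
  \int[P]_w resV a b (limU s 0 w) 0 = resV a b 0 (pi * K).
Proof.
move=> ns; apply: (cvg_unique (@norm_hausdorff _ R) (expV_near ns)) => /=.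
apply: (near_eq_cvg_to expV_far); apply: nearW => k.
have k0 : 0 < k.+1%:R :> R by [].
have [_ h] := exp_stationary s k0.
apply: (etrans (esym h)); exact: expV_cst.
Qed.

End fixed_pole.
End expected_resolvent.

(** * From Poisson integrals to the law *)

Section poisson.
Context {R : realType}.

(** The Poisson kernel [b / (u ^ 2 + b ^ 2)] is the derivative of the arctangent
    of [u / b] and is Lipschitz with constant [1 / b ^ 2]. *)
Lemma atan_div_taylor (b u e : R) : 0 < b -> 0 <= e ->
  `|atan ((u + e) / b) - atan (u / b) - e * (b / (u ^+ 2 + b ^+ 2))|
    <= b ^- 2 * e ^+ 2.
Proof.
move=> b0 e0.
have ue : u <= u + e by rewrite lerDl.
have dv x := is_derive_atan_div x b0.
have [|c] := @MVT_segment R (fun x => atan (x / b)) _ u (u + e) ue (fun x _ => dv x).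
  apply: continuous_subspaceT => x; apply: differentiable_continuous.
  by apply/derivable1_diffP; have [] := dv x.
rewrite in_itv/= => /andP[uc cu] ->.
rewrite addrAC subrr add0r [X in X - _]mulrC -mulrBr normrM (ger0_norm e0).
rewrite [leLHS]mulrC expr2 mulrA ler_wpM2r//.
have Qu : 0 < u ^+ 2 + b ^+ 2 by rewrite ltr_wpDl ?sqr_ge0// exprn_gt0.
have Qc : 0 < c ^+ 2 + b ^+ 2 by rewrite ltr_wpDl ?sqr_ge0// exprn_gt0.
have -> : b / (c ^+ 2 + b ^+ 2) - b / (u ^+ 2 + b ^+ 2) =
    b * ((u - c) * (u + c)) / ((c ^+ 2 + b ^+ 2) * (u ^+ 2 + b ^+ 2)).
  by field; rewrite !gt_eqF.
have QQ : 0 < (c ^+ 2 + b ^+ 2) * (u ^+ 2 + b ^+ 2) by exact: mulr_gt0.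
rewrite normrM normfV (gtr0_norm QQ) ler_pdivrMr//.
have -> : b ^- 2 * e * ((c ^+ 2 + b ^+ 2) * (u ^+ 2 + b ^+ 2)) =
    b^-1 * e * ((c ^+ 2 + b ^+ 2) * (u ^+ 2 + b ^+ 2)) / b.
  by field; rewrite gt_eqF.
rewrite ler_pdivlMr// !normrM (gtr0_norm b0).
have uce : `|u - c| <= e by rewrite ler0_norm ?subr_le0//; lra.
have ucl : b ^+ 3 * `|u + c| <= (c ^+ 2 + b ^+ 2) * (u ^+ 2 + b ^+ 2).
  rewrite -[b ^+ 3 * _](@ger0_norm _ (b ^+ 3 * _)); last by rewrite mulr_ge0// exprn_ge0// ltW.
  rewrite normrM normr_id -normrM ler_norml.
  apply/andP; split.
    have := sqr_ge0 (u * c); have := sqr_ge0 (b * (u + b / 2)).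
    have := sqr_ge0 (b * (c + b / 2)); have := sqr_ge0 (b ^+ 2).
    by rewrite !expr2 exprS expr2; lra.
  have := sqr_ge0 (u * c); have := sqr_ge0 (b * (u - b / 2)).
  have := sqr_ge0 (b * (c - b / 2)); have := sqr_ge0 (b ^+ 2).
  by rewrite !expr2 exprS expr2; lra.
have -> : b * (`|u - c| * `|u + c|) * b = b^-1 * (`|u - c| * (b ^+ 3 * `|u + c|)).
  by field; rewrite gt_eqF.
rewrite -mulrA ler_wpM2l ?invr_ge0 ?(ltW b0)//.
by apply: ler_pM => //; rewrite mulr_ge0// exprn_ge0// ltW.
Qed.

Lemma poisson_kernel_le (b u : R) : 0 < b -> `|b / (u ^+ 2 + b ^+ 2)| <= b^-1.
Proof.
move=> b0; have Q : 0 < u ^+ 2 + b ^+ 2 by rewrite ltr_wpDl ?sqr_ge0// exprn_gt0.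
rewrite ger0_norm; last by rewrite divr_ge0 ?ltW.
by rewrite ler_pdivrMr// mulrC ler_pdivlMr// [b ^+ 2]expr2 lerDr sqr_ge0.
Qed.

Lemma atan_dilation_cvg (u : R) :
  atan (u * k.+1%:R) @[k --> \oo] --> pi / 2 * Num.sg u.
Proof.
have pos (v : R) : 0 < v -> atan (v * k.+1%:R) @[k --> \oo] --> pi / 2.
  move=> v0; apply: (@cvg_comp _ _ _ (fun k : nat => v * k.+1%:R) atan); last exact: cvgy_atan.
  apply/cvgryPge => A; exists (Num.truncn (A / v)) => // k /= Ak.
  rewrite mulrC -ler_pdivrMr// (le_trans (ltW (truncnS_gt _)))// ler_nat ltnS//.
case: (ltrgt0P u) => [u0|u0|->].
- by rewrite gtr0_sg// mulr1; exact: pos.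
- rewrite ltr0_sg// mulrN1; have nu : 0 < - u by rewrite oppr_gt0.
  apply: (near_eq_cvg_to (cvgN (pos _ nu))); apply: nearW => k /=.
  by rewrite mulNr atanN opprK.
- rewrite sgr0 mulr0; apply: (near_eq_cvg_to (cvg_cst 0)); apply: nearW => k.
  by rewrite mul0r atan0.
Qed.

End poisson.

Section poisson_transform.
Context d {T : measurableType d} {R : realType} (P : probability T R).
Variable X : T -> R.
Hypothesis mX : measurable_fun setT X.
Hypothesis poissonX : forall a b : R, 0 < b ->
  \int[P]_w (b / ((a - X w) ^+ 2 + b ^+ 2)) = (b + 1) / (a ^+ 2 + (b + 1) ^+ 2).

Let atanX (b a : R) (w : T) := atan ((a - X w) / b).

Let measurable_atanX b a : measurable_fun setT (atanX b a).
Proof.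
have mat : measurable_fun [set: R] (@atan R).
  apply: continuous_measurable_fun => x; exact: continuous_atan.
by apply: (measurableT_comp mat); apply: measurable_funM => //; exact: measurable_funB.
Qed.

Let atan_bnd (x : R) : `|atan x| <= pi / 2.
Proof. by rewrite ler_norml; apply/andP; split; rewrite ltW// ?atan_gtNpi2 ?atan_ltpi2. Qed.

Let integrable_atanX b a : P.-integrable setT (EFin \o atanX b a).
Proof. by apply: (@bounded_integrable _ _ _ P _ (pi / 2)) => // w; exact: atan_bnd. Qed.

(** As functions of the end point, both sides have the same derivative by
    hypothesis. With the second order Taylor estimates their difference has
    increments of second order, hence is constant; no derivative is taken under
    the integral. *)
Lemma Rintegral_atan_increment b p q : 0 < b -> p <= q ->
  \int[P]_w (atanX b q w - atanX b p w) = atan (q / (b + 1)) - atan (p / (b + 1)).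
Proof.
move=> b0 pq; have b10 : 0 < b + 1 by exact: addr_gt0.
rewrite RintegralB//.
set phi := fun a => \int[P]_w atanX b a w - atan (a / (b + 1)).
suff : phi q = phi p by rewrite /phi; lra.
have C0 : 0 <= b ^- 2 + (b + 1) ^- 2 by rewrite addr_ge0// invr_ge0 sqr_ge0.
apply: (quadratic_increments_cst C0 (@ltr01 R) _ pq) => z e _ e0 _.
have mk : measurable_fun setT (fun w => b / ((z - X w) ^+ 2 + b ^+ 2)).
  apply: measurable_funM => //; apply: (measurableT_comp measurable_invr).
  by apply: measurable_funD => //; apply: measurable_funX; exact: measurable_funB.
have ik : P.-integrable setT (EFin \o (fun w => e * (b / ((z - X w) ^+ 2 + b ^+ 2)))).
  apply: (@bounded_integrable _ _ _ P _ (e * b^-1)); first exact: measurable_funM.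
  by move=> w; rewrite normrM (ger0_norm e0) ler_wpM2l//; exact: poisson_kernel_le.
have h1 : `|\int[P]_w (atanX b (z + e) w - atanX b z w
     - e * (b / ((z - X w) ^+ 2 + b ^+ 2)))| <= b ^- 2 * e ^+ 2.
  apply: ae_Rintegral_le.
  - by apply: measurable_funB; [exact: measurable_funB|exact: measurable_funM].
  - by rewrite mulr_ge0 ?sqr_ge0// invr_ge0 sqr_ge0.
  - apply: aeW => w; rewrite /atanX [z + e - X w]addrAC; exact: atan_div_taylor.
have i1 : P.-integrable setT (EFin \o (fun w => atanX b (z + e) w - atanX b z w)).
  apply: (@bounded_integrable _ _ _ P _ (pi / 2 + pi / 2)); first exact: measurable_funB.
  by move=> w; apply: le_trans (ler_normB _ _) _; apply: lerD; exact: atan_bnd.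
have i2 : P.-integrable setT (EFin \o (fun w => b / ((z - X w) ^+ 2 + b ^+ 2))).
  apply: (@bounded_integrable _ _ _ P _ (b^-1)) => //.
  by move=> w; exact: poisson_kernel_le.
rewrite (RintegralB measurableT i1 ik) RintegralB// RintegralZl// in h1.
rewrite poissonX// in h1.
have h2 := atan_div_taylor z b10 e0.
rewrite /phi [leRHS]mulrDl.
apply: le_trans (lerD h1 h2).
by apply: le_trans (ler_normB _ _); rewrite le_eqVlt; apply/orP; left; apply/eqP; congr `|_|; ring.
Qed.

Let sgnX (a : R) (w : T) : R := Num.sg (a - X w).

Lemma measurable_sgnX a : measurable_fun setT (sgnX a).
Proof.
rewrite (_ : sgnX a = fun w => if X w < a then 1 else if a < X w then -1 else 0).
  apply: measurable_fun_ifT => //; first exact: measurable_fun_ltr.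
  by apply: measurable_fun_ifT => //; exact: measurable_fun_ltr.
apply/funext => w; rewrite /sgnX -subr_gt0 -[a < _]subr_lt0.
case: (ltrgt0P (a - X w)) => [u0|u0|->]; last exact: sgr0.
- exact: gtr0_sg.
- exact: ltr0_sg.
Qed.

(** Limit of the identity for arctangents as [b] tends to 0. *)
Lemma Rintegral_sg_increment p q : p <= q ->
  \int[P]_w (pi / 2 * (sgnX q w - sgnX p w)) = atan q - atan p.
Proof.
move=> pq.
have c1 : \int[P]_w (atanX k.+1%:R^-1 q w - atanX k.+1%:R^-1 p w) @[k --> \oo]
    --> \int[P]_w (pi / 2 * (sgnX q w - sgnX p w)).
  apply: (@bounded_cvg_Rintegral _ _ _ P _ _ (pi / 2 + pi / 2)).
  - by move=> k; exact: measurable_funB.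
  - by apply: measurable_funM => //; apply: measurable_funB; exact: measurable_sgnX.
  - by move=> k w; apply: le_trans (ler_normB _ _) _; apply: lerD; exact: atan_bnd.
  - apply: aeW => w; rewrite mulrBr /atanX.
    under eq_fun do rewrite !invrK.
    by apply: cvgB; exact: atan_dilation_cvg.
apply: (cvg_unique (@norm_hausdorff _ R) c1) => /=.
have c2 (u : R) : atan (u / (k.+1%:R^-1 + 1)) @[k --> \oo] --> atan u.
  apply: (@continuous_cvg _ _ _ _ _ _ atan); first exact: continuous_atan.
  rewrite -[X in _ --> X](mulr1 u); apply: cvgM; first exact: cvg_cst.
  rewrite -[X in _ --> X]invr1; apply: cvgV; first exact: oner_neq0.
  rewrite -[X in _ --> X]add0r; apply: cvgD; [exact: cvg_harmonic|exact: cvg_cst].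
apply: (near_eq_cvg_to (cvgB (c2 q) (c2 p))); apply: nearW => k /=.
by rewrite Rintegral_atan_increment.
Qed.

End poisson_transform.

Section cauchy_interval.
Context {R : realType}.

Lemma std_cauchy_itv (p q : R) : p < q ->
  std_cauchy `]p, q] = ((atan q - atan p) / pi)%:E.
Proof.
move=> pq.
have cpdf : continuous (fun x : R => pi^-1 * (oneDsqr x)^-1).
  by move=> x; apply: cvgM; [exact: cvg_cst|exact: continuous_oneDsqrV].
have -> : std_cauchy `]p, q] =
    (\int[lebesgue_measure]_(x in `]p, q]) (pi^-1 * (oneDsqr x)^-1)%:E)%E.
  by apply: eq_integral => x _; rewrite /std_cauchy_pdf invfM.
rewrite integral_itv_obnd_cbnd; last first.
  by apply/measurable_EFinP/measurable_funTS; exact: continuous_measurable_fun.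
rewrite (@continuous_FTC2 _ _ (fun x => pi^-1 * atan x)) //.
- by rewrite -EFinB; congr EFin; rewrite -mulrBr mulrC.
- exact: continuous_subspaceT.
- split=> [x _||].
  + by apply: derivableM => //; exact: derivable_atan.
  + apply: cvg_at_right_filter; apply: cvgM; [exact: cvg_cst|exact: continuous_atan].
  + apply: cvg_at_left_filter; apply: cvgM; [exact: cvg_cst|exact: continuous_atan].
- move=> x _; rewrite derive1E.
  have d1 := is_derive1_atan x.
  have d2 : is_derive x 1 (pi^-1 \*: (@atan R)) _ := is_deriveZ _ d1.
  by have [_ ->] := d2.
Qed.

End cauchy_interval.

Section law.
Context d {T : measurableType d} {R : realType} (P : probability T R).
Variable X : T -> R.
Hypothesis mX : measurable_fun setT X.
Hypothesis poissonX : forall a b : R, 0 < b ->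
  \int[P]_w (b / ((a - X w) ^+ 2 + b ^+ 2)) = (b + 1) / (a ^+ 2 + (b + 1) ^+ 2).

Lemma sg_right_cvg (u : R) :
  Num.sg (u + k.+1%:R^-1) @[k --> \oo] --> ((-1) ^+ (u < 0)%R : R).
Proof.
have [u0|u0] := ltP u 0; rewrite ?expr0 ?expr1; last first.
  apply: cvg_near_cst; apply: nearW => k; apply/eqP.
  by rewrite gtr0_sg// ltr_wpDl.
apply: cvg_near_cst.
have : \forall k \near \oo, k.+1%:R^-1 < - u.
  have := @cvg_harmonic R; move/cvgrPdist_lt => /(_ (- u)).
  rewrite oppr_gt0 => /(_ u0); apply: filterS => k.
  by rewrite sub0r normrN ger0_norm ?invr_ge0.
by apply: filterS => k ku; apply/eqP; rewrite ltr0_sg// -[ltRHS](subrr u) ltrD2l.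
Qed.

(** The sign of [q - X] vanishes at [X = q]; approaching [q] from the right
    counts that point as being below [q]. *)
Lemma probability_itv (p q : R) : p < q ->
  P (X @^-1` `]p, q]) = ((atan q - atan p) / pi)%:E.
Proof.
move=> pq.
have mA : measurable (X @^-1` `]p, q]) by rewrite -[X in measurable X]setTI; exact: mX.
have msg a : measurable_fun setT (fun w => Num.sg (a - X w)).
  exact: measurable_sgnX.
have c1 : \int[P]_w (pi / 2 * (Num.sg (q + k.+1%:R^-1 - X w) - Num.sg (p + k.+1%:R^-1 - X w)))
    @[k --> \oo] --> \int[P]_w (pi * \1_(X @^-1` `]p, q]) w).
  apply: (@bounded_cvg_Rintegral _ _ _ P _ _ (pi / 2 * 2)).
  - by move=> k; apply: measurable_funM => //; exact: measurable_funB.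
  - by apply: measurable_funM => //; exact: measurable_indic.
  - move=> k w; have pi20 : 0 <= pi / 2 :> R by rewrite divr_ge0 ?pi_ge0.
    rewrite normrM (ger0_norm pi20) ler_wpM2l//.
    apply: le_trans (ler_normB _ _) _; rewrite !normr_sg.
    by case: (_ != 0); case: (_ != 0); rewrite /=; lra.
  - apply: aeW => w.
    have -> : pi * \1_(X @^-1` `]p, q]) w =
        pi / 2 * ((-1) ^+ (q - X w < 0)%R - (-1) ^+ (p - X w < 0)%R) :> R.
      have -> : \1_(X @^-1` `]p, q]) w = ((p < X w) && (X w <= q))%:R :> R.
        by rewrite indicE; congr (nat_of_bool _)%:R; apply/idP/idP; rewrite inE/= in_itv.
      rewrite !subr_lt0 [X w <= q]leNgt.
      have [pX|Xp] := ltP p (X w); have [qX|Xq] := ltP q (X w) => /=.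
      - by ring.
      - by field.
      - by move: (lt_le_trans pq (ltW qX)); rewrite ltNge Xp.
      - by ring.
    apply: cvgM; first exact: cvg_cst.
    apply: cvgB.
      by under eq_fun do rewrite addrAC; exact: sg_right_cvg.
    by under eq_fun do rewrite addrAC; exact: sg_right_cvg.
have c2 (u : R) : atan (u + k.+1%:R^-1) @[k --> \oo] --> atan u.
  apply: (@continuous_cvg _ _ _ _ _ _ atan); first exact: continuous_atan.
  rewrite -[X in _ --> X]addr0; apply: cvgD; [exact: cvg_cst|exact: cvg_harmonic].
have : \int[P]_w (pi * \1_(X @^-1` `]p, q]) w) = atan q - atan p.
  apply: (cvg_unique (@norm_hausdorff _ R) c1) => /=.
  apply: (near_eq_cvg_to (cvgB (c2 q) (c2 p))); apply: nearW => k /=.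
  apply: esym; apply: (Rintegral_sg_increment mX poissonX).
  by rewrite lerD2r ltW.
rewrite RintegralZl//; last first.
  apply: (@bounded_integrable _ _ _ P _ 1); first exact: measurable_indic.
  by move=> w; rewrite indicE; case: (_ \in _); rewrite ?normr1 ?normr0.
rewrite /Rintegral integral_indic// setIT => <-.
by rewrite mulrC mulKf ?gt_eqF ?pi_gt0// fineK// fin_num_measure.
Qed.

Let rvX : {RV P >-> R} := HB.pack X (isMeasurableFun.Build _ _ _ _ X mX).

(** The laws agree on the intervals [`]p, q]], which generate the Borel sets and
    are stable under intersection. *)
Lemma distribution_cauchy (B : set R) : measurable B ->
  distribution P rvX B = std_cauchy B.
Proof.
apply: (@measure_unique _ R R (@ocitv R) (fun k => `]- k%:R, k%:R]%classic)).
- by [].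
- exact: ocitvI.
- by move=> k; exact: is_ocitv.
- apply/seteqP; split => // x _.
  exists (Num.truncn `|x|).+1 => //=; rewrite in_itv/=.
  have h : `|x| < (Num.truncn `|x|).+1%:R by exact: truncnS_gt.
  by move: h; rewrite ltr_norml => /andP[-> /ltW].
- move=> A /ocitvP[->|[[p q] /= pq ->]]; first by rewrite !measure0.
  rewrite std_cauchy_itv//; exact: probability_itv.
- by move=> k; apply: le_lt_trans (probability_le1 _ _) (ltry _).
Qed.

Lemma integral_cauchy (f : R -> R) (C : R) : measurable_fun setT f -> (forall x, `|f x| <= C) ->
  (\int[P]_w (f (X w))%:E = \int[std_cauchy]_x (f x)%:E)%E.
Proof.
move=> mf fC.
rewrite -(@eq_measure_integral _ _ _ setT std_cauchy (distribution P rvX)); last first.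
  by move=> A mA _; exact: distribution_cauchy.
rewrite integral_distribution//; first exact/measurable_EFinP.
apply: (@bounded_integrable _ _ _ P _ C) => //.
exact: (measurableT_comp mf mX).
Qed.

End law.

(** * The limit law *)

Section off_support.
Context {R : realType} (K : R) (mu : wpm R).
Hypothesis K0 : 0 <= K.
Hypothesis mu_reg : regular K mu.

Lemma kerU_pole (s : R) : kerU s 0 = fun x => (s - x)^-1.
Proof.
apply/funext => x; rewrite /kerU expr0n/= addr0 expr2 invfM mulrA.
have [->|sx] := eqVneq (s - x) 0; first by rewrite invr0 mulr0.
by rewrite divff// mul1r.
Qed.

Lemma pole_window_cvg (s : R) : ~ supp mu s -> exists l : R,
  \int[mu]_(x in `[s - LR.1, s + LR.2]) kerU s 0 x - K * ln (LR.1 / LR.2)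
    @[LR --> filter_prod (pinfty_nbhs R) (pinfty_nbhs R)] --> l.
Proof.
move=> ns; have [A aw] := away_off_support ns.
exact: (kerU_window_cvg K0 mu_reg (aw 0)).
Qed.

(** The limit over symmetric windows [[- A, A]] and the one over windows around
    [s] are the same. *)
Lemma transform_cvg (s : R) : ~ supp mu s ->
  cvg (truncated_transform mu (- A) A s @[A --> +oo]) /\
  truncated_transform mu (s - LR.1) (s + LR.2) s - K * ln (LR.1 / LR.2)
    @[LR --> filter_prod (pinfty_nbhs R) (pinfty_nbhs R)] --> transform mu s.
Proof.
move=> ns; have [l cl] := pole_window_cvg ns.
have cs : truncated_transform mu (- A) A s @[A --> +oo] --> l.
  apply: (near_eq_cvg_to (sym_window_along 0 cl (@cvg_id _ _))).
  by apply: nearW => A; rewrite kerU_pole sub0r add0r.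
split; first by apply/cvg_ex; exists l.
rewrite /transform (cvg_lim (@Rhausdorff R) cs).
by rewrite kerU_pole in cl.
Qed.

End off_support.

(** The resolvent at [k * a + i k * b] with the variable [u] is, up to a factor,
    the Poisson kernel at [a + i b] with the variable [u / k]. *)
Lemma poisson_scaling {R : realType} (k a b u : R) : 0 < k -> 0 < b ->
  b / ((a - k^-1 * u) ^+ 2 + b ^+ 2) = k * resV (k * a) (k * b) u 0.
Proof.
move=> k0 b0; rewrite /resV addr0.
have Q : 0 < (a - k^-1 * u) ^+ 2 + b ^+ 2.
  by rewrite ltr_wpDl ?sqr_ge0// exprn_gt0.
have -> : (k * a - u) ^+ 2 + (k * b) ^+ 2 = k ^+ 2 * ((a - k^-1 * u) ^+ 2 + b ^+ 2).
  by field; rewrite gt_eqF.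
by move: Q; set q := (_ + _) => Q; field; rewrite !gt_eqF.
Qed.

Section limit_law.
Context d {T : measurableType d} {R : realType} (P : probability T R).
Variables (M : {RV P >-> wpm R}) (K : R).
Hypothesis M_stationary : stationary M.
Hypothesis K_gt0 : 0 < K.
Hypothesis M_intensity : intensity M = K%:E.
Hypothesis M_regular : {ae P, forall w, regular K (M w)}.

Lemma ae_off_support (s : R) : {ae P, forall w, ~ supp (M w) s}.
Proof.
apply: filterS (no_fixed_atom M_stationary M_intensity s) => w Ms sw.
have [_ [wt [wt0 muE]]] := wpmP (M w).
have := wpm_set1 wt0 muE sw; rewrite Ms => -[h].
by have := wt0 _ sw; rewrite -h ltxx.
Qed.

Let X (s : R) (w : T) : R := (pi * K)^-1 * limU M s 0 w.

Let piK : 0 < pi * K. Proof. by rewrite mulr_gt0// pi_gt0. Qed.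

Let measurable_X s : measurable_fun setT (X s).
Proof. by apply: measurable_funM => //; exact: measurable_limU. Qed.

(** These are the Poisson integrals of the standard Cauchy law. *)
Lemma poisson_transform s (a b : R) : 0 < b ->
  \int[P]_w (b / ((a - X s w) ^+ 2 + b ^+ 2)) = (b + 1) / (a ^+ 2 + (b + 1) ^+ 2).
Proof.
move=> b0; have kb0 : 0 < pi * K * b by exact: mulr_gt0.
have hE := expected_resolvent M_stationary K_gt0 M_regular (pi * K * a) kb0 (ae_off_support s).
have -> : (fun w => b / ((a - X s w) ^+ 2 + b ^+ 2)) =
    (fun w => (pi * K) * resV (pi * K * a) (pi * K * b) (limU M s 0 w) 0).
  by apply/funext => w; exact: poisson_scaling.
rewrite RintegralZl//; last first.
  apply: (@bounded_integrable _ _ _ P _ (pi * K * b)^-1).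
    by have [] := measurable_res (pi * K * a) (pi * K * b) (measurable_limU M s 0) (measurable_cst (0 : R)).
  by move=> w; exact: resV_le.
have b1 : 0 < b + 1 by rewrite addr_gt0.
have := poisson_scaling a 0 piK b1; rewrite mulr0 subr0 => ->.
by rewrite hE /resV addr0 mulrDr mulr1.
Qed.

Lemma window_law_cvg (L Rr : nat -> R) (l s : R) :
  L n @[n --> \oo] --> +oo -> Rr n @[n --> \oo] --> +oo ->
  ln (L n / Rr n) @[n --> \oo] --> l ->
  {ae P, forall w, (pi * K)^-1 * truncated_transform (M w) (s - L n) (s + Rr n) s
    @[n --> \oo] --> l / pi + 1 * X s w}.
Proof.
move=> cL cR cl; apply: filterS2 M_regular (ae_off_support s) => w reg ns.
have [u cu] := pole_window_cvg (ltW K_gt0) reg ns.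
have uE : limU M s 0 w = u.
  by apply: mlim_eq; exact: (sym_window_along s cu (@cvgr_idn R)).
have c := @window_along _ _ _ _ _ _ _ _ _ L Rr l cu cL cR cl.
have -> : l / pi + 1 * X s w = (pi * K)^-1 * (u + K * l).
  by rewrite /X uE; move: (@pi R) (@pi_gt0 R) => p p0; field; rewrite !gt_eqF.
apply: cvgM; first exact: cvg_cst.
rewrite kerU_pole in c; exact: (c (eventually_filter)).
Qed.

(** Along the windows the transform converges almost surely, hence in law, to an
    affine image of a variable whose law is the standard Cauchy law. *)
Lemma window_converges_in_distribution (L Rr : nat -> R) (l s : R) :
  L n @[n --> \oo] --> +oo -> Rr n @[n --> \oo] --> +oo ->
  ln (L n / Rr n) @[n --> \oo] --> l ->
  converges_in_distribution P
    (fun n w => (pi * K)^-1 * truncated_transform (M w) (s - L n) (s + Rr n) s)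
    (cauchy_prob (l / pi) 1).
Proof.
move=> cL cR cl.
set Y := fun n w => _.
have mY n : measurable_fun setT (Y n).
  apply: measurable_funM => //.
  rewrite /truncated_transform -(kerU_pole s).
  apply: (measurableT_comp (measurable_wpm_Rintegral (measurable_itv _) (measurable_kerU s 0))).
  exact: measurable_funPT.
split=> // f cf [C [_ fC]].
have {}fC x : `|f x| <= C + 1 by apply: fC; rewrite ?ltrDl.
have mf : measurable_fun setT f by exact: continuous_measurable_fun.
have mXf : measurable_fun setT (fun x => f (affine_map (l / pi) 1 x)).
  by apply: (measurableT_comp mf); exact: measurable_funPT.
have cvP : \int[P]_w f (Y n w) @[n --> \oo] --> \int[P]_w f (affine_map (l / pi) 1 (X s w)).
  apply: (@bounded_cvg_Rintegral _ _ _ P _ _ (C + 1)).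
  - by move=> n; exact: (measurableT_comp mf).
  - exact: (measurableT_comp mXf (measurable_X s)).
  - by move=> n w; exact: fC.
  - apply: filterS (window_law_cvg s cL cR cl) => w cw.
    by apply: (@continuous_cvg _ _ _ _ _ _ f) => //; exact: cf.
have iY n : P.-integrable setT (EFin \o (f \o Y n)).
  apply: (@bounded_integrable _ _ _ P _ (C + 1)); first exact: (measurableT_comp mf).
  by move=> w; exact: fC.
have iX : P.-integrable setT (EFin \o (fun w => f (affine_map (l / pi) 1 (X s w)))).
  apply: (@bounded_integrable _ _ _ P _ (C + 1)); first exact: (measurableT_comp mXf (measurable_X s)).
  by move=> w; exact: fC.
have -> : (\int[cauchy_prob (l / pi) 1]_y (f y)%:E)%E =
    (\int[P]_w f (affine_map (l / pi) 1 (X s w)))%:E.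
  rewrite integral_distribution; last 2 first.
  - exact/measurable_EFinP.
  - by apply: (@bounded_integrable _ _ _ std_cauchy _ (C + 1)).
  rewrite /Rintegral fineK; last exact: integrable_fin_num.
  by rewrite (integral_cauchy (measurable_X s) (poisson_transform s) mXf (fun x => fC _)).
have -> : (fun n => 'E_P[f \o Y n])%E = (fun n => (\int[P]_w f (Y n w))%:E).
  apply/funext => n; rewrite unlock /Rintegral fineK//.
  exact: (integrable_fin_num measurableT (iY n)).
by apply: cvg_EFin => //; exact: nearW.
Qed.

End limit_law.

Theorem theorem4p2 (R : realType) (d : measure_display) (T : measurableType d)
    (P : probability T R) (M : {RV P >-> wpm R}) (K : R) (h : R -> R)
    (M_stationary : stationary M)
    (K_gt0 : 0 < K)
    (M_intensity : intensity M = K%:E)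
    (h_ge0 : forall r, 1 <= r -> 0 <= h r)
    (h_measurable : measurable_fun (`[1, +oo[%classic : set R) h)
    (M_dev : forall x, 1 <= `|x| ->
      ('E_P[fun omega => `|counting_fun (M omega) x - K * x|%R]
         <= (h `|x|)%:E)%E)
    (h_int : (\int[lebesgue_measure]_(r in `[1%R, +oo[)
                (h r / r ^+ 2)%:E < +oo)%E) :
  {ae P, forall omega, forall s : R, ~ supp (M omega) s ->
    cvg (truncated_transform (M omega) (- A) A s @[A --> +oo]) /\
    truncated_transform (M omega) (s - LR.1) (s + LR.2) s
        - K * ln (LR.1 / LR.2)
      @[LR --> filter_prod (pinfty_nbhs R) (pinfty_nbhs R)]
      --> transform (M omega) s} /\
  (forall (L Rr : nat -> R) (l : R),
     L n @[n --> \oo] --> +oo ->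
     Rr n @[n --> \oo] --> +oo ->
     ln (L n / Rr n) @[n --> \oo] --> l ->
     forall s : R,
       converges_in_distribution P
         (fun n omega => (pi * K)^-1 *
            truncated_transform (M omega) (s - L n) (s + Rr n) s)
         (cauchy_prob (l / pi) 1)).
Proof.
have reg : {ae P, forall w, regular K (M w)}.
  exact: (ae_regular M_stationary K_gt0 M_intensity h_ge0 h_measurable M_dev h_int).
split.
  by apply: filterS reg => w mu_reg s; exact: (transform_cvg (ltW K_gt0)).
move=> L Rr l cL cR cl s.
exact: (window_converges_in_distribution M_stationary K_gt0 M_intensity reg s cL cR cl).
Qed.
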